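(* Assume the regression setting described in the context, with fixed $\rho\in(-1,1)$ and $\sigma_\varepsilon^2>0$. Let $n\to\infty$ and let $p=p_n$ satisfy $p\to\infty$ and $p/n\to c\in(0,\infty)$. Assume $\sum_{j=1}^\infty\beta_j^2<\infty$. Then $$\frac{\|\mathbb{X}'Y\|_2^2-n^2\kappa_{2,p}-pn(\kappa_{1,p}+\sigma_\varepsilon^2)}{n^{3/2}}\xrightarrow{d}\mathcal N(0,s^2),$$ where $$s^2=4\kappa_2^2+4(\kappa_1+\sigma_\varepsilon^2)(2\kappa_2c+\kappa_3)+2c(\kappa_1+\sigma_\varepsilon^2)^2\Big(c+\frac{1+\rho^2}{1-\rho^2}\Big).$$
   Context: Let $(\beta_j)_{j\ge1}$ be a fixed real sequence, $\rho\in(-1,1)$ and $\sigma_\varepsilon^2>0$ fixed. For each $n$ and $p=p_n$, let $\mathbb X=(X_1,\dots,X_n)'\in\mathbb R^{n\times p}$ have i.i.d. rows $X_i\sim\mathcal N_p(0,\Sigma)$ with $\Sigma=(\rho^{|i-j|})_{i,j=1}^p$ (with $\Sigma=I_p$ when $\rho=0$), let $\varepsilon\sim\mathcal N(0,\sigma_\varepsilon^2I_n)$ be independent of $\mathbb X$, let $\beta=(\beta_1,\dots,\beta_p)'$ and $Y=\mathbb X\beta+\varepsilon$. Define $\kappa_{1,p}=\sum_{k,l=1}^p\beta_k\beta_l\rho^{|k-l|}$, $\kappa_{2,p}=\sum_{k=1}^p\big(\sum_{l=1}^p\beta_l\rho^{|k-l|}\big)^2$, $\kappa_{3,p}=\sum_{k,l,j,j'=1}^p\beta_j\beta_{j'}\rho^{|k-j|}\rho^{|l-j'|}\rho^{|k-l|}$,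 and $\kappa_i=\lim_{p\to\infty}\kappa_{i,p}$ ($i=1,2,3$), which exist and are finite when $\sum_j\beta_j^2<\infty$. $\|\cdot\|_2$ is the Euclidean norm. *)

(* Defs.v *)
From HB Require Import structures.
From mathcomp Require Import all_boot all_order all_algebra.
From mathcomp Require Import all_classical all_reals all_analysis.
Set Implicit Arguments. Unset Strict Implicit. Unset Printing Implicit Defensive.
Import Order.TTheory GRing.Theory Num.Theory.
Import numFieldNormedType.Exports.
Local Open Scope classical_set_scope.
Local Open Scope ring_scope.

Section defs.
Context {R : realType}.

(** Sigma_{kl} = rho^{|k-l|} (with rho^0 = 1, so Sigma = I when rho = 0). *)
Definition sig_entry (rho : R) (k l : nat) : R := rho ^+ (k - l + (l - k))%N.

(** beta is indexed from 0: [beta j] stands for beta_{j+1}. *)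
Definition kappa1 (beta : nat -> R) (rho : R) (p : nat) : R :=
  \sum_(k < p) \sum_(l < p) beta k * beta l * sig_entry rho k l.
Definition kappa2 (beta : nat -> R) (rho : R) (p : nat) : R :=
  \sum_(k < p) (\sum_(l < p) beta l * sig_entry rho k l) ^+ 2.
Definition kappa3 (beta : nat -> R) (rho : R) (p : nat) : R :=
  \sum_(k < p) \sum_(l < p) \sum_(j < p) \sum_(j' < p)
     beta j * beta j' * sig_entry rho k j * sig_entry rho l j' * sig_entry rho k l.

Definition gauss_law (v : R) : set R -> \bar R :=
  if v == 0 then (\d_(0 : R) : set R -> \bar R) else normal_prob 0 (Num.sqrt v).

Context {d : measure_display} {T : measurableType d}.

Definition rect (J : finType) (V : J -> T -> R) (A : J -> set R) : set T :=
  [set w | forall j, A j (V j w)].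

Definition mutual_indep (P : probability T R) (K J : finType)
    (V : K -> J -> T -> R) : Prop :=
  forall A : K -> J -> set R, (forall k j, measurable (A k j)) ->
    P [set w | forall k j, A k j (V k j w)] = (\prod_(k : K) P (rect (V k) (A k)))%E.

Definition indep2 (P : probability T R) (I J : finType)
    (U : I -> T -> R) (V : J -> T -> R) : Prop :=
  forall (A : I -> set R) (B : J -> set R),
    (forall i, measurable (A i)) -> (forall j, measurable (B j)) ->
    P (rect U A `&` rect V B) = (P (rect U A) * P (rect V B))%E.

Definition gauss_vec (P : probability T R) (J : finType)
    (V : J -> T -> R) (S : J -> J -> R) : Prop :=
  forall (t : J -> R) (A : set R), measurable A ->
    P [set w | A (\sum_(j : J) t j * V j w)] =
      gauss_law (\sum_(i : J) \sum_(j : J) t i * S i j * t j) A.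

End defs.

Definition cvg_in_distribution {R : realType} {d : measure_display}
    (T : nat -> measurableType d) (P : forall n, probability (T n) R)
    (Y : forall n, T n -> R) (mu : set R -> \bar R) : Prop :=
  forall x : R, {for x, continuous (fun t : R => fine (mu `]-oo, t]%classic))} ->
    (fun n => fine (P n [set w | Y n w <= x])) @ \oo --> fine (mu `]-oo, x]%classic).

(* Main.v *)
Require Import Defs.
From HB Require Import structures.
From mathcomp Require Import all_boot all_order all_algebra.
From mathcomp Require Import all_classical all_reals all_analysis.
From mathcomp Require Import measurable_realfun.
From mathcomp Require Import ring lra.

(** The statistic depends on the data through q = |Y|^2 and h = W'Y, where W_ik = X_ik - a_k Y_i
    with a = b / tau, b = Sigma beta and tau = kappa_1 + sigma^2, is the residual of the regression of
    X on Y: Y and W are independent Gaussian, and W has row covariance Gamma = Sigma - b b' / tau.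
    Up to a remainder that is negligible in L^1, the normalised statistic is a polynomial F in (q, h),
    and Gaussian integration by parts gives a Stein identity E[F f(F)] = E[f'(F) T] with T again a
    polynomial in (q, h).  All second moments of T are explicit, so that E (T - s^2)^2 -> 0, and the
    solution of Stein's equation for piecewise linear test functions yields the convergence of the
    distribution functions.

    Jointly Gaussian families are handled through E cos (<t, V> + theta), which avoids complex
    characteristic functions; independence of events is turned into factorisation of such expectations
    and back by Gaussian smoothing. *)

Set Implicit Arguments. Unset Strict Implicit. Unset Printing Implicit Defensive.
Import Order.TTheory GRing.Theory Num.Theory.
Import numFieldNormedType.Exports.
Local Open Scope classical_set_scope.
Local Open Scope ring_scope.

(** * Integrals against the normal density *)

(** The statistic splits into three centred, uncorrelated pieces: [2 q <a, h>],
    [|h|^2 - tr(Gamma) q] and [D (q - n tau)]. The slope [D = 2 |a|^2 n tau + tr Gamma] comes from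
    linearising [|a|^2 q^2] at [q = n tau]; the part left out has L^1 norm of order [n], against the
    normalisation [n^(3/2)]. Given [y], [h] is N(0, q Gamma), and [q / tau] is chi-square, so after
    division by [n^3] the variances are about [4 tau^3 a'Gamma a], [2 tau^2 tr(Gamma^2) / n] and
    [2 tau^2 (D / n)^2]; their limits add up to s^2. E (T - s^2)^2 vanishes because Gamma, a
    rank-one correction of Sigma, has bounded operator norm by Schur's test: hence [a'Gamma^3 a / n]
    and [tr(Gamma^4) / n^2] tend to 0. Ramps replace half-line indicators for two reasons:
    integration by parts needs a Stein solution with continuous derivative, and the discarded
    remainder is controlled only through a Lipschitz constant. *)

Section density.
Context d (T : measurableType d) (R : realType).
Variables (nu : {measure set T -> \bar R}) (mu : {measure set T -> \bar R}).
Variable g : T -> R.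
Hypotheses (g0 : forall x, 0 <= g x) (mg : measurable_fun setT g).
Hypothesis nuE : forall A, measurable A -> nu A = (\int[mu]_(x in A) (g x)%:E)%E.

Import HBNNSimple.

Let nnsfunE (f : {nnsfun T >-> R}) :
  (\int[nu]_x (f x)%:E = \int[mu]_x (f x * g x)%:E)%E.
Proof.
under [LHS]eq_integral do rewrite fimfunE -fsumEFin//.
rewrite [LHS]ge0_integral_fsum//; last 2 first.
- by move=> r; exact/measurable_EFinP/measurableT_comp.
- by move=> n x _; rewrite EFinM nnfun_muleindic_ge0.
under [RHS]eq_integral.
  move=> x xD; rewrite EFinM fimfunE -fsumEFin// muleC ge0_mule_fsumr; last first.
    by move=> r; rewrite EFinM nnfun_muleindic_ge0.
  over.
rewrite [RHS]ge0_integral_fsum//; last 2 first.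
- move=> r; apply/measurable_EFinP/measurable_funM => //.
  by do 2 apply/measurableT_comp => //.
- move=> n x _; rewrite EFinM mule_ge0//; last by rewrite nnfun_muleindic_ge0.
  by rewrite lee_fin.
apply: eq_fsbigr => r _.
have [r0|r0] := ltP r 0.
  rewrite integral0_eq ?integral0_eq//.
  - by move=> x _; rewrite preimage_nnfun0// indic0 mulr0 mule0.
  - by move=> x _; rewrite preimage_nnfun0// indic0 mulr0.
rewrite integralZl_indic_nnsfun//= integral_indic// setIT nuE//.
rewrite integral_mkcond -ge0_integralZl//; last 2 first.
- apply/(measurable_restrictT (EFin \o g)) => //.
  exact/measurable_funTS/measurable_EFinP.
- by move=> x _; apply: erestrict_ge0 => {}x _; rewrite lee_fin.
apply: eq_integral => x _; rewrite patchE indicE.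
by case: ifP => _; rewrite -!EFinM; congr EFin => /=; ring.
Qed.

Lemma ge0_integral_density (f : T -> \bar R) :
  measurable_fun setT f -> (forall x, 0 <= f x)%E ->
  (\int[nu]_x f x = \int[mu]_x (f x * (g x)%:E))%E.
Proof.
move=> mf f0.
pose f_ := nnsfun_approx measurableT mf.
transitivity (lim (\int[nu]_x (f_ n x)%:E @[n --> \oo])%E).
  rewrite -monotone_convergence//=.
  - apply: eq_integral => ? /[!inE] xD; apply/esym/cvg_lim => //=.
    exact: cvg_nnsfun_approx.
  - by move=> n; exact/measurable_EFinP/measurable_funTS.
  - by move=> n ? _; rewrite lee_fin.
  - by move=> ? _ ? ? mn; rewrite lee_fin; exact/lefP/nd_nnsfun_approx.
rewrite [RHS](_ : _ = lim (\int[mu]_x (f_ n x * g x)%:E @[n --> \oo])%E).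
  by apply: congr_lim; apply/funext => n /=; exact: nnsfunE.
rewrite -monotone_convergence//=.
- apply: eq_integral => x /[!inE] xD; apply/esym/cvg_lim => //=.
  under eq_fun do rewrite EFinM.
  by apply: cvgeZr => //; exact: cvg_nnsfun_approx.
- by move=> n; apply/measurable_EFinP/measurable_funM.
- by move=> n ? _; rewrite lee_fin mulr_ge0.
- move=> x _ ? ? mn; rewrite lee_fin ler_wpM2r//.
  exact/lefP/nd_nnsfun_approx.
Qed.

Lemma integrable_density (f : T -> R) : measurable_fun setT f ->
  mu.-integrable setT (EFin \o (fun x => f x * g x)) ->
  nu.-integrable setT (EFin \o f).
Proof.
move=> mf /integrableP[_ fg]; apply/integrableP; split.
  exact/measurable_EFinP.
rewrite ge0_integral_density//; last by do 2 apply: measurableT_comp => //.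
apply: le_lt_trans fg; rewrite le_eqVlt; apply/orP; left; apply/eqP.
by apply: eq_integral => x _ /=; rewrite normrM (ger0_norm (g0 x)).
Qed.

Lemma Rintegral_density (f : T -> R) : measurable_fun setT f ->
  mu.-integrable setT (EFin \o (fun x => f x * g x)) ->
  \int[nu]_x f x = \int[mu]_x (f x * g x).
Proof.
move=> mf ifg; have inu := integrable_density mf ifg.
rewrite /Rintegral [in LHS]integralE [in RHS]integralE; congr (fine (_ - _)%E).
  rewrite ge0_integral_density//; last exact/measurable_funepos/measurable_EFinP.
  apply: eq_integral => x _; rewrite /= !funeposE.
  by rewrite -!EFin_max -EFinM maxr_pMl// mul0r.
rewrite ge0_integral_density//; last exact/measurable_funeneg/measurable_EFinP.
apply: eq_integral => x _; rewrite /= !funenegE.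
by rewrite -!EFinN -!EFin_max -EFinM maxr_pMl// mul0r mulNr.
Qed.

End density.

Section normal_law.
Context {R : realType}.
Implicit Types (s x : R) (m : nat).
Local Notation mu := (@lebesgue_measure R).

(** A single term of the exponential series, [y^m / m! <= expR y], taken at [y = a (1 + x^2)]; the
    constant part of [y] gives the factor [expR a]. *)
Lemma poly_le_expR (a : R) m : 0 < a ->
  exists2 C : R, 0 < C & forall x : R, (1 + x ^+ 2) ^+ m <= C * expR (a * x ^+ 2).
Proof.
move=> a0; exists (m`!%:R / a ^+ m * expR a).
  by rewrite !mulr_gt0 ?expR_gt0 ?invr_gt0 ?exprn_gt0 ?ltr0n ?fact_gt0.
move=> x; rewrite -[leRHS]mulrA -expRD -[X in X + a * _]mulr1 -mulrDr.
have y0 : 0 <= a * (1 + x ^+ 2) by apply: mulr_ge0; [exact: ltW|apply: addr_ge0 => //; exact: sqr_ge0].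
have H : (a * (1 + x ^+ 2)) ^+ m <= m`!%:R * expR (a * (1 + x ^+ 2)).
  case: m => [|m]; first by rewrite fact0 expr0 mul1r -[leLHS]expR0 ler_expR.
  have f0 : 0 < (m.+1`!%:R : R) by rewrite ltr0n fact_gt0.
  have := expR_ge1Dxn m y0; rewrite mulrC => H.
  by rewrite -ler_pdivrMl//; apply: le_trans H; rewrite lerDr.
rewrite exprMn in H.
by rewrite mulrAC ler_pdivlMr ?exprn_gt0// mulrC.
Qed.

(** Doubling the standard deviation absorbs any polynomial. This serves both to dominate integrands
    by an integrable density and to kill boundary terms. *)
Lemma normal_pdf_poly_le s m : 0 < s -> exists2 C : R, 0 < C &
  forall x, (1 + x ^+ 2) ^+ m * normal_pdf 0 s x <= C * normal_pdf 0 (2 * s) x.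
Proof.
(* The gap between the two Gaussian exponents: [1 / (2 s^2) - 1 / (8 s^2) = 3 / (8 s^2)]. *)
move=> s0; have a0 : 0 < 3 / (8 * s ^+ 2).
  by rewrite divr_gt0// mulr_gt0// exprn_gt0.
have [C C0 HC] := poly_le_expR m a0.
have s2 : 0 < 2 * s by rewrite mulr_gt0.
have p1 := normal_peak_gt0 (lt0r_neq0 s0).
have p2 := normal_peak_gt0 (lt0r_neq0 s2).
exists (C * normal_peak s / normal_peak (2 * s)); first by rewrite divr_gt0// mulr_gt0.
move=> x; rewrite !normal_pdfE ?gt_eqF//.
rewrite [leRHS]mulrA divfK ?gt_eqF// mulrCA [C * _]mulrC -mulrA ler_pM2l//.
rewrite /normal_fun subr0.
have -> : - x ^+ 2 / (s ^+ 2 *+ 2) =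
  - (3 / (8 * s ^+ 2) * x ^+ 2) + - x ^+ 2 / ((2 * s) ^+ 2 *+ 2).
  by field; rewrite gt_eqF.
rewrite expRD mulrA ler_wpM2r ?expR_ge0// expRN ler_pdivrMr ?expR_gt0//.
Qed.

Lemma integrable_poly_normal_pdf s m (f : R -> R) (K : R) : 0 < s ->
  measurable_fun setT f -> (forall x, `|f x| <= K * (1 + x ^+ 2) ^+ m) ->
  mu.-integrable setT (EFin \o (fun x => f x * normal_pdf 0 s x)).
Proof.
move=> s0 mf fK; have [C C0 HC] := normal_pdf_poly_le m s0.
have i2 : mu.-integrable setT (EFin \o (fun x : R => K * C * normal_pdf 0 (2 * s) x)).
  apply: eq_integrable (integrableZl measurableT (K * C) (integrable_normal_pdf 0 (2 * s))) => //.
have K0 : 0 <= K.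
  have := le_trans (normr_ge0 _) (fK 0).
  by rewrite expr0n addr0 expr1n mulr1.
apply: (le_integrable _ _ _ i2) => //.
  apply/measurable_EFinP; apply: measurable_funM => //.
  exact: measurable_normal_pdf.
move=> x _ /=; rewrite lee_fin !normrM (ger0_norm (normal_pdf_ge0 _ _ _)).
apply: (@le_trans _ _ (K * ((1 + x ^+ 2) ^+ m * normal_pdf 0 s x))).
  by rewrite mulrA ler_wpM2r// normal_pdf_ge0.
rewrite (ger0_norm K0) (ger0_norm (ltW C0)) -[leRHS]mulrA ler_wpM2l//.
by rewrite (ger0_norm (normal_pdf_ge0 _ _ _)).
Qed.

Lemma normal_probE s A : measurable A ->
  normal_prob 0 s A = (\int[mu]_(x in A) (normal_pdf 0 s x)%:E)%E.
Proof. by []. Qed.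

Lemma integrable_normal s m (f : R -> R) (K : R) : 0 < s ->
  measurable_fun setT f -> (forall x, `|f x| <= K * (1 + x ^+ 2) ^+ m) ->
  (normal_prob 0 s).-integrable setT (EFin \o f).
Proof.
move=> s0 mf fK.
have H := (integrable_density (nu := normal_prob 0 s) (mu := mu) (normal_pdf_ge0 0 s)
  (measurable_normal_pdf 0 s) (@normal_probE s) mf).
apply: H => //.
exact: integrable_poly_normal_pdf fK.
Qed.

Lemma Rintegral_normal s m (f : R -> R) (K : R) : 0 < s ->
  measurable_fun setT f -> (forall x, `|f x| <= K * (1 + x ^+ 2) ^+ m) ->
  \int[normal_prob 0 s]_x f x = \int[mu]_x (f x * normal_pdf 0 s x).
Proof.
move=> s0 mf fK.
have H := (Rintegral_density (nu := normal_prob 0 s) (mu := mu) (normal_pdf_ge0 0 s)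
  (measurable_normal_pdf 0 s) (@normal_probE s) mf).
apply: H => //.
exact: integrable_poly_normal_pdf fK.
Qed.

Lemma is_derive_normal_pdf s (x : R) : 0 < s ->
  is_derive x 1 (normal_pdf 0 s) (- (x / s ^+ 2) * normal_pdf 0 s x).
Proof.
move=> s0; rewrite normal_pdfE ?gt_eqF// /normal_fun.
have H : is_derive x (1 : R) (fun x : R => - (x - 0) ^+ 2 / (s ^+ 2 *+ 2)) (- (x / s ^+ 2)).
  apply: is_derive_eq; rewrite /GRing.scale/=.
  by field; rewrite gt_eqF.
have H2 := is_derive1_comp (is_derive_expR _) H.
move: (normal_peak s) => P.
apply: (is_derive_eq (is_deriveM (is_derive_cst _ _ _) H2)).
by rewrite /GRing.scale /=; ring.
Qed.

Lemma cvg_Rintegral_symitv (f : R -> R) : mu.-integrable setT (EFin \o f) ->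
  (fun n : nat => \int[mu]_(x in `[- n%:R, n%:R]) f x) @ \oo --> \int[mu]_x f x.
Proof.
move=> iF; apply: fine_cvg; rewrite fineK; last exact: integrable_fin_num.
have mf := measurable_int _ iF.
pose I (n : nat) : set R := [set` `[(- n%:R : R), (n%:R : R)]].
have mI n : measurable (I n) by exact: measurable_itv.
have [] := @dominated_convergence _ _ _ mu setT measurableT
  (fun n : nat => (EFin \o f) \_ (I n)) (EFin \o f) (abse \o (EFin \o f)).
- move=> n; apply/(measurable_restrictT (EFin \o f)) => //.
  exact: measurable_funTS.
- by [].
- apply: aeW => x _; apply: cvg_near_cst.
  near=> n; rewrite patchE ifT//; apply/mem_set => /=.
  rewrite /I /= in_itv/= -ler_norml; near: n; exact: nbhs_infty_ger.
- exact: integrable_abse.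
- apply: aeW => x n _; rewrite patchE.
  by case: ifP => _; [exact: lexx|rewrite abse0 abse_ge0].
- move=> _ _; apply: cvg_trans; apply: near_eq_cvg; apply: nearW => n /=.
  by rewrite [RHS]integral_mkcond.
Unshelve. all: end_near. Qed.

(** Since the density satisfies [phi' = - (x / s^2) phi], the claim is that [(g phi)'] integrates to
    0. The fundamental theorem on [[-n, n]] leaves boundary values that tend to 0. *)
Lemma normal_ibp s m (K : R) (g dg : R -> R) : 0 < s ->
  (forall x : R, is_derive x (1 : R) g (dg x)) -> continuous dg ->
  (forall x, `|g x| <= K * (1 + x ^+ 2) ^+ m) ->
  (forall x, `|dg x| <= K * (1 + x ^+ 2) ^+ m) ->
  \int[normal_prob 0 s]_x (x * g x) = s ^+ 2 * \int[normal_prob 0 s]_x dg x.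
Proof.
move=> s0 dgE cdg gK dgK.
have cg : continuous g.
  by move=> x; apply/differentiable_continuous/derivable1_diffP; case: (dgE x).
have mg : measurable_fun setT g by exact: continuous_measurable_fun.
have mdg : measurable_fun setT dg by exact: continuous_measurable_fun.
have K0 : 0 <= K.
  have := le_trans (normr_ge0 _) (gK 0).
  by rewrite expr0n addr0 expr1n mulr1.
have mxg : measurable_fun setT (fun x : R => x * g x) by exact: measurable_funM.
have xgK x : `|x * g x| <= K * (1 + x ^+ 2) ^+ m.+1.
  rewrite normrM exprS mulrCA ler_pM//.
  have := sqr_ge0 (`|x| - 1); rewrite -[x ^+ 2]real_normK ?num_real//.
  have := normr_ge0 x; nra.
pose G (x : R) := g x * normal_pdf 0 s x.
pose dG (x : R) := dg x * normal_pdf 0 s x - s ^- 2 * (x * g x * normal_pdf 0 s x).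
have cpdf : continuous (normal_pdf 0 s : R -> R) by apply: continuous_normal_pdf; rewrite gt_eqF.
have i1 := integrable_poly_normal_pdf s0 mdg dgK.
have i2 := integrable_poly_normal_pdf s0 mxg xgK.
have i2' := integrableZl measurableT (s ^- 2) i2.
have idG : mu.-integrable setT (EFin \o dG) by exact: (integrableB _ i1 i2').
rewrite (Rintegral_normal s0 mxg xgK) (Rintegral_normal s0 mdg dgK).
suff : \int[mu]_x dG x = 0.
  rewrite RintegralB// RintegralZl// => /eqP; rewrite subr_eq0 => /eqP ->.
  by rewrite mulrA divff ?mul1r// expf_neq0// gt_eqF.
have dGE (x : R) : is_derive x (1 : R) G (dG x).
  apply: (is_derive_eq (is_deriveM (dgE x) (is_derive_normal_pdf x s0))).
  by rewrite /dG /GRing.scale /=; ring.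
have cdG : continuous dG.
  move=> x; apply: cvgB; first by apply: cvgM; [exact: cdg|exact: cpdf].
  apply: cvgM; first exact: cvg_cst.
  by apply: cvgM; [apply: cvgM; [exact: cvg_id|exact: cg]|exact: cpdf].
have cG : continuous G.
  by move=> x; apply: cvgM; [exact: cg|exact: cpdf].
have dcvg := cvg_Rintegral_symitv idG.
apply: (cvg_unique _ dcvg) => //.
(* One power more than the growth of [g], so that the boundary values decay like [1 / (1 + x^2)]. *)
have [C C0 HC] := normal_pdf_poly_le m.+1 s0.
pose B := K * (C * normal_peak (2 * s)).
have GB x : `|G x| <= B / (1 + x ^+ 2).
  have x1 : 0 < 1 + x ^+ 2 by rewrite ltr_pwDl// sqr_ge0.
  rewrite ler_pdivlMr// normrM (ger0_norm (normal_pdf_ge0 _ _ _)).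
  apply: (@le_trans _ _ (K * ((1 + x ^+ 2) ^+ m.+1 * normal_pdf 0 s x))).
    have -> : K * ((1 + x ^+ 2) ^+ m.+1 * normal_pdf 0 s x) =
      K * (1 + x ^+ 2) ^+ m * normal_pdf 0 s x * (1 + x ^+ 2).
      by rewrite exprSr; ring.
    by rewrite ler_wpM2r ?(ltW x1)// ler_wpM2r ?normal_pdf_ge0.
  rewrite ler_wpM2l//; apply: (le_trans (HC x)).
  by rewrite ler_wpM2l ?(ltW C0)// normal_pdf_ub// gt_eqF// mulr_gt0.
have GB0 (u : nat -> R) : (forall n, (u n) ^+ 2 = n%:R ^+ 2) -> G \o u @ \oo --> 0.
  move=> un; apply: norm_cvg0.
  apply: (@squeeze_cvgr _ _ _ _ (cst 0) (fun n : nat => B * harmonic n)).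
  - apply: nearW => n /=; rewrite normr_ge0/=; apply: (le_trans (GB _)).
    have B0 : 0 <= B.
      by rewrite mulr_ge0// mulr_ge0 ?(ltW C0)// normal_peak_ge0.
    rewrite ler_wpM2l// un lef_pV2 ?posrE// ?ltr_pwDl ?sqr_ge0//.
    rewrite -natr1 addrC lerD2l -natrX ler_nat; case: n => // n.
    by rewrite leq_pmulr.
  - exact: cvg_cst.
  - rewrite -[X in _ --> X](mulr0 B); apply: cvgM; first exact: cvg_cst.
    exact: cvg_harmonic.
have : (fun n : nat => G n%:R - G (- n%:R)) @ \oo --> (0 - 0 : R).
  by apply: cvgB; apply: GB0 => n //=; rewrite sqrrN.
rewrite subr0; apply: cvg_trans; apply: near_eq_cvg.
near=> n.
have n0 : (0 : R) < n%:R by rewrite ltr0n; near: n; exists 1%N.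
rewrite /Rintegral (@continuous_FTC2 _ dG G)//.
- by rewrite gtrN.
- exact: continuous_subspaceT.
- split.
  + by move=> x _; case: (dGE x).
  + by apply: cvg_at_right_filter; exact: cG.
  + by apply: cvg_at_left_filter; exact: cG.
- by move=> x _; rewrite derive1E; case: (dGE x).
Unshelve. all: end_near. Qed.

End normal_law.

(** * The characteristic cosine of a normal law *)

Section rintegral_tools.
Context d (T : measurableType d) (R : realType) (P : probability T R).

Lemma integrable_le_cst (f : T -> R) (C : R) : measurable_fun setT f ->
  (forall x, `|f x| <= C) -> P.-integrable setT (EFin \o f).
Proof.
move=> mf fC; apply: measurable_bounded_integrable => //.
  by rewrite (le_lt_trans (probability_le1 _ _))// ltry.
exists C; split; first exact: num_real.
by move=> x Cx y _; rewrite /= (le_trans (fC y))// ltW.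
Qed.

Lemma Rintegral_prob_cst (c : R) : \int[P]_x c = c.
Proof. by rewrite Rintegral_cst//= probability_setT /= mulr1. Qed.

End rintegral_tools.

Section Rfubini.
Context d1 d2 (T1 : measurableType d1) (T2 : measurableType d2) (R : realType).
Variables (m1 : {sigma_finite_measure set T1 -> \bar R}).
Variables (m2 : {sigma_finite_measure set T2 -> \bar R}).

(** Real integrals are [fine] of extended ones, so integrability of the sections is asked at every
    point: the inner real integral then agrees everywhere with the extended one of Fubini's
    theorem. *)
Lemma Rintegral_prod1 (f : T1 * T2 -> R) : (m1 \x m2)%E.-integrable setT (EFin \o f) ->
  (forall x, m2.-integrable setT (EFin \o (fun y => f (x, y)))) ->
  \int[(m1 \x m2)%E]_z f z = \int[m1]_x \int[m2]_y f (x, y).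
Proof.
move=> intf int1; rewrite /Rintegral -integral12_prod_meas1//; congr fine.
apply: eq_integral => x _; rewrite /fubini_F fineK//.
exact: (integrable_fin_num _ (int1 x)).
Qed.

Lemma Rintegral_prod2 (f : T1 * T2 -> R) : (m1 \x m2)%E.-integrable setT (EFin \o f) ->
  (forall y, m1.-integrable setT (EFin \o (fun x => f (x, y)))) ->
  \int[(m1 \x m2)%E]_z f z = \int[m2]_y \int[m1]_x f (x, y).
Proof.
move=> intf int1; rewrite /Rintegral -integral21_prod_meas1//; congr fine.
apply: eq_integral => x _; rewrite /fubini_G fineK//.
exact: (integrable_fin_num _ (int1 x)).
Qed.

End Rfubini.

Section normal_cos.
Context {R : realType}.

Lemma measurable_cosE : measurable_fun [set: R] (@cos R).
Proof. by apply: continuous_measurable_fun; exact: continuous_cos. Qed.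

Lemma measurable_sinE : measurable_fun [set: R] (@sin R).
Proof. by apply: continuous_measurable_fun; exact: continuous_sin. Qed.

Lemma normr_cos_le1 (x : R) : `|cos x| <= 1.
Proof. by rewrite ler_norml cos_geN1 cos_le1. Qed.

Lemma normr_sin_le1 (x : R) : `|sin x| <= 1.
Proof. by rewrite ler_norml sin_geN1 sin_le1. Qed.

(** Differentiation under the integral followed by integration by parts gives [F' = - s^2 t F] as a
    function of [t]; multiplied by the integrating factor, [F] is constant. The free phase [th]
    covers sines as well, and makes the family stable under products. *)
Lemma normal_cos (s t th : R) : 0 < s ->
  \int[normal_prob 0 s]_x cos (t * x + th) = expR (- (s ^+ 2 * t ^+ 2 / 2)) * cos th.
Proof.
move=> s0.
pose F (t : R) := \int[normal_prob 0 s]_x cos (t * x + th).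
have mcos u : measurable_fun setT (fun x : R => cos (u * x + th)).
  apply: (measurableT_comp measurable_cosE).
  by apply: measurable_funD => //; exact: measurable_funM.
have dF (u : R) : is_derive u (1 : R) F (- (s ^+ 2 * u) * F u).
  have ibp := @normal_ibp R s 1 (1 + `|u|) (fun x => sin (u * x + th)) (fun x => u * cos (u * x + th)) s0.
  have dcos (x y : R) : is_derive x (1 : R) (fun t : R => cos (t * y + th)) (- y * sin (x * y + th)).
    have H : is_derive x (1 : R) (fun t : R => t * y + th) y.
      by apply: is_derive_eq; rewrite /GRing.scale /=; ring.
    apply: (is_derive_eq (is_derive1_comp (is_derive_cos _) H)).
    by ring.
  have p1 (x y : R) : partial1of2 (fun t y : R => cos (t * y + th)) x y = - y * sin (x * y + th).
    by rewrite /partial1of2 derive1E; case: (dcos x y).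
  (* The domination [|y|] is uniform in the parameter, so any bounded neighbourhood of [u] would
     serve. *)
  have Iu : [set` `](u - 1), (u + 1)[] u by rewrite /= in_itv/=; lra.
  have intf (x : R) : [set` `](u - 1), (u + 1)[] x ->
     (normal_prob 0 s).-integrable setT (EFin \o (fun y => cos (x * y + th))).
    by move=> _; apply: (@integrable_le_cst _ _ _ _ _ 1); [exact: mcos|move=> y; exact: normr_cos_le1].
  have intG : (normal_prob 0 s).-integrable setT (EFin \o (fun y : R => `|y|)).
    have b (x : R) : `|(`|x| : R)| <= 1 * (1 + x ^+ 2) ^+ 1.
      rewrite normr_id mul1r; have := sqr_ge0 (`|x| - 1).
      by rewrite -[x ^+ 2]real_normK ?num_real//; nra.
    exact: (integrable_normal s0 (@normr_measurable _ setT) b).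
  have Gub (x y : R) : [set` `](u - 1), (u + 1)[] x -> setT y ->
     `|partial1of2 (fun t y : R => cos (t * y + th)) x y| <= `|y|.
    by move=> _ _; rewrite p1 normrM normrN ler_piMr// normr_sin_le1.
  have dd (x y : R) : [set` `](u - 1), (u + 1)[] x -> setT y -> derivable (fun t : R => cos (t * y + th)) x 1.
    by move=> _ _; case: (dcos x y).
  have D1 := derivable_under_integral measurableT Iu intf dd (fun y => normr_ge0 y) intG Gub.
  have D2 := differentiation_under_integral measurableT Iu intf dd (fun y => normr_ge0 y) intG Gub.
  apply: DeriveDef; first exact: D1.
  rewrite -derive1E D2.
  under eq_Rintegral do rewrite p1 -mulrN1 -mulrA mulN1r.
  have xp (x : R) : 1 <= (1 + `|u|) * (1 + x ^+ 2) ^+ 1.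
    by rewrite expr1 mulr_ege1// ?lerDl// sqr_ge0.
  have msin : measurable_fun setT (fun x : R => sin (u * x + th)).
    apply: (measurableT_comp measurable_sinE).
    by apply: measurable_funD => //; exact: measurable_funM.
  have dlin (x : R) : is_derive x (1 : R) (fun x : R => u * x + th) u.
    by apply: is_derive_eq; rewrite /GRing.scale /=; ring.
  have clin : continuous (fun x : R => u * x + th).
    move=> x; apply/differentiable_continuous/derivable1_diffP.
    by case: (dlin x).
  have {ibp} := ibp _ _ _ _.
  rewrite RintegralZl//; last by apply: (@integrable_le_cst _ _ _ _ _ 1); [exact: mcos|move=> y; exact: normr_cos_le1].
  move=> ibp; under eq_Rintegral do rewrite mulrN.
  have imx : (normal_prob 0 s).-integrable setT (EFin \o (fun x : R => x * sin (u * x + th))).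
    apply: (le_integrable _ _ _ intG) => //.
      by apply/measurable_EFinP/measurable_funM.
    by move=> x _ /=; rewrite lee_fin normrM normr_id ler_piMr// normr_sin_le1.
  under eq_Rintegral do rewrite -mulN1r.
  rewrite RintegralZl//.
  suff -> : \int[normal_prob 0 s]_x (x * sin (u * x + th)) = s ^+ 2 * (u * F u).
    by rewrite mulN1r mulNr mulrA.
  apply: ibp.
  - move=> x; apply: (is_derive_eq (is_derive1_comp (is_derive_sin _) (dlin x))).
    by rewrite mulrC.
  - move=> x; apply: cvgM; first exact: cvg_cst.
    apply: (cvg_comp (fun x : R => u * x + th) cos); first exact: clin.
    exact: continuous_cos.
  - by move=> x; rewrite (le_trans (normr_sin_le1 _)).
  - move=> x; rewrite normrM (@le_trans _ _ (`|u| * 1))//.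
      by rewrite ler_wpM2l// normr_cos_le1.
    rewrite mulr1 expr1 (@le_trans _ _ (1 + `|u|)) ?lerDr//.
    by rewrite ler_peMr ?lerDl ?sqr_ge0// addr_ge0.
pose H (t : R) := F t * expR (s ^+ 2 * t ^+ 2 / 2).
have dH (u : R) : is_derive u (1 : R) H 0.
  have dE : is_derive u (1 : R) (fun t : R => s ^+ 2 * t ^+ 2 / 2) (s ^+ 2 * u).
    by apply: is_derive_eq; rewrite /GRing.scale /=; field.
  apply: (is_derive_eq (is_deriveM (dF u) (is_derive1_comp (is_derive_expR _) dE))).
  by rewrite /GRing.scale /=; ring.
have := is_derive_0_is_cst t 0 dH.
rewrite /H /F expr0n mulr0 mul0r expR0 mulr1.
under [in RHS]eq_Rintegral do rewrite mul0r add0r.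
rewrite Rintegral_prob_cst expRN => <-.
by rewrite mulrC mulfK// gt_eqF// expR_gt0.
Qed.

End normal_cos.

(** * A bounded variable is determined by its cosine transform *)

Section Rfubini_bounded.
Context d1 d2 (T1 : measurableType d1) (T2 : measurableType d2) (R : realType).
Variables (m1 : probability T1 R) (m2 : probability T2 R).

Lemma integrable_prod_le_cst (f : T1 * T2 -> R) (C : R) : measurable_fun setT f ->
  (forall z, `|f z| <= C) -> (m1 \x m2)%E.-integrable setT (EFin \o f).
Proof.
move=> mf fC; apply/integrable12ltyP; first exact/measurable_EFinP.
apply: (@le_lt_trans _ _ (\int[m1]_x (\int[m2]_y C%:E))%E).
  have C0 (z : T1 * T2) : (0 <= C%:E)%E by rewrite lee_fin (le_trans (normr_ge0 _) (fC z)).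
  have mnf : measurable_fun setT (abse \o (EFin \o f)).
    by apply: measurableT_comp => //; exact/measurable_EFinP.
  apply: ge0_le_integral => //.
  - by move=> x _; apply: integral_ge0 => y _.
  - by apply: (@measurable_fun_fubini_tonelli_F _ _ _ _ _ m2 (abse \o (EFin \o f))) => // z; exact: abse_ge0.
  - move=> x _; apply: ge0_le_integral => //.
    + exact: (measurableT_comp mnf (pair1_measurable x)).
    + by move=> y _; rewrite lee_fin.
have E (x : T1) : (\int[m2]_y C%:E = C%:E)%E.
  by rewrite integral_cst//= probability_setT mule1.
under eq_integral => t _ do rewrite (E t).
by rewrite integral_cst//= probability_setT mule1 ltry.
Qed.

Lemma Rfubini_bounded (f : T1 * T2 -> R) (C : R) : measurable_fun setT f ->
  (forall z, `|f z| <= C) ->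
  \int[m1]_x \int[m2]_y f (x, y) = \int[m2]_y \int[m1]_x f (x, y).
Proof.
move=> mf fC; have iF := integrable_prod_le_cst mf fC.
rewrite -(Rintegral_prod1 iF) -?(Rintegral_prod2 iF)//.
- move=> y; apply: (@integrable_le_cst _ _ _ _ _ C) => //.
  exact: (measurableT_comp mf (pair2_measurable y)).
- move=> x; apply: (@integrable_le_cst _ _ _ _ _ C) => //.
  exact: (measurableT_comp mf (pair1_measurable x)).
Qed.

End Rfubini_bounded.

Section Rdominated.
Context d (T : measurableType d) (R : realType) (P : probability T R).

Lemma normr_Rintegral_le (f : T -> R) (C : R) : measurable_fun setT f ->
  (forall x, `|f x| <= C) -> `|\int[P]_x f x| <= C.
Proof.
move=> mf fC; have iF := integrable_le_cst P mf fC.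
rewrite (le_trans (le_normr_Rintegral _ iF))// -[leRHS](Rintegral_prob_cst P C).
apply: le_Rintegral => //; first exact: integrable_norm.
by apply: (@integrable_le_cst _ _ _ _ _ `|C|).
Qed.

Lemma bounded_Rintegral_cvg (f_ : nat -> T -> R) (f : T -> R) (C : R) :
  (forall n, measurable_fun setT (f_ n)) ->
  (forall x, f_ n x @[n --> \oo] --> f x) ->
  (forall n x, `|f_ n x| <= C) ->
  \int[P]_x f_ n x @[n --> \oo] --> \int[P]_x f x.
Proof.
move=> mf_ f_f fC.
have mf : measurable_fun setT f by exact: measurable_fun_cvg (fun x _ => f_f x).
have iC : P.-integrable setT (EFin \o (fun _ : T => C)).
  by apply: (@integrable_le_cst _ _ _ _ _ `|C|).
have [] := @dominated_convergence _ _ _ P setT measurableT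
  (fun n x => (f_ n x)%:E) (EFin \o f) (EFin \o (fun _ => C)).
- by move=> n; exact/measurable_EFinP.
- exact/measurable_EFinP.
- by apply: aeW => x _; apply: cvg_EFin; [exact: nearW|exact: f_f].
- exact: iC.
- by apply: aeW => x n _; rewrite lee_fin.
move=> iF _ cvgF.
apply: fine_cvg; rewrite fineK //; exact: integrable_fin_num.
Qed.

End Rdominated.

Section normal_shift.
Context (R : realType).
Local Notation mu := (@lebesgue_measure R).

Lemma Rintegral_normal_shift (f : R -> R) (x s : R) : 0 < s ->
  continuous f -> (forall y, 0 <= f y <= 1) ->
  \int[mu]_y (f y * normal_pdf x s y) = \int[normal_prob 0 1]_z f (x + s * z).
Proof.
move=> s0 cf f01.
have mfs : measurable_fun setT (fun z : R => f (x + s * z)).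
  apply: measurableT_comp; first exact: continuous_measurable_fun.
  by apply: measurable_funD => //; exact: measurable_funM.
have fs1 z : `|f (x + s * z)| <= 1 * (1 + z ^+ 2) ^+ 0.
  by rewrite expr0 mulr1 ger0_norm; case/andP: (f01 (x + s * z)).
rewrite (Rintegral_normal ltr01 mfs fs1) /Rintegral; apply: (congr1 fine).
have dF (z : R) : is_derive z (1 : R) (fun z : R => x + s * z) s.
  by apply: is_derive_eq; rewrite /GRing.scale/=; ring.
have F'E : (fun z : R => x + s * z)^`()%classic = cst s.
  by apply/funext => z; rewrite derive1E; case: (dF z).
rewrite (@increasing_ge0_integration_by_substitutionT R (fun z : R => x + s * z)
  (fun y => f y * normal_pdf x s y)).
- apply: eq_integral => z _; rewrite F'E /=; congr EFin.
  rewrite /= !fctE /= -mulrA; congr (_ * _).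
  rewrite !normal_pdfE ?gt_eqF// /normal_fun /normal_peak.
  rewrite mulrAC; congr (_ * expR _).
    rewrite expr1n mul1r -[s ^+ 2 * pi *+ 2]mulrnAr sqrtrM ?sqr_ge0// sqrtr_sqr gtr0_norm// invfM.
    by rewrite mulrAC mulVf ?mul1r// gt_eqF.
  by field; rewrite gt_eqF.
- by move=> a b ab; rewrite ltrD2l ltr_pM2l.
- by rewrite F'E => ?; exact: cvg_cst.
- by rewrite F'E; exact: is_cvg_cst.
- by rewrite F'E; exact: is_cvg_cst.
- by move=> z; case: (dF z).
- exact: (cvg_comp _ _ (gt0_cvgMrNy s0 cvg_id) (cvg_addrl_Ny x)).
- exact: (cvg_comp _ _ (gt0_cvgMry s0 cvg_id) (cvg_addrl x)).
- move=> z; apply: cvgM; first exact: cf.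
  by apply: continuous_normal_pdf; rewrite gt_eqF.
- by move=> z; rewrite mulr_ge0 ?normal_pdf_ge0//; case/andP: (f01 z).
Qed.
End normal_shift.

(** The ramp of slope [-m] that ends at [b]: for [m > 0] it is 1 up to [b - 1/m] and 0 from [b] on.
    For [m = 0] it is identically 0, hence the successors in its later uses. *)
Definition step (R : realType) (b : R) (m : nat) : R -> R :=
  (cst 1 : R -> R^o) \min ((cst 0 : R -> R^o) \max (fun y => m%:R * (b - y))).

Lemma step01 (R : realType) (b : R) m y : 0 <= step b m y <= 1.
Proof. by rewrite /step /= le_min ge_min lexx ler01 le_max lexx. Qed.

Lemma continuous_step (R : realType) (b : R) m : continuous (step b m).
Proof.
move=> y; apply: continuous_min; first exact: cst_continuous.
apply: continuous_max; first exact: cst_continuous.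
apply: cvgM; first exact: cvg_cst.
by apply: cvgB; [exact: cvg_cst|exact: cvg_id].
Qed.

(** * Gaussian smoothing of a weighted law *)

Section cos_smooth.
Context d (T : measurableType d) (R : realType) (P : probability T R).
Local Notation mu := (@lebesgue_measure R).
Variables (xi phi : T -> R) (C : R).
Hypotheses (mxi : measurable_fun setT xi) (mphi : measurable_fun setT phi).
Hypothesis phiC : forall w, `|phi w| <= C.
Let H (t th : R) := \int[P]_w (phi w * cos (t * xi w + th)).

Let C0 : 0 <= C.
Proof. by rewrite (le_trans (normr_ge0 _) (phiC point)). Qed.

(** The Gaussian density is its own cosine transform: at [y] it equals [normal_peak s] times the
    mean of [cos ((xi - y) / s * z)] for [z] standard normal. Exchanging the integrals leaves only
    values of [H]. *)
Let smooth_pdf (s y : R) : 0 < s -> \int[P]_w (phi w * normal_pdf (xi w) s y) =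
  normal_peak s * \int[normal_prob 0 1]_z H (z / s) (- y / s * z).
Proof.
move=> s0.
have pdfE w : phi w * normal_pdf (xi w) s y = normal_peak s *
  \int[normal_prob 0 1]_z (phi w * cos ((xi w - y) / s * z)).
  rewrite RintegralZl//; last first.
    apply: (@integrable_le_cst _ _ _ _ _ 1); last by move=> z; exact: normr_cos_le1.
    by apply: (measurableT_comp measurable_cosE); exact: measurable_funM.
  have := @normal_cos R 1 ((xi w - y) / s) 0 ltr01.
  under eq_Rintegral do rewrite addr0.
  move=> ->; rewrite cos0 mulr1 normal_pdfE ?gt_eqF// mulrCA; congr (_ * (_ * expR _)).
  by field; rewrite gt_eqF.
under eq_Rintegral do rewrite pdfE.
have mf : measurable_fun setT (fun z : T * R => phi z.1 * cos ((xi z.1 - y) / s * z.2)).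
  apply: measurable_funM; first exact: (measurableT_comp mphi measurable_fst).
  apply: (measurableT_comp measurable_cosE); apply: measurable_funM => //.
  apply: measurable_funM => //; apply: measurable_funB => //.
  exact: (measurableT_comp mxi measurable_fst).
have fC (z : T * R) : `|phi z.1 * cos ((xi z.1 - y) / s * z.2)| <= C.
  by rewrite normrM -[C]mulr1 ler_pM// normr_cos_le1.
rewrite RintegralZl//; last first.
  have := integrable_fubini_F (integrable_prod_le_cst P (normal_prob 0 1) mf fC).
  apply: eq_integrable => //= w _; rewrite /fubini_F /Rintegral fineK//.
  apply: integrable_fin_num => //.
  apply: (@integrable_le_cst _ _ _ _ _ C); last by move=> z; exact: (fC (w, z)).
  exact: (measurableT_comp mf (pair1_measurable w)).
rewrite (Rfubini_bounded P (normal_prob 0 1) mf fC) /=; congr (_ * _).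
apply: eq_Rintegral => z _; apply: eq_Rintegral => w _.
by congr (_ * cos _); field; rewrite gt_eqF.
Qed.

(** A real form of Fourier inversion: the right-hand side depends on [xi] and on the signed weight
    [phi] only through the cosine transforms. The preliminary smoothing makes every exchange of
    integrals absolutely convergent. *)
Lemma cos_smooth (f : R -> R) (s : R) : 0 < s -> continuous f -> (forall y, 0 <= f y <= 1) ->
  \int[P]_w (phi w * \int[normal_prob 0 1]_z f (xi w + s * z)) =
  \int[mu]_y (f y * (normal_peak s *
    \int[normal_prob 0 1]_z \int[P]_w (phi w * cos (z / s * xi w + - y / s * z)))).
Proof.
move=> s0 cf f01.

pose g (z : T * R) := phi z.1 * (f z.2 * normal_pdf (xi z.1) s z.2).
have mf : measurable_fun setT f by exact: continuous_measurable_fun.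
have mg : measurable_fun setT g.
  apply: measurable_funM; first exact: (measurableT_comp mphi measurable_fst).
  apply: measurable_funM; first exact: (measurableT_comp mf measurable_snd).
  rewrite (_ : (fun _ => _) = fun z : T * R => normal_peak s * expR (- (z.2 - xi z.1) ^+ 2 / (s ^+ 2 *+ 2))); last first.
    by apply/funext => z; rewrite normal_pdfE ?gt_eqF.
  apply: measurable_funM => //; apply: (measurableT_comp (@measurable_expR R)).
  apply: measurable_funM => //; apply: measurableT_comp => //=.
  apply: measurable_funX; apply: measurable_funB => //.
  exact: (measurableT_comp mxi measurable_fst).
have gC w y : `|g (w, y)| <= C * normal_pdf (xi w) s y.
  rewrite normrM ler_pM// normrM (ger0_norm (normal_pdf_ge0 _ _ _)).
  by rewrite ler_piMl ?normal_pdf_ge0//; case/andP: (f01 y) => ? ?; rewrite ger0_norm.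
have iy w : mu.-integrable setT (EFin \o (fun y => g (w, y))).
  have i2 := integrableZl measurableT C (integrable_normal_pdf (xi w) s).
  apply: (le_integrable _ _ _ i2) => //.
    by apply/measurable_EFinP; exact: (measurableT_comp mg (pair1_measurable w)).
  move=> y _; rewrite -EFinM lee_fin (le_trans (gC w y))//.
  by rewrite ger0_norm// mulr_ge0// normal_pdf_ge0.
have iw y : P.-integrable setT (EFin \o (fun w => g (w, y))).
  apply: (@integrable_le_cst _ _ _ _ _ (C * normal_peak s)).
    exact: (measurableT_comp mg (pair2_measurable y)).
  by move=> w; rewrite (le_trans (gC w y))// ler_wpM2l// normal_pdf_ub// gt_eqF.
have ig : (P \x mu)%E.-integrable setT (EFin \o g).
  apply/integrable12ltyP; first exact/measurable_EFinP.
  apply: (@le_lt_trans _ _ (\int[P]_w C%:E)%E).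
    have mng : measurable_fun setT (abse \o (EFin \o g)).
      by apply: measurableT_comp => //; exact/measurable_EFinP.
    apply: ge0_le_integral => //.
    - by move=> x _; apply: integral_ge0 => y _.
    - by apply: (@measurable_fun_fubini_tonelli_F _ _ _ _ _ mu (abse \o (EFin \o g))) => // z; exact: abse_ge0.
    - move=> w _; apply: (@le_trans _ _ (\int[mu]_y (C%:E * (normal_pdf (xi w) s y)%:E))%E).
        apply: ge0_le_integral => //.
        + by have /integrable_abse/measurable_int := iy w.
        + by apply/measurable_EFinP; apply: measurable_funM => //; exact: measurable_normal_pdf.
        + by move=> y _; rewrite -EFinM lee_fin.
      rewrite ge0_integralZl//.
      + by rewrite integral_normal_pdf mule1.
      + by apply/measurable_EFinP; exact: measurable_normal_pdf.
      + by move=> y _; rewrite lee_fin normal_pdf_ge0.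
  by rewrite integral_cst//= probability_setT mule1 ltry.
transitivity (\int[P]_w \int[mu]_y g (w, y)).
  apply: eq_Rintegral => w _; rewrite -Rintegral_normal_shift//.
  rewrite /g /= RintegralZl//.
  have i2 := integrable_normal_pdf (xi w) s.
  apply: (le_integrable _ _ _ i2) => //.
    by apply/measurable_EFinP; apply: measurable_funM => //; exact: measurable_normal_pdf.
  move=> y _; rewrite lee_fin normrM ler_piMl//.
  by case/andP: (f01 y) => ? ?; rewrite ger0_norm.
rewrite -(Rintegral_prod1 ig iy) (Rintegral_prod2 ig iw).
apply: eq_Rintegral => y _; rewrite /g /=.
have E w : phi w * (f y * normal_pdf (xi w) s y) = f y * (phi w * normal_pdf (xi w) s y).
  by rewrite mulrCA.
under eq_Rintegral do rewrite E.
rewrite RintegralZl//; first by rewrite smooth_pdf.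
apply: (@integrable_le_cst _ _ _ _ _ (C * normal_peak s)).
  apply: measurable_funM => //.
  rewrite (_ : (fun _ => _) = fun w => normal_peak s * expR (- (y - xi w) ^+ 2 / (s ^+ 2 *+ 2))); last first.
    by apply/funext => z; rewrite normal_pdfE ?gt_eqF.
  apply: measurable_funM => //; apply: (measurableT_comp (@measurable_expR R)).
  apply: measurable_funM => //; apply: measurableT_comp => //=.
  by apply: measurable_funX; apply: measurable_funB.
move=> w; rewrite normrM ler_pM// ger0_norm ?normal_pdf_ge0//.
by rewrite normal_pdf_ub// gt_eqF.
Qed.

Lemma mollify_cvg (f : R -> R) : continuous f -> (forall y, 0 <= f y <= 1) ->
  \int[P]_w (phi w * \int[normal_prob 0 1]_z f (xi w + harmonic n * z)) @[n --> \oo] -->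
  \int[P]_w (phi w * f (xi w)).
Proof.
move=> cf f01.
have mf : measurable_fun setT f by exact: continuous_measurable_fun.
have f1 y : `|f y| <= 1 by case/andP: (f01 y) => ? ?; rewrite ger0_norm.
have mfs x (n : nat) : measurable_fun setT (fun z : R => f (x + harmonic n * z)).
  apply: measurableT_comp => //.
  by apply: measurable_funD => //; exact: measurable_funM.
have K w : \int[normal_prob 0 1]_z f (xi w + harmonic n * z) @[n --> \oo] --> f (xi w).
  rewrite -[X in _ --> X](Rintegral_prob_cst (normal_prob 0 1)).
  apply: (@bounded_Rintegral_cvg _ _ _ _ _ _ 1) => //; first by move=> n; exact: mfs.
  move=> z; apply: continuous_cvg; first exact: cf.
  rewrite -[X in _ --> X]addr0 -[X in _ --> _ + X](mul0r z).
  apply: cvgD; first exact: cvg_cst.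
  by apply: cvgM; [exact: cvg_harmonic|exact: cvg_cst].
have mK n : measurable_fun setT (fun w => \int[normal_prob 0 1]_z f (xi w + harmonic n * z)).
  have mG : measurable_fun setT (fun z : T * R => f (xi z.1 + harmonic n * z.2)).
    apply: measurableT_comp => //; apply: measurable_funD.
      exact: (measurableT_comp mxi measurable_fst).
    by apply: measurable_funM.
  have /measurable_int mI := integrable_fubini_F (integrable_prod_le_cst P (normal_prob 0 1) mG (fun z => f1 _)).
  exact: (measurableT_comp (@fine_measurable R setT _) mI).
apply: (@bounded_Rintegral_cvg _ _ _ _ _ _ C).
  - by move=> n; exact: measurable_funM.
  - by move=> w; apply: cvgM; [exact: cvg_cst|exact: K].
  - move=> n w; rewrite normrM -[C]mulr1 ler_pM//.
    by apply: normr_Rintegral_le => //; exact: mfs.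
Qed.

Lemma cvg_step_ray (b : R) :
  \int[P]_w (phi w * step b m (xi w)) @[m --> \oo] --> \int[P]_w (phi w * \1_`]-oo, b[ (xi w)).
Proof.
have lim y : step b m y @[m --> \oo] --> (\1_`]-oo, b[ y : R).
  apply: cvg_near_cst; rewrite indicE /step /=; have [yb|by_] := ltP y b.
    rewrite mem_set /=; last by rewrite in_itv.
    near=> m; apply/min_idPl; rewrite le_max; apply/orP; right.
    rewrite -ler_pdivrMr ?subr_gt0//; near: m; exact: nbhs_infty_ger.
  rewrite memNset /=; last by rewrite in_itv/=; apply/negP; rewrite -leNgt.
  apply: nearW => m; rewrite (_ : Num.max _ _ = 0); first by apply/min_idPr.
  by apply/max_idPl; rewrite mulr_ge0_le0// subr_le0.
apply: (@bounded_Rintegral_cvg _ _ _ _ _ _ C).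
  - move=> n; apply: measurable_funM => //; apply: measurableT_comp => //.
    by apply: continuous_measurable_fun; exact: continuous_step.
  - by move=> w; apply: cvgM; [exact: cvg_cst|exact: lim].
  - move=> n w; rewrite normrM -[C]mulr1 ler_pM// ger0_norm; by case/andP: (step01 b n (xi w)).
Unshelve. all: end_near. Qed.

Lemma integrable_mul_indic (B : set R) : measurable B -> P.-integrable setT (EFin \o (fun w => phi w * \1_B (xi w))).
Proof.
move=> mB; apply: (@integrable_le_cst _ _ _ _ _ C).
  by apply: measurable_funM => //; apply: measurableT_comp => //; exact: measurable_indic.
by move=> w; rewrite normrM -[C]mulr1 ler_pM// indicE; case: (_ \in _); rewrite ?normr1 ?normr0.
Qed.

Lemma cvg_indic_bigcup (F : (set R)^nat) : (forall n, measurable (F n)) ->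
  trivIset setT F ->
  (fun n => \sum_(k < n) \int[P]_w (phi w * \1_(F k) (xi w))) @ \oo -->
    \int[P]_w (phi w * \1_(\bigcup_k F k) (xi w)).
Proof.
move=> mF tF.
  pose S n x : R := \sum_(k < n) \1_(F k) x.
  have S1 k n x : F k x -> S n x = (k < n)%N%:R.
    move=> Fkx; elim: n => [|n IH]; first by rewrite /S big_ord0.
    rewrite /S big_ord_recr /= -/(S n x) IH ltnS [(k <= n)%N]leq_eqVlt indicE.
    have [kn|kn] := eqVneq k n.
      by rewrite -kn ltnn mem_set//= add0r.
    rewrite memNset ?addr0// => Fnx; move/eqP : kn; apply.
    by apply: tF => //; exists x.
  have S0 n x : (~ exists k, F k x) -> S n x = 0.
    move=> nF; apply: big1 => k _; rewrite indicE memNset// => Fk.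
    by apply: nF; exists k.
  have limS x : S n x @[n --> \oo] --> (\1_(\bigcup_k F k) x : R).
    apply: cvg_near_cst; rewrite indicE.
    have [[k Fk]|nF] := pselect (exists k, F k x).
      rewrite mem_set; last by exists k.
      by exists k.+1 => // n /= kn; rewrite (S1 k)// kn.
    rewrite memNset; last by move=> [k _ Fk]; apply: nF; exists k.
    by apply: nearW => n; rewrite S0.
  have mS n : measurable_fun setT (S n).
    by apply: measurable_sum => k; exact: measurable_indic.
  have nS n x : `|S n x| <= 1.
    have [[k Fk]|nF] := pselect (exists k, F k x).
      by rewrite (S1 k)//; case: (k < n)%N; rewrite ?normr1 ?normr0.
    by rewrite S0// normr0.
  have cS : \int[P]_w (phi w * S n (xi w)) @[n --> \oo] -->
    \int[P]_w (phi w * \1_(\bigcup_k F k) (xi w)).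
    apply: (@bounded_Rintegral_cvg _ _ _ _ _ _ C).
    + by move=> n; apply: measurable_funM => //; exact: measurableT_comp.
    + by move=> w; apply: cvgM; [exact: cvg_cst|exact: limS].
    + by move=> n w; rewrite normrM -[C]mulr1 ler_pM.
  apply: cvg_trans cS; apply: near_eq_cvg; apply: nearW; elim=> [|n IH].
    under eq_Rintegral do rewrite /S big_ord0 mulr0.
    by rewrite Rintegral_prob_cst big_ord0.
  under eq_Rintegral do rewrite /S big_ord_recr /= mulrDr.
  rewrite RintegralD//; first by rewrite IH big_ord_recr.
    apply: (@integrable_le_cst _ _ _ _ _ C).
      by apply: measurable_funM => //; exact: measurableT_comp (mS n) mxi.
    by move=> w; rewrite normrM -[C]mulr1 ler_pM// nS.
  exact: integrable_mul_indic.
Qed.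

End cos_smooth.

(** * Uniqueness of a weighted law from its cosine transform *)

Section cos_unique.
Context d1 d2 (T1 : measurableType d1) (T2 : measurableType d2) (R : realType).
Variables (P1 : probability T1 R) (P2 : probability T2 R).
Variables (xi1 phi1 : T1 -> R) (xi2 phi2 : T2 -> R) (C : R).
Hypotheses (mxi1 : measurable_fun setT xi1) (mphi1 : measurable_fun setT phi1).
Hypotheses (mxi2 : measurable_fun setT xi2) (mphi2 : measurable_fun setT phi2).
Hypotheses (phiC1 : forall w, `|phi1 w| <= C) (phiC2 : forall w, `|phi2 w| <= C).
Hypothesis H : forall t th : R, \int[P1]_w (phi1 w * cos (t * xi1 w + th)) =
  \int[P2]_w (phi2 w * cos (t * xi2 w + th)).

Let unique_cont (f : R -> R) : continuous f -> (forall y, 0 <= f y <= 1) ->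
  \int[P1]_w (phi1 w * f (xi1 w)) = \int[P2]_w (phi2 w * f (xi2 w)).
Proof.
move=> cf f01.
have c1 := mollify_cvg (P := P1) mxi1 mphi1 phiC1 cf f01.
have c2 := mollify_cvg (P := P2) mxi2 mphi2 phiC2 cf f01.
apply: (cvg_unique _ c1) => //; apply: cvg_trans c2; apply: near_eq_cvg.
apply: nearW => n.
have E1 := cos_smooth P1 mxi1 mphi1 phiC1 (harmonic_gt0 n) cf f01.
have E2 := cos_smooth P2 mxi2 mphi2 phiC2 (harmonic_gt0 n) cf f01.
apply: (etrans E2); apply/esym; apply: (etrans E1).
apply: eq_Rintegral => y _; congr (_ * (_ * _)); apply: eq_Rintegral => z _.
by rewrite H.
Qed.

(** The signed measures [B |-> E[phi 1_B(xi)]] agree on smoothed functions, hence on continuous ones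
    as the smoothing variance tends to 0, hence on open half-lines as ramps increase to their
    indicators, hence on Borel sets by Dynkin's lemma. The weights are what later allows
    independence to be proved one coordinate at a time. *)
Lemma cos_unique (B : set R) : measurable B ->
  \int[P1]_w (phi1 w * \1_B (xi1 w)) = \int[P2]_w (phi2 w * \1_B (xi2 w)).
Proof.
move=> mB.
have PT : \int[P1]_w phi1 w = \int[P2]_w phi2 w.
  have := H 0 0; under eq_Rintegral do rewrite mul0r add0r cos0 mulr1.
  by under [in RHS]eq_Rintegral do rewrite mul0r add0r cos0 mulr1.
pose G := @RGenInftyO.G R.
have mG : @measurable _ R = <<s G >> by exact: RGenInftyO.measurableE.
have mBs : <<s G >> B by rewrite -mG.
apply: (@dynkin_induction _ R G
  (fun B => \int[P1]_w (phi1 w * \1_B (xi1 w)) = \int[P2]_w (phi2 w * \1_B (xi2 w))) mG _ _ _ _ _ B) => //.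
- move=> _ _ [x ->] [y ->]; exists (Num.min x y).
  by apply/seteqP; split => z /=; rewrite !in_itv/= lt_min => /andP.
- under eq_Rintegral do rewrite indicT mulr1.
  by under [in RHS]eq_Rintegral do rewrite indicT mulr1.
- move=> _ [x ->].
  have c1 := cvg_step_ray (P := P1) mxi1 mphi1 phiC1 (b := x).
  have c2 := cvg_step_ray (P := P2) mxi2 mphi2 phiC2 (b := x).
  apply: (cvg_unique _ c1) => //; apply: cvg_trans c2; apply: near_eq_cvg.
  by apply: nearW => n; apply/esym/unique_cont; [exact: continuous_step|exact: step01].
- move=> S mS HS.
  have E (u v : R) : u * \1_(~` S) v = u - u * \1_S v.
    by rewrite !indicE in_setC; case: (_ \in _) => /=; ring.
  under eq_Rintegral do rewrite E.
  under [in RHS]eq_Rintegral do rewrite E.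
  rewrite !RintegralB//; first by rewrite PT HS.
  + exact: (@integrable_le_cst _ _ _ _ _ C).
  + exact: integrable_mul_indic.
  + exact: (@integrable_le_cst _ _ _ _ _ C).
  + exact: integrable_mul_indic.
- move=> F mF tF HF.
  have c1 := cvg_indic_bigcup (P := P1) mxi1 mphi1 phiC1 mF tF.
  have c2 := cvg_indic_bigcup (P := P2) mxi2 mphi2 phiC2 mF tF.
  apply: (cvg_unique _ c1) => //; apply: cvg_trans c2; apply: near_eq_cvg.
  by apply: nearW => n; apply: eq_bigr => k _; rewrite HF.
Qed.

End cos_unique.

(** * Independence and factorisation of integrals *)

Definition to_mfun d d' (T : measurableType d) (T' : measurableType d') (f : T -> T')
  (mf : measurable_fun setT f) : {mfun T >-> T'} :=
  HB.pack f (isMeasurableFun.Build _ _ _ _ _ mf).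

Section product_law.
Context d d1 d2 (T : measurableType d) (T1 : measurableType d1) (T2 : measurableType d2).
Context (R : realType) (P : probability T R).
Variables (X1 : {mfun T >-> T1}) (X2 : {mfun T >-> T2}).
Hypothesis indepX : forall A B, measurable A -> measurable B ->
  P (X1 @^-1` A `&` X2 @^-1` B) = (P (X1 @^-1` A) * P (X2 @^-1` B))%E.

Let mX12 : measurable_fun setT (fun w => (X1 w, X2 w)).
Proof. exact: measurable_fun_pair. Qed.
Let X12 : {mfun T >-> (T1 * T2)%type} := to_mfun mX12.

Let lawE (S : set (T1 * T2)) : measurable S ->
  (distribution P X1 \x distribution P X2)%E S = distribution P X12 S.
Proof.
move=> mS; apply: product_measure_unique => // A B mA mB.
Qed.

Lemma Rintegral_indep (f : T1 * T2 -> R) : measurable_fun setT f ->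
  P.-integrable setT (EFin \o (fun w => f (X1 w, X2 w))) ->
  (forall x, (distribution P X2).-integrable setT (EFin \o (fun y => f (x, y)))) ->
  \int[P]_w f (X1 w, X2 w) = \int[P]_w \int[distribution P X2]_y f (X1 w, y).
Proof.
move=> mf intf intf1.
have mEf : measurable_fun setT (EFin \o f) by exact/measurable_EFinP.
have i12 : (distribution P X12).-integrable setT (EFin \o f).
  exact: (integrable_pushforward mX12 mEf intf).
have iprod : (distribution P X1 \x distribution P X2)%E.-integrable setT (EFin \o f).
  apply/integrableP; split => //.
  rewrite (@eq_measure_integral _ _ _ _ (distribution P X12)).
    by case/integrableP : i12.
  by move=> A mA _; exact: lawE.
have -> : \int[P]_w f (X1 w, X2 w) = \int[distribution P X12]_z f z.
  by rewrite /Rintegral (integral_pushforward mX12 mEf)//.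
have -> : \int[distribution P X12]_z f z =
    \int[(distribution P X1 \x distribution P X2)%E]_z f z.
  rewrite /Rintegral; congr fine; apply: eq_measure_integral => A mA _.
  exact/esym/lawE.
rewrite (Rintegral_prod1 iprod intf1).
have iG := integrable_fubini_F iprod.
have mG : measurable_fun setT (fun x => \int[distribution P X2]_y f (x, y)).
  exact: (measurableT_comp (@fine_measurable R setT _) (measurable_int _ iG)).
have iG' : (distribution P X1).-integrable setT
    (EFin \o (fun x => \int[distribution P X2]_y f (x, y))).
  apply: eq_integrable iG => //= x _; rewrite /fubini_F /Rintegral fineK//.
  by apply: integrable_fin_num => //; exact: intf1.
rewrite /Rintegral; congr fine.
have mG' : measurable_fun setT (EFin \o (fun x => \int[distribution P X2]_y f (x, y))).
  exact/measurable_EFinP.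
rewrite integral_distribution//.
move/integrableP : iG' => [_]; rewrite ge0_integral_distribution//; last first.
  by apply: measurableT_comp.
move=> H; apply/integrableP; split => //.
exact: (measurableT_comp mG' (measurable_funPT X1)).
Qed.

End product_law.

Section sigma_of_family.
Context d (T : measurableType d) (R : realType).

Definition rects (J : finType) (V : J -> T -> R) : set (set T) :=
  [set S | exists A : J -> set R, (forall j, measurable (A j)) /\ S = rect V A].

(** The sample space itself, with the sigma-algebra generated by the family. The identity map then
    stands for the random vector, so that no measurable structure on [J -> R] has to be chosen. *)
Definition family_space (J : finType) (V : J -> T -> R) := g_sigma_algebraType (rects V).

Lemma setI_closed_rects (J : finType) (V : J -> T -> R) : setI_closed (rects V).
Proof.
move=> _ _ [A [mA ->]] [B [mB ->]]; exists (fun j => A j `&` B j); split.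
  by move=> j; exact: measurableI.
apply/seteqP; split => w /=; first by move=> [H1 H2] j; split; [exact: H1|exact: H2].
by move=> H; split => j; case: (H j).
Qed.

Lemma measurable_rect (J : finType) (V : J -> T -> R) (A : J -> set R) :
  (forall j, measurable_fun setT (V j)) -> (forall j, measurable (A j)) ->
  measurable (rect V A).
Proof.
move=> mV mA; have -> : rect V A = \big[setI/setT]_(j in J) (V j @^-1` A j).
  rewrite -bigcap_seq; apply/seteqP; split => w /=.
    by move=> H j _; exact: H.
  by move=> H j; apply: H; rewrite /= mem_index_enum.
apply: bigsetI_measurable => j _.
by rewrite -[_ @^-1` _]setTI; apply: mV.
Qed.

Lemma measurable_family_space (J : finType) (V : J -> T -> R) (S : set T) :
  (forall j, measurable_fun setT (V j)) ->
  (<<s rects V >>) S -> measurable S.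
Proof.
move=> mV; apply: smallest_sub; first exact: sigma_algebra_measurable.
by move=> _ [A [mA ->]]; exact: measurable_rect.
Qed.

Lemma measurable_to_family_space (J : finType) (V : J -> T -> R) :
  (forall j, measurable_fun setT (V j)) ->
  measurable_fun setT (fun w : T => (w : family_space V)).
Proof.
by move=> mV _ S mS; rewrite setTI; exact: measurable_family_space mS.
Qed.

Lemma measurable_family_member (J : finType) (V : J -> T -> R) (j : J) :
  measurable_fun setT (fun w : family_space V => V j w).
Proof.
move=> _ S mS; rewrite setTI; apply: sub_sigma_algebra.
exists (fun k => if k == j then S else setT); split.
  by move=> k; case: ifP.
apply/seteqP; split => w /=; first by move=> Sw k; case: ifP => // /eqP ->.
by move=> /(_ j); rewrite eqxx.
Qed.

End sigma_of_family.

(** As functions of [B], both sides are finite measures, a restriction and a rescaling of [P], that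
    agree on a generating pi-system containing the whole space. *)
Lemma indep_generated d (T : measurableType d) (R : realType) (P : probability T R)
    (A : set T) (G : set (set T)) : measurable A -> G `<=` measurable ->
  setI_closed G -> G setT ->
  (forall B, G B -> P (A `&` B) = (P A * P B)%E) ->
  forall B, <<s G >> B -> P (A `&` B) = (P A * P B)%E.
Proof.
move=> mA Gm GI GT GP B GB.
have PA0 : 0 <= fine (P A) by rewrite fine_ge0.
have PAf : P A \is a fin_num by exact: fin_num_measure.
pose m1 : {measure set T -> \bar R} := mrestr P mA.
pose m2 : {measure set T -> \bar R} := mscale (NngNum PA0) P.
suff : m1 B = m2 B.
  by rewrite /m1 /m2 /= /mrestr /mscale /= fineK// setIC.
apply: (@g_sigma_algebra_measure_unique _ R T G Gm (fun=> setT)) => //.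
- by rewrite bigcup_const//; exists 0%N.
- move=> C GC; rewrite /m1 /m2 /= /mrestr /mscale /= fineK// setIC; exact: GP.
- by move=> _; rewrite /m1 /= /mrestr /= setTI ltey_eq PAf.
Qed.

Section indep_families.
Context d (T : measurableType d) (R : realType) (P : probability T R).
Variables (I J : finType) (U : I -> T -> R) (V : J -> T -> R).
Hypotheses (mU : forall i, measurable_fun setT (U i)) (mV : forall j, measurable_fun setT (V j)).
Hypothesis UV : indep2 P U V.

(** The pi-system argument is applied twice: [B] is extended with [A] fixed in its sigma-algebra,
    which leaves rectangles [B], and for these [A] is extended in turn. *)
Lemma indep_sigma (A B : set T) : (<<s rects U >>) A -> (<<s rects V >>) B ->
  P (A `&` B) = (P A * P B)%E.
Proof.
move=> UA VB.
have rT (K : finType) (W : K -> T -> R) : rects W setT.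
  by exists (fun=> setT); split => //; apply/seteqP; split.
have rm (K : finType) (W : K -> T -> R) : (forall k, measurable_fun setT (W k)) ->
    rects W `<=` measurable.
  by move=> mW _ [S [mS ->]]; exact: measurable_rect.
have mA := measurable_family_space mU UA.
have mB := measurable_family_space mV VB.
apply: (indep_generated mA (rm _ _ mV) (@setI_closed_rects _ T R _ V)) => // {VB mB}B [B' [mB' ->]].
have mB : measurable (rect V B') by exact: measurable_rect.
rewrite setIC muleC.
apply: (indep_generated mB (rm _ _ mU) (@setI_closed_rects _ T R _ U)) => // {UA mA}A [A' [mA' ->]].
by rewrite setIC muleC UV.
Qed.

(** Freezing: under independence the diagonal [(w, w)] may be replaced by two independent copies of
    the sample point. *)
Lemma Rintegral_indep_families (f : family_space U * family_space V -> R) :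
  measurable_fun setT f ->
  P.-integrable setT (EFin \o (fun w => f (w, w))) ->
  (forall w, P.-integrable setT (EFin \o (fun w' => f (w, w')))) ->
  \int[P]_w f (w, w) = \int[P]_w \int[P]_w' f (w, w').
Proof.
move=> mf intf intf1.
pose X1 := to_mfun (measurable_to_family_space mU).
pose X2 := to_mfun (measurable_to_family_space mV).
have iX A B : measurable A -> measurable B ->
    P (X1 @^-1` A `&` X2 @^-1` B) = (P (X1 @^-1` A) * P (X2 @^-1` B))%E.
  by move=> mA mB; exact: indep_sigma.
have mE : measurable_fun setT (EFin \o f) by exact/measurable_EFinP.
have i1 w : (distribution P X2).-integrable setT (EFin \o (fun y => f (w, y))).
  apply: (integrable_pushforward (measurable_to_family_space mV)) => //; last exact: intf1.
  exact: (measurableT_comp mE (pair1_measurable w)).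
rewrite (Rintegral_indep iX mf intf i1); apply: eq_Rintegral => w _.
rewrite /Rintegral (integral_pushforward (measurable_to_family_space mV)) //; last exact: intf1.
exact: (measurableT_comp mE (pair1_measurable (w : family_space U))).
Qed.

End indep_families.

Lemma cosMcos (R : realType) (x y : R) : cos x * cos y = 2^-1 * (cos (x + y) + cos (x - y)).
Proof. by rewrite cosD cosB; field. Qed.

Lemma Rintegral_indic d (T : measurableType d) (R : realType) (P : probability T R) (S : set T) :
  measurable S -> \int[P]_w (\1_S w : R) = fine (P S).
Proof. by move=> mS; rewrite /Rintegral integral_indic// setIT. Qed.

(** * Independence of events from factorised cosine expectations *)

Section indep_of_cos.
Context d (T : measurableType d) (R : realType) (P : probability T R).
Variables (J : finType) (eta : J -> T -> R) (xi : T -> R).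
Hypotheses (meta : forall j, measurable_fun setT (eta j)) (mxi : measurable_fun setT xi).
Hypothesis factor : forall (t th : R) (s : J -> R) (th' : R),
  \int[P]_w (cos (t * xi w + th) * cos (\sum_j s j * eta j w + th')) =
  \int[P]_w cos (t * xi w + th) * \int[P]_w cos (\sum_j s j * eta j w + th').

Let mlin (s : J -> R) (th : R) : measurable_fun setT (fun w => cos (\sum_j s j * eta j w + th)).
Proof.
apply: (measurableT_comp (@measurable_cosE R)); apply: measurable_funD => //.
by apply: measurable_sum => j; exact: measurable_funM.
Qed.

Section fixed.
Variables (A : set R) (B : J -> set R).
Hypotheses (mA : measurable A) (mB : forall j, measurable (B j)).
Let pA := \int[P]_w \1_A (xi w).

Let mIA : measurable_fun setT (fun w => \1_A (xi w) : R).
Proof. by apply: measurableT_comp => //; exact: measurable_indic. Qed.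

Let pA01 : 0 <= pA <= 1.
Proof.
rewrite Rintegral_ge0 /=; last by move=> w _; rewrite indicE.
rewrite -[leRHS](Rintegral_prob_cst P 1); apply: le_Rintegral => //.
- apply: (@integrable_le_cst _ _ _ _ _ 1) => // w.
  by rewrite indicE; case: (_ \in _); rewrite ?normr1 ?normr0.
- by apply: (@integrable_le_cst _ _ _ _ _ 1) => // w; rewrite normr1.
Qed.

(** With the indicator of [A] centred, independence from the rectangle becomes the single equation
    [E[W] = 0] for the full list of coordinates. *)
Let W (l : seq J) w : R := (\1_A (xi w) - pA) * \prod_(j <- l) \1_(B j) (eta j w).

Let mW l : measurable_fun setT (W l).
Proof.
apply: measurable_funM; first exact: measurable_funB.
apply: measurable_prod => j _.
by apply: measurableT_comp => //; exact: measurable_indic.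
Qed.

Let W1 l w : `|W l w| <= 1.
Proof.
rewrite normrM -[leRHS]mulr1 ler_pM//.
  by have := pA01; rewrite indicE ler_norml; case: (_ \in _) => /=; lra.
rewrite normr_prod; elim: l => [|j l IH]; first by rewrite big_nil.
rewrite big_cons mulr_ile1 ?prodr_ge0//.
by rewrite indicE; case: (_ \in _); rewrite ?normr1 ?normr0.
Qed.

(** Induction on the coordinates already turned into indicators; the others are still tested by a
    cosine. Frequencies and phase are universally quantified because the inductive step shifts
    both. *)
Let claim l : forall s th, \int[P]_w (W l w * cos (\sum_j s j * eta j w + th)) = 0.
Proof.
elim: l => [|j l IH] s th.
  pose c w := cos (\sum_j s j * eta j w + th).
  pose m := \int[P]_w c w.
  have ic : P.-integrable setT (EFin \o c).
    by apply: (@integrable_le_cst _ _ _ _ _ 1); [exact: mlin|move=> w; exact: normr_cos_le1].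
  have m1 : `|m| <= 1.
    by apply: normr_Rintegral_le; [exact: mlin|move=> w; exact: normr_cos_le1].
  (* Uniqueness is used against the zero weight: by [factor], the centred cosine [c - m] has
     vanishing transform along [xi], so it also integrates to 0 against the indicator of [A]. *)
  have := @cos_unique _ _ _ _ _ P P xi (fun w => c w - m) xi (fun=> 0) 2 mxi _ mxi _ _ _ _ A mA.
  have -> : \int[P]_w (0 * \1_A (xi w)) = (0 : R).
    by under eq_Rintegral do rewrite mul0r; rewrite Rintegral_prob_cst.
  move=> H.
  have E w : W [::] w * c w = (c w - m) * \1_A (xi w) - (c w - m) * pA + m * (\1_A (xi w) - pA).
    by rewrite /W big_nil mulr1; ring.
  have iI : P.-integrable setT (EFin \o (fun w => \1_A (xi w) : R)).
    apply: (@integrable_le_cst _ _ _ _ _ 1) => // w.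
    by rewrite indicE; case: (_ \in _); rewrite ?normr1 ?normr0.
  have icm : P.-integrable setT (EFin \o (fun w => c w - m)).
    apply: (@integrable_le_cst _ _ _ _ _ 2) => [|w].
      by apply: measurable_funB => //; exact: mlin.
    rewrite (le_trans (ler_normB _ _))// (_ : 2 = 1 + 1 :> R)// lerD//.
    exact: normr_cos_le1.
  have icmI : P.-integrable setT (EFin \o (fun w => (c w - m) * \1_A (xi w))).
    apply: (@integrable_le_cst _ _ _ _ _ 2) => [|w].
      by apply: measurable_funM => //; apply: measurable_funB => //; exact: mlin.
    rewrite normrM -[leRHS]mulr1 ler_pM//.
      rewrite (le_trans (ler_normB _ _))// (_ : 2 = 1 + 1 :> R)// lerD//.
      exact: normr_cos_le1.
    by rewrite indicE; case: (_ \in _); rewrite ?normr1 ?normr0.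
  have iIp : P.-integrable setT (EFin \o (fun w => \1_A (xi w) - pA)).
    have ipA : P.-integrable setT (EFin \o (fun _ : T => pA)).
      exact: (@integrable_le_cst _ _ _ _ _ `|pA|).
    exact: (integrableB measurableT iI ipA).
  under eq_Rintegral do rewrite E.
  have H1 : \int[P]_w ((c w - m) * \1_A (xi w)) = 0.
    apply: H.
    - by apply: measurable_funB => //; exact: mlin.
    - by [].
    - move=> w; rewrite (le_trans (ler_normB _ _))// (_ : 2 = 1 + 1 :> R)// lerD//.
      exact: normr_cos_le1.
    - by move=> w; rewrite normr0.
    - move=> t th'.
      under [RHS]eq_Rintegral do rewrite mul0r.
      rewrite Rintegral_prob_cst.
      have mt : measurable_fun setT (fun w => cos (t * xi w + th')).
        apply: (measurableT_comp (@measurable_cosE R)); apply: measurable_funD => //.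
        exact: measurable_funM.
      have it : P.-integrable setT (EFin \o (fun w => cos (t * xi w + th'))).
        by apply: (@integrable_le_cst _ _ _ _ _ 1) => // w; exact: normr_cos_le1.
      have E2 w : (c w - m) * cos (t * xi w + th') =
          cos (t * xi w + th') * c w - m * cos (t * xi w + th') by ring.
      under eq_Rintegral do rewrite E2.
      rewrite RintegralB//; last 2 first.
      + apply: (@integrable_le_cst _ _ _ _ _ 1); first by apply: measurable_funM => //; exact: mlin.
        by move=> w; rewrite normrM mulr_ile1// normr_cos_le1.
      + exact: (integrableZl measurableT m it).
      by rewrite RintegralZl// factor -/m mulrC subrr.
  rewrite RintegralD//; last 2 first.
  - exact: (integrableB measurableT icmI (integrableZr measurableT pA icm)).
  - exact: (integrableZl measurableT m iIp).
  rewrite RintegralB//; last exact: (integrableZr measurableT pA icm).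
  rewrite RintegralZl// RintegralZr// H1 !RintegralB//; last 2 first.
  - exact: (@integrable_le_cst _ _ _ _ _ `|pA|).
  - exact: (@integrable_le_cst _ _ _ _ _ `|m|).
  by rewrite !Rintegral_prob_cst -/m -/pA !subrr mul0r mulr0 subr0 addr0.
pose phi w := W l w * cos (\sum_j s j * eta j w + th).
have := @cos_unique _ _ _ _ _ P P (eta j) phi (eta j) (fun=> 0) 1 (meta j) _ (meta j) _ _ _ _ (B j) (mB j).
have -> : \int[P]_w (0 * \1_(B j) (eta j w)) = (0 : R).
  by under eq_Rintegral do rewrite mul0r; rewrite Rintegral_prob_cst.
move=> H; rewrite -[RHS]H.
- by apply: eq_Rintegral => w _; rewrite /phi /W big_cons; ring.
- by apply: measurable_funM => //; exact: mlin.
- by [].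
- by move=> w; rewrite normrM -[leRHS]mulr1 ler_pM// normr_cos_le1.
- by move=> w; rewrite normr0.
move=> t th'.
under [RHS]eq_Rintegral do rewrite mul0r.
rewrite Rintegral_prob_cst.
have sE (u : R) w : \sum_i (s i + u * (i == j)%:R) * eta i w = \sum_i s i * eta i w + u * eta j w.
  under eq_bigr do rewrite mulrDl; rewrite big_split/=; congr (_ + _).
  rewrite (bigD1 j)//= eqxx mulr1 big1 ?addr0// => i /negPf ->.
  by rewrite mulr0 mul0r.
(* The product-to-sum formula only moves the [j]-th frequency by [t] or [- t], so both terms fall
   under the induction hypothesis. *)
have E w : phi w * cos (t * eta j w + th') =
    2^-1 * (W l w * cos (\sum_i (s i + t * (i == j)%:R) * eta i w + (th + th')))
  + 2^-1 * (W l w * cos (\sum_i (s i + - t * (i == j)%:R) * eta i w + (th - th'))).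
  rewrite /phi -mulrA cosMcos !sE !mulrDr; congr (_ + _).
    by rewrite mulrCA; congr (_ * (_ * cos _)); ring.
  by rewrite mulrCA; congr (_ * (_ * cos _)); ring.
under eq_Rintegral do rewrite E.
have iW s' th'' : P.-integrable setT (EFin \o (fun w => W l w * cos (\sum_i s' i * eta i w + th''))).
  apply: (@integrable_le_cst _ _ _ _ _ 1); first by apply: measurable_funM => //; exact: mlin.
  by move=> w; rewrite normrM -[leRHS]mulr1 ler_pM// normr_cos_le1.
rewrite RintegralD//; last 2 first.
- exact: (integrableZl measurableT 2^-1 (iW _ _)).
- exact: (integrableZl measurableT 2^-1 (iW _ _)).
by rewrite !RintegralZl// !IH !mulr0 addr0.
Qed.

Let prodE w : \prod_(j : J) \1_(B j) (eta j w) = \1_(rect eta B) w :> R.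
Proof.
rewrite indicE; have [/set_mem H|/negP H] := boolP (w \in rect eta B).
  by apply: big1 => j _; rewrite indicE mem_set//; exact: H.
have /existsNP[j Hj] : ~ (forall j, B j (eta j w)) by move=> H'; apply: H; exact/mem_set.
by rewrite (bigD1 j)//= indicE memNset// mul0r.
Qed.

Lemma indep_of_cos_rect :
  P (rect eta B `&` xi @^-1` A) = (P (rect eta B) * P (xi @^-1` A))%E.
Proof.
have mR : measurable (rect eta B) by exact: measurable_rect.
have mX : measurable (xi @^-1` A) by rewrite -[_ @^-1` _]setTI; exact: mxi.
have iA w : \1_A (xi w) = \1_(xi @^-1` A) w :> R by rewrite !indicE; congr (_%:R); apply/idP/idP => /set_mem H; apply/mem_set.
have pAE : pA = fine (P (xi @^-1` A)).
  by rewrite -Rintegral_indic//; apply: eq_Rintegral => w _; rewrite iA.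
have := claim (index_enum J) (fun=> 0) 0.
have E w : W (index_enum J) w * cos (\sum_j 0 * eta j w + 0) =
    \1_(rect eta B `&` xi @^-1` A) w - pA * \1_(rect eta B) w.
  rewrite big1 ?addr0 ?cos0 ?mulr1; last by move=> j _; rewrite mul0r.
  by rewrite /W prodE iA indicI /=; ring.
under eq_Rintegral do rewrite E.
have iI (S : set T) : measurable S -> P.-integrable setT (EFin \o (fun w => \1_S w : R)).
  move=> mS; apply: (@integrable_le_cst _ _ _ _ _ 1) => [|w]; first exact: measurable_indic.
  by rewrite indicE; case: (_ \in _); rewrite ?normr1 ?normr0.
have mI := measurableI _ _ mR mX.
rewrite RintegralB//; last 2 first.
- exact: iI.
- exact: (integrableZl measurableT pA (iI _ mR)).
rewrite RintegralZl//; last exact: iI.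
rewrite !Rintegral_indic// pAE => /eqP; rewrite subr_eq0 => /eqP H.
rewrite -[LHS]fineK ?fin_num_measure// H mulrC EFinM !fineK// fin_num_measure//.
Qed.
End fixed.

Lemma indep_of_cos : indep2 P eta (fun _ : unit => xi).
Proof.
move=> B A mB mA.
have -> : rect (fun _ : unit => xi) A = xi @^-1` (A tt).
  by apply/seteqP; split => w; [move=> /(_ tt)|move=> ? []].
exact: indep_of_cos_rect.
Qed.

End indep_of_cos.

Section transfer.
Context d (T : measurableType d) (R : realType) (P : probability T R).
Variables (xi : T -> R) (nu : {measure set (measurableTypeR R) -> \bar R}).
Hypotheses (mxi : measurable_fun setT xi).
Hypothesis lawE : forall B, measurable B -> P (xi @^-1` B) = nu B.

Lemma integrable_law (f : R -> R) : measurable_fun setT f ->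
  nu.-integrable setT (EFin \o f) -> P.-integrable setT (EFin \o (fun w => f (xi w))).
Proof.
move=> mf /integrableP[_ H]; apply/integrableP; split.
  by apply/measurable_EFinP; exact: measurableT_comp.
have mnf : measurable_fun setT (abse \o (EFin \o f)).
  by apply: measurableT_comp => //; exact/measurable_EFinP.
move: H; rewrite (@eq_measure_integral _ _ _ _ (distribution P (@to_mfun _ _ T (measurableTypeR R) xi mxi))); last first.
  by move=> A mA _; rewrite -lawE.
by rewrite ge0_integral_distribution.
Qed.

Lemma Rintegral_law (f : R -> R) : measurable_fun setT f ->
  nu.-integrable setT (EFin \o f) -> \int[P]_w f (xi w) = \int[nu]_x f x.
Proof.
move=> mf inu; have iP := integrable_law mf inu.
rewrite /Rintegral; congr fine.
rewrite [RHS](@eq_measure_integral _ _ _ _ (distribution P (@to_mfun _ _ T (measurableTypeR R) xi mxi))); last first.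
  by move=> A mA _; rewrite -lawE.
by rewrite integral_distribution//; exact/measurable_EFinP.
Qed.

End transfer.

Section cos_law.
Context d (T : measurableType d) (R : realType) (P : probability T R).
Variables (xi : T -> R) (v : R).
Hypothesis (mxi : measurable_fun setT xi).
Hypothesis cosE : forall t th : R,
  \int[P]_w cos (t * xi w + th) = expR (- (v * t ^+ 2 / 2)) * cos th.

Let indicE_P (B : set R) : measurable B -> \int[P]_w (1 * \1_B (xi w)) = fine (P (xi @^-1` B)).
Proof.
move=> mB; rewrite -Rintegral_indic.
  by apply: eq_Rintegral => w _; rewrite mul1r !indicE; congr (_%:R); apply/idP/idP => /set_mem H; apply/mem_set.
by rewrite -[_ @^-1` _]setTI; exact: mxi.
Qed.

Lemma cos_law_normal B : 0 < v -> measurable B ->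
  P (xi @^-1` B) = normal_prob 0 (Num.sqrt v) B.
Proof.
move=> v0 mB.
have mP : measurable (xi @^-1` B) by rewrite -[_ @^-1` _]setTI; exact: mxi.
rewrite -[LHS]fineK ?fin_num_measure// -[RHS]fineK ?fin_num_measure//; congr EFin.
rewrite -indicE_P// -[RHS]Rintegral_indic//.
rewrite (@cos_unique _ _ _ _ _ P (normal_prob 0 (Num.sqrt v)) xi (fun=> 1) id (fun=> 1) 1)//.
- by apply: eq_Rintegral => w _; rewrite mul1r.
- by move=> w; rewrite normr1.
- by move=> w; rewrite normr1.
- move=> t th; under eq_Rintegral do rewrite mul1r.
  under [RHS]eq_Rintegral do rewrite mul1r.
  by rewrite cosE normal_cos ?sqrtr_gt0// sqr_sqrtr// ltW.
Qed.

Lemma cos_law_dirac B : v = 0 -> measurable B -> P (xi @^-1` B) = \d_(0 : R) B.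
Proof.
move=> v0 mB.
have mP : measurable (xi @^-1` B) by rewrite -[_ @^-1` _]setTI; exact: mxi.
rewrite -[LHS]fineK ?fin_num_measure// diracE; congr EFin.
rewrite -indicE_P//.
rewrite (@cos_unique _ _ _ _ _ P P xi (fun=> 1) (fun=> 0) (fun=> 1) 1)//.
- by rewrite Rintegral_prob_cst mul1r indicE.
- by move=> w; rewrite normr1.
- by move=> w; rewrite normr1.
- move=> t th; under eq_Rintegral do rewrite mul1r.
  under [RHS]eq_Rintegral do rewrite mul1r mulr0 add0r.
  by rewrite cosE v0 !mul0r oppr0 expR0 mul1r Rintegral_prob_cst.
Qed.

Lemma cos_law_moment (m : nat) : 0 <= v ->
  P.-integrable setT (EFin \o (fun w => (1 + xi w ^+ 2) ^+ m)).
Proof.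
move=> v0.
have mf : measurable_fun setT (fun x : R => (1 + x ^+ 2) ^+ m).
  apply: measurable_funX; exact: measurable_funD.
have p0 (x : R) : 0 <= (1 + x ^+ 2) ^+ m by rewrite exprn_ge0// addr_ge0// sqr_ge0.
move: v0; rewrite le_eqVlt => /predU1P[/esym v0|v0].
  apply: (integrable_law (nu := \d_(0 : measurableTypeR R)) mxi _ mf).
    by move=> B mB; exact: cos_law_dirac.
  apply/integrableP; split; first exact/measurable_EFinP.
  rewrite integral_dirac//; last by apply: measurableT_comp => //; exact/measurable_EFinP.
  by rewrite diracT mul1e ltry.
apply: (integrable_law (nu := normal_prob 0 (Num.sqrt v)) mxi _ mf).
  by move=> B mB; exact: cos_law_normal.
apply: (@integrable_normal _ _ m _ 1) => //; first by rewrite sqrtr_gt0.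
by move=> x; rewrite mul1r ger0_norm.
Qed.

End cos_law.

(** * Functions of polynomial growth and directional derivatives *)

Section nice.
Context (R : realType) (J : finType).
Implicit Types (g h : (J -> R) -> R) (x u : J -> R).

Definition pw x : R := 1 + \sum_j x j ^+ 2.

Lemma pw_ge1 x : 1 <= pw x.
Proof. by rewrite lerDl sumr_ge0// => j _; exact: sqr_ge0. Qed.

Lemma pw_ge0 x : 0 <= pw x.
Proof. exact: le_trans (pw_ge1 x). Qed.

Lemma le_pwX x m n : (m <= n)%N -> pw x ^+ m <= pw x ^+ n.
Proof. by move=> mn; rewrite ler_weXn2l// pw_ge1. Qed.

Definition line x u (e : R) : J -> R := fun j => x j + e * u j.

(** Measurability is expressed through composition with arbitrary measurable families, so that [g]
    can be evaluated on the sample space and on products of generated spaces alike. Polynomial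
    growth gives integrability under Gaussian laws, and continuity along lines is all that
    one-dimensional integration by parts requires. *)
Record nice g : Prop := Nice {
  nice_measurable : forall d (S : measurableType d) (V : J -> S -> R),
    (forall j, measurable_fun setT (V j)) -> measurable_fun setT (fun w => g (V ^~ w));
  nice_growth : exists K m, forall x, `|g x| <= K * pw x ^+ m;
  nice_line : forall x u, continuous (fun e => g (line x u e)) }.

Lemma nice_cst (c : R) : nice (fun=> c).
Proof.
split; [by move=> *; exact: measurable_cst| |by move=> x u e; exact: cvg_cst].
by exists `|c|, 0%N => x; rewrite expr0 mulr1.
Qed.

Lemma nice_coord j : nice (fun x => x j).
Proof.
split; [by []| |].
  exists 1, 1%N => x; rewrite mul1r expr1 /pw (bigD1 j)//= addrA.
  rewrite (@le_trans _ _ (1 + x j ^+ 2))//; last by rewrite lerDl sumr_ge0// => i _; exact: sqr_ge0.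
  by have := sqr_ge0 (`|x j| - 1); rewrite -[x j ^+ 2]real_normK ?num_real//; have := normr_ge0 (x j); nra.
move=> x u e; apply: cvgD; first exact: cvg_cst.
by apply: cvgM; [exact: cvg_id|exact: cvg_cst].
Qed.

Lemma niceD g h : nice g -> nice h -> nice (fun x => g x + h x).
Proof.
move=> [mg [K [m gK]] lg] [mh [L [n hL]] lh]; split.
- by move=> d S V mV; apply: measurable_funD; [exact: mg|exact: mh].
- exists (`|K| + `|L|), (maxn m n) => x; rewrite mulrDl (le_trans (ler_normD _ _))// lerD//.
    rewrite (le_trans (gK x))// (@le_trans _ _ (`|K| * pw x ^+ m))//.
      by rewrite ler_wpM2r ?exprn_ge0 ?pw_ge0// ler_norm.
    by rewrite ler_wpM2l// le_pwX// leq_maxl.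
  rewrite (le_trans (hL x))// (@le_trans _ _ (`|L| * pw x ^+ n))//.
    by rewrite ler_wpM2r ?exprn_ge0 ?pw_ge0// ler_norm.
  by rewrite ler_wpM2l// le_pwX// leq_maxr.
- by move=> x u e; apply: cvgD; [exact: lg|exact: lh].
Qed.

Lemma niceM g h : nice g -> nice h -> nice (fun x => g x * h x).
Proof.
move=> [mg [K [m gK]] lg] [mh [L [n hL]] lh]; split.
- by move=> d S V mV; apply: measurable_funM; [exact: mg|exact: mh].
- by exists (K * L), (m + n)%N => x; rewrite normrM exprD mulrACA ler_pM.
- by move=> x u e; apply: cvgM; [exact: lg|exact: lh].
Qed.

Lemma nice_sum (I : Type) (r : seq I) (Q : pred I) (g : I -> (J -> R) -> R) :
  (forall i, nice (g i)) -> nice (fun x => \sum_(i <- r | Q i) g i x).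
Proof.
move=> gn; elim: r => [|i r IH].
  by rewrite (_ : (fun _ => _) = fun=> 0); [exact: nice_cst|apply/funext => x; rewrite big_nil].
have -> : (fun x => \sum_(j <- i :: r | Q j) g j x) =
   fun x => (if Q i then 1 else 0) * g i x + \sum_(j <- r | Q j) g j x.
  by apply/funext => x; rewrite big_cons; case: ifP; rewrite ?mul1r ?mul0r ?add0r.
by apply: niceD => //; apply: niceM => //; exact: nice_cst.
Qed.

Lemma nice_comp (phi : R -> R) (K : R) g : continuous phi ->
  (forall y, `|phi y| <= K * (1 + `|y|)) -> nice g -> nice (fun x => phi (g x)).
Proof.
move=> cphi phiK [mg [L [m gL]] lg]; split.
- move=> d S V mV; apply: measurableT_comp; last exact: mg.
  exact: continuous_measurable_fun.
- have K0 : 0 <= K.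
    by have := le_trans (normr_ge0 _) (phiK 0); rewrite normr0 addr0 mulr1.
  exists (K * (1 + `|L|)), m => x; rewrite (le_trans (phiK _))// -mulrA ler_wpM2l//.
  rewrite mulrDl mul1r lerD//; first by rewrite exprn_ege1// pw_ge1.
  by rewrite (le_trans (gL x))// ler_wpM2r ?exprn_ge0 ?pw_ge0// ler_norm.
- by move=> x u e; apply: (cvg_comp (fun e => g (line x u e)) phi); [exact: lg|exact: cphi].
Qed.

Definition has_dir u g dg : Prop :=
  forall x, is_derive (0 : R) (1 : R) (fun e => g (line x u e)) (dg x).

Lemma line_line x u (e f : R) : line (line x u e) u f = line x u (f + e).
Proof. by apply/funext => j; rewrite /line mulrDl -addrA [e * _ + _]addrC. Qed.

Lemma has_dir_line u g dg x (e : R) : has_dir u g dg ->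
  is_derive e (1 : R) (fun e => g (line x u e)) (dg (line x u e)).
Proof.
move=> H; have H0 := H (line x u e).
have S : is_derive e (1 : R) (fun f : R => f - e) 1.
  by apply: is_derive_eq; rewrite subr0.
have H1 : is_derive (e - e) (1 : R) (fun f => g (line (line x u e) u f)) (dg (line x u e)).
  by rewrite subrr.
have := @is_derive1_comp _ (fun f => g (line (line x u e) u f)) (fun f => f - e) _ _ _ H1 S.
rewrite mulr1 (_ : _ \o _ = fun f => g (line x u f))//.
by apply/funext => f /=; rewrite line_line subrK.
Qed.

Lemma has_dir_cst u c : has_dir u (fun=> c) (fun=> 0).
Proof. by move=> x; exact: is_derive_cst. Qed.

Lemma has_dir_coord u j : has_dir u (fun x => x j) (fun=> u j).
Proof.
move=> x; rewrite /line; apply: is_derive_eq; rewrite /GRing.scale/=; ring.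
Qed.

Lemma has_dirD u g dg h dh : has_dir u g dg -> has_dir u h dh ->
  has_dir u (fun x => g x + h x) (fun x => dg x + dh x).
Proof. by move=> Hg Hh x; exact: (is_deriveD (Hg x) (Hh x)). Qed.

Lemma line0 x u : line x u 0 = x.
Proof. by apply/funext => j; rewrite /line mul0r addr0. Qed.

Lemma has_dirM u g dg h dh : has_dir u g dg -> has_dir u h dh ->
  has_dir u (fun x => g x * h x) (fun x => dg x * h x + g x * dh x).
Proof.
move=> Hg Hh x; apply: (is_derive_eq (is_deriveM (Hg x) (Hh x))).
by rewrite line0 /GRing.scale /=; ring.
Qed.

Lemma has_dir_sum (I : Type) (r : seq I) (Q : pred I) u (g dg : I -> (J -> R) -> R) :
  (forall i, has_dir u (g i) (dg i)) ->
  has_dir u (fun x => \sum_(i <- r | Q i) g i x) (fun x => \sum_(i <- r | Q i) dg i x).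
Proof.
move=> H; elim: r => [|i r IH] x.
  rewrite big_nil (_ : (fun _ => _) = fun=> 0); last by apply/funext => e; rewrite big_nil.
  exact: is_derive_cst.
rewrite big_cons; under eq_fun do rewrite big_cons.
by case: ifP => _; [exact: (is_deriveD (H i x) (IH x))|exact: IH].
Qed.

Lemma has_dir_comp u (phi dphi : R -> R) g dg :
  (forall y : R, is_derive y (1 : R) phi (dphi y)) -> has_dir u g dg ->
  has_dir u (fun x => phi (g x)) (fun x => dphi (g x) * dg x).
Proof.
move=> H Hg x.
have H1 : is_derive (g (line x u 0)) (1 : R) phi (dphi (g x)) by rewrite line0.
exact: (is_derive1_comp H1 (Hg x)).
Qed.

Lemma has_dir_eq u g dg dg' : has_dir u g dg -> dg =1 dg' -> has_dir u g dg'.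
Proof. by move=> H E x; rewrite -E. Qed.

End nice.

(** * Gaussian families and integration by parts *)

Definition qf (R : realType) (J : finType) (C : J -> J -> R) (s t : J -> R) : R :=
  \sum_i \sum_j s i * C i j * t j.

(** Jointly Gaussian, centred, with covariance [C], which may be singular. Positivity of [C] is not
    part of the definition; it follows from it. *)
Definition gfam (R : realType) d (T : measurableType d) (P : probability T R)
    (J : finType) (V : J -> T -> R) (C : J -> J -> R) : Prop :=
  forall (t : J -> R) (th : R),
    \int[P]_w cos (\sum_j t j * V j w + th) = expR (- (qf C t t / 2)) * cos th.

Section gfam.
Context (R : realType) d (T : measurableType d) (P : probability T R) (J : finType).
Variables (V : J -> T -> R) (C : J -> J -> R).
Hypotheses (mV : forall j, measurable_fun setT (V j)) (Csym : forall i j, C i j = C j i).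
Hypothesis VC : gfam P V C.

Let dl (j : J) (a : R) (i : J) : R := a * (i == j)%:R.

Let sum_dl j a (F : J -> R) : \sum_i dl j a i * F i = a * F j.
Proof.
rewrite (bigD1 j)//= big1 ?addr0 /dl ?eqxx ?mulr1// => i /negPf ->.
by rewrite mulr0 mul0r.
Qed.

Lemma qfDl (s s' t : J -> R) : qf C (fun i => s i + s' i) t = qf C s t + qf C s' t.
Proof.
rewrite /qf -big_split; apply: eq_bigr => i _ /=; rewrite -big_split.
by apply: eq_bigr => j _ /=; ring.
Qed.

Lemma qfC (s t : J -> R) : qf C s t = qf C t s.
Proof.
rewrite /qf exchange_big; apply: eq_bigr => i _; apply: eq_bigr => j _ /=.
by rewrite Csym; ring.
Qed.

Let qf_dl j a t : qf C (dl j a) t = a * \sum_k C j k * t k.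
Proof.
rewrite /qf -(sum_dl j a (fun i => \sum_k C i k * t k)); apply: eq_bigr => i _.
by rewrite big_distrr; apply: eq_bigr => k _ /=; ring.
Qed.

Let qf_dl_sum j t : \sum_k C j k * dl j t k = t * C j j.
Proof. by under eq_bigr do rewrite mulrC; rewrite sum_dl. Qed.

Let mcos t th : measurable_fun setT (fun w => cos (\sum_j t j * V j w + th)).
Proof.
apply: (measurableT_comp (@measurable_cosE R)); apply: measurable_funD => //.
by apply: measurable_sum => j; exact: measurable_funM.
Qed.

(** The mean of a cosine is at most 1, which forces the exponent [- qf C t t / 2] to be
    nonpositive. *)
Lemma qf_ge0 t : 0 <= qf C t t.
Proof.
have := VC t 0; rewrite cos0 mulr1 => H.
have : expR (- (qf C t t / 2)) <= 1.
  rewrite -H (le_trans (ler_norm _))//.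
  by apply: normr_Rintegral_le; [exact: mcos|move=> w; exact: normr_cos_le1].
by rewrite expR_le1 oppr_le0 pmulr_lge0.
Qed.

Lemma gfam_coord j (t th : R) :
  \int[P]_w cos (t * V j w + th) = expR (- (C j j * t ^+ 2 / 2)) * cos th.
Proof.
have := VC (dl j t) th; under eq_Rintegral do rewrite sum_dl.
by rewrite qf_dl qf_dl_sum => ->; congr (expR (- (_ / 2)) * _); ring.
Qed.

Lemma gfam_diag_ge0 j : 0 <= C j j.
Proof.
have := qf_ge0 (dl j 1); rewrite qf_dl mul1r.
by under eq_bigr do rewrite mulrC; rewrite sum_dl mul1r.
Qed.

Lemma gfam_diag0 j k : C j j = 0 -> C j k = 0.
Proof.
move=> Cjj; apply/eqP/negPn/negP => Cjk.
(* With [C j j = 0], the quadratic form at [e_k + y e_j] is [C k k + 2 y C j k]; this [y] makes it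
   [-1]. *)
pose y := - (C k k + 1) / (2 * C j k).
have := qf_ge0 (fun i => dl k 1 i + dl j y i).
have dlC i a t : \sum_k C i k * dl a t k = t * C i a.
  by under eq_bigr do rewrite mulrC; rewrite sum_dl.
rewrite qfDl ![qf C _ (fun i => _ + _)]qfC !qfDl !qf_dl !dlC Cjj [C k j]Csym.
rewrite !mul1r !mulr0 addr0 /y leNgt => /negP; apply.
by rewrite -subr_lt0 (_ : _ - 0 = -1); [rewrite ltrN10|field].
Qed.

(** Bounding each coordinate by the largest one gives [pw^m <= #|J|^m * \sum_j (1 + V_j^2)^m], so
    that only the marginal laws matter. An empty index set has no largest coordinate and is treated
    apart. *)
Lemma integrable_pw m : P.-integrable setT (EFin \o (fun w => pw (V ^~ w) ^+ m)).
Proof.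
have mpw : measurable_fun setT (fun w => pw (V ^~ w) ^+ m).
  apply: measurable_funX; apply: measurable_funD => //.
  by apply: measurable_sum => j; exact: measurable_funX.
have [j0|J0] := pickP (@predT J); last first.
  apply: (@integrable_le_cst _ _ _ _ _ 1) => // w.
  rewrite /pw big1 ?addr0 ?expr1n ?normr1// => j _.
  by have := J0 j.
have iS : P.-integrable setT (EFin \o (fun w => (#|J|%:R : R) ^+ m * \sum_j (1 + V j w ^+ 2) ^+ m)).
  have i1 j := cos_law_moment (mV j) (gfam_coord j) m (gfam_diag_ge0 j).
  have i2 : P.-integrable setT (EFin \o (fun w => \sum_j (1 + V j w ^+ 2) ^+ m)).
    rewrite (_ : _ \o _ = fun w => (\sum_j ((1 + V j w ^+ 2) ^+ m)%:E)%E); last first.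
      by apply/funext => w /=; rewrite sumEFin.
    by apply: integrable_sum => // j _; exact: i1.
  exact: (integrableZl measurableT _ i2).
move=> _; apply: (le_integrable _ _ _ iS) => //; first exact/measurable_EFinP.
move=> w _ /=; rewrite lee_fin.
have p1 (j : J) : 0 <= 1 + V j w ^+ 2 by rewrite addr_ge0// sqr_ge0.
rewrite !ger0_norm ?exprn_ge0 ?pw_ge0//; last first.
  by rewrite mulr_ge0 ?exprn_ge0// sumr_ge0// => j _; rewrite exprn_ge0.
pose k := [arg max_(k > j0) (1 + V k w ^+ 2)]%O.
have kmax j : 1 + V j w ^+ 2 <= 1 + V k w ^+ 2.
  by rewrite /k; case: arg_maxP => // i _; apply.
rewrite (@le_trans _ _ ((#|J|%:R * (1 + V k w ^+ 2)) ^+ m))//.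
  rewrite lerXn2r ?nnegrE ?pw_ge0 ?mulr_ge0//.
  rewrite (@le_trans _ _ (\sum_(j : J) (1 + V j w ^+ 2)))//.
    rewrite /pw big_split /= lerD2r (bigD1 j0)//= lerDl sumr_ge0//.
  by rewrite (le_trans (ler_sum _ (fun j _ => kmax j)))// sumr_const mulr_natl.
rewrite exprMn ler_wpM2l ?exprn_ge0//.
by rewrite (bigD1 k)//= lerDl sumr_ge0// => j _; rewrite exprn_ge0.
Qed.

Lemma integrable_nice g : nice g -> P.-integrable setT (EFin \o (fun w => g (V ^~ w))).
Proof.
move=> [mg [K [m gK]] _]; have i2 := integrableZl measurableT K (integrable_pw m).
apply: (le_integrable _ _ _ i2) => //; first by apply/measurable_EFinP; exact: mg.
by move=> w _ /=; rewrite lee_fin (le_trans (gK _))// ler_norm.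
Qed.

Lemma line_growth g (x u : J -> R) : nice g ->
  exists K m, forall e, `|g (line x u e)| <= K * (1 + e ^+ 2) ^+ m.
Proof.
move=> [_ [K [m gK]] _].
pose L := 1 + 2 * \sum_i x i ^+ 2 + 2 * \sum_i u i ^+ 2.
exists (`|K| * L ^+ m), m => e.
rewrite (le_trans (gK _))// -mulrA -exprMn.
rewrite (@le_trans _ _ (`|K| * pw (line x u e) ^+ m))//.
  by rewrite ler_wpM2r ?exprn_ge0 ?pw_ge0// ler_norm.
have sx : 0 <= \sum_i x i ^+ 2 by rewrite sumr_ge0// => i _; exact: sqr_ge0.
have su : 0 <= \sum_i u i ^+ 2 by rewrite sumr_ge0// => i _; exact: sqr_ge0.
rewrite ler_wpM2l// lerXn2r ?nnegrE ?pw_ge0//.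
  by have := sqr_ge0 e => e2; apply: mulr_ge0; rewrite /L; lra.
rewrite (@le_trans _ _ (1 + (2 * \sum_i x i ^+ 2 + 2 * e ^+ 2 * \sum_i u i ^+ 2)))//.
  rewrite /pw lerD2l !big_distrr -big_split /=; apply: ler_sum => i _.
  by rewrite /line; have := sqr_ge0 (x i - e * u i); nra.
by have := sqr_ge0 e; rewrite /L; nra.
Qed.

(** Once [V] is written as [eta + V_j u] with [eta] independent of [V_j], [eta] can be frozen and
    only a one-dimensional normal integral remains. *)
Lemma Rintegral_nice_indep (j : J) (eta : J -> T -> R) (u : J -> R) g : 0 < C j j ->
  (forall k, measurable_fun setT (eta k)) ->
  (forall w, V ^~ w = line (eta ^~ w) u (V j w)) ->
  indep2 P eta (fun _ : unit => V j) -> nice g ->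
  \int[P]_w g (V ^~ w) =
  \int[P]_w \int[normal_prob 0 (Num.sqrt (C j j))]_x g (line (eta ^~ w) u x).
Proof.
move=> v0 meta VE ind ng; pose v := C j j.
have s0 : 0 < Num.sqrt v by rewrite sqrtr_gt0.
have lawE B : measurable B -> P (V j @^-1` B) = normal_prob 0 (Num.sqrt v) B.
  by move=> mB; apply: (cos_law_normal (mV j) (gfam_coord j)).
have mgl w : measurable_fun setT (fun x => g (line (eta ^~ w) u x)).
  by apply: continuous_measurable_fun; exact: (nice_line ng).
have igl w : (normal_prob 0 (Num.sqrt v)).-integrable setT (EFin \o (fun x => g (line (eta ^~ w) u x))).
  have [K [m gK]] := line_growth (eta ^~ w) u ng.
  exact: (integrable_normal s0 (mgl w) gK).
pose f (z : family_space eta * family_space (fun _ : unit => V j)) :=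
  g (line (eta ^~ z.1) u (V j z.2)).
have mf : measurable_fun setT f.
  apply: (nice_measurable ng) => k; apply: measurable_funD.
    exact: (measurableT_comp (@measurable_family_member _ _ _ _ eta k) measurable_fst).
  apply: measurable_funM => //.
  exact: (measurableT_comp (@measurable_family_member _ _ _ _ (fun _ : unit => V j) tt) measurable_snd).
have := @Rintegral_indep_families _ _ _ P _ _ eta (fun _ : unit => V j) meta (fun _ => mV j) ind f mf.
have fE w : f (w, w) = g (V ^~ w) by rewrite /f /= -VE.
under eq_Rintegral do rewrite fE.
move=> ->.
- by apply: eq_Rintegral => w _; apply: (Rintegral_law (mV j) lawE (mgl w) (igl w)).
- by have := integrable_nice ng; apply: eq_integrable => // w _ /=; rewrite fE.
- by move=> w; apply: (integrable_law (mV j) lawE (mgl w) (igl w)).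
Qed.

(** Regress all coordinates on [V_j]: [V = eta + V_j u] with [u = C_j / C_jj]. For frozen [eta] the
    one-dimensional formula applies, and [C_jj] times the derivative along [u] is the derivative
    along the covariance row [C_j]. *)
Lemma gfam_ibp (j : J) g dg : nice g -> nice dg -> has_dir (C j) g dg ->
  \int[P]_w (V j w * g (V ^~ w)) = \int[P]_w dg (V ^~ w).
Proof.
move=> ng ndg gdg.
(* In the degenerate case the whole row [C_j] vanishes, so [dg = 0], while [V_j = 0] almost surely:
   both sides are 0. *)
have := gfam_diag_ge0 j; rewrite le_eqVlt => /predU1P[/esym v0|v0].
  have Cj0 k : C j k = 0 by exact: gfam_diag0.
  have dg0 x : dg x = 0.
    have := gdg x; rewrite (_ : (fun e => _) = cst (g x)) => [H|].
      by case: H => _ <-; rewrite derive_cst.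
    apply/funext => e /=; congr g; apply/funext => k.
    by rewrite /line Cj0 mulr0 addr0.
  under [RHS]eq_Rintegral do rewrite dg0.
  rewrite Rintegral_prob_cst.
  have cE t th : \int[P]_w cos (t * V j w + th) = expR (- (0 * t ^+ 2 / 2)) * cos th.
    by rewrite gfam_coord v0.
  have P0 := @cos_law_dirac _ _ _ P (V j) 0 (mV j) cE [set~ 0] erefl.
  rewrite /Rintegral (_ : 0 = fine 0%E)//; congr fine.
  rewrite -[RHS](integral0 P setT); apply: ae_eq_integral => //.
    by apply/measurable_EFinP; apply: measurable_funM => //; exact: (nice_measurable ng).
  exists (V j @^-1` [set~ 0]); split.
  - by rewrite -[_ @^-1` _]setTI; apply: mV => //; exact: measurableC.
  - by apply: (etrans (P0 (measurableC (measurable_set1 0)))); rewrite diracE memNset//=; exact.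
  - move=> w /= H Vj; apply: H => _; by rewrite Vj mul0r.
pose v := C j j; pose u k := C j k / v.
pose eta k w := V k w - u k * V j w.
have meta k : measurable_fun setT (eta k).
  by apply: measurable_funB => //; exact: measurable_funM.
have VE w : V ^~ w = line (eta ^~ w) u (V j w).
  by apply/funext => k; rewrite /line /eta mulrC subrK.
(* The residuals are uncorrelated with [V_j]: the quadratic form [Q] of [a V_j + \sum_k s_k eta_k]
   has no term linear in [a], so the cosine expectations factorise. *)
have ind : indep2 P eta (fun _ : unit => V j).
  apply: indep_of_cos => // t th s th'.
  pose r := \sum_k s k * u k.
  have lin a w : a * V j w + \sum_k s k * eta k w = \sum_k (s k + dl j (a - r) k) * V k w.
    under [RHS]eq_bigr do rewrite mulrDl.
    rewrite big_split /= sum_dl mulrBl /r.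
    under [in LHS]eq_bigr do rewrite mulrBr mulrA.
    by rewrite sumrB -big_distrl /=; ring.
  have lin0 w : \sum_k s k * eta k w = \sum_k (s k + dl j (0 - r) k) * V k w.
    by rewrite -lin mul0r add0r.
  have sC : \sum_k C j k * s k = r * v.
    by rewrite /r big_distrl; apply: eq_bigr => k _ /=; rewrite /u; field; rewrite gt_eqF.
  have Q a : qf C (fun k => s k + dl j (a - r) k) (fun k => s k + dl j (a - r) k) =
      qf C s s - r ^+ 2 * v + a ^+ 2 * v.
    rewrite qfDl ![qf C _ (fun i => _ + _)]qfC !qfDl [qf C s (dl _ _)]qfC !qf_dl.
    by rewrite sC qf_dl_sum -/v; ring.
  have E w : cos (t * V j w + th) * cos (\sum_k s k * eta k w + th') =
      2^-1 * cos (\sum_k (s k + dl j (t - r) k) * V k w + (th + th')) +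
      2^-1 * cos (\sum_k (s k + dl j (- t - r) k) * V k w + (th' - th)).
    rewrite cosMcos mulrDr -!lin; congr (_ * cos _ + _ * _); first by ring.
    by rewrite -cosN; congr cos; ring.
  have ic a b : P.-integrable setT (EFin \o (fun w => cos (\sum_k a k * V k w + b))).
    by apply: (@integrable_le_cst _ _ _ _ _ 1); [exact: mcos|move=> w; exact: normr_cos_le1].
  under eq_Rintegral do rewrite E.
  rewrite RintegralD//; last 2 first.
  - exact: (integrableZl measurableT 2^-1 (ic _ _)).
  - exact: (integrableZl measurableT 2^-1 (ic _ _)).
  rewrite !RintegralZl// !VC gfam_coord -/v.
  under [in RHS]eq_Rintegral do rewrite lin0.
  rewrite VC !Q sqrrN.
  have -> : expR (- ((qf C s s - r ^+ 2 * v + t ^+ 2 * v) / 2)) =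
     expR (- (v * t ^+ 2 / 2)) * expR (- ((qf C s s - r ^+ 2 * v + 0 ^+ 2 * v) / 2)).
    by rewrite -expRD; congr expR; field.
  have -> : th + th' = th' + th by rewrite addrC.
  by rewrite cosD cosB; field.
have s0 : 0 < Num.sqrt v by rewrite sqrtr_gt0.
rewrite (Rintegral_nice_indep v0 meta VE ind (niceM (nice_coord _ j) ng)).
rewrite (Rintegral_nice_indep v0 meta VE ind ndg).
apply: eq_Rintegral => w _; rewrite -/v.
have eta0 : eta j w = 0 by rewrite /eta /u -/v divff ?gt_eqF// mul1r subrr.
have lineE x : line (eta ^~ w) u x j = x.
  by rewrite /line eta0 add0r /u -/v divff ?gt_eqF// mulr1.
under eq_Rintegral do rewrite lineE.
have [K1 [m1 gK]] := line_growth (eta ^~ w) u ng.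
have [K2 [m2 dgK]] := line_growth (eta ^~ w) u ndg.
pose m := maxn m1 m2; pose K : R := `|K1| + `|K2| / v.
have lw e (k : nat) (L M : R) : (k <= m)%N -> L <= M -> 0 <= M -> L * (1 + e ^+ 2) ^+ k <= M * (1 + e ^+ 2) ^+ m.
  move=> km LM M0; have e1 : 1 <= 1 + e ^+ 2 by rewrite lerDl sqr_ge0.
  rewrite (@le_trans _ _ (M * (1 + e ^+ 2) ^+ k))//.
    by rewrite ler_wpM2r// exprn_ge0// (le_trans _ e1).
  by rewrite ler_wpM2l// ler_weXn2l.
(* A step [e] along [u] is a step [e / v] along [C_j]; this [1 / v] will cancel the variance
   produced by [normal_ibp]. *)
have lineC e : line (eta ^~ w) u e = line (eta ^~ w) (C j) (e / v).
  by apply/funext => k; rewrite /line /u; congr (_ + _); ring.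
have dG (e : R) : is_derive e (1 : R) (fun x => g (line (eta ^~ w) u x)) (dg (line (eta ^~ w) u e) / v).
  under eq_fun do rewrite lineC.
  rewrite lineC.
  have H1 : is_derive e (1 : R) (fun e : R => e / v) v^-1.
    apply: (is_derive_eq (is_deriveM (is_derive_id e (1 : R)) (is_derive_cst (v^-1 : R) e (1 : R)))).
    by rewrite /GRing.scale /= mulr0 add0r mulr1.
  exact: (@is_derive1_comp _ (fun e => g (line (eta ^~ w) (C j) e)) (fun e => e / v)
    _ _ _ (has_dir_line (eta ^~ w) (e / v) gdg) H1).
have K0 : 0 <= `|K2| / v by rewrite divr_ge0// ltW.
rewrite (@normal_ibp _ _ m K _ (fun x => dg (line (eta ^~ w) u x) / v) s0 dG).
- rewrite sqr_sqrtr ?(ltW v0)// RintegralZr//; first by rewrite mulrC divfK// gt_eqF.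
  apply: (@integrable_normal _ _ m2 _ K2) => //.
  by apply: continuous_measurable_fun; exact: (nice_line ndg).
- by move=> x; apply: cvgM; [exact: (nice_line ndg)|exact: cvg_cst].
- move=> x; rewrite (le_trans (gK x))// lw ?leq_maxl//.
    by rewrite (le_trans (ler_norm _))// lerDl.
  by rewrite addr_ge0.
- move=> x; have vi : `|v^-1| = v^-1 by rewrite gtr0_norm// invr_gt0.
  rewrite normrM vi.
  rewrite (@le_trans _ _ (K2 / v * (1 + x ^+ 2) ^+ m2))//.
    by rewrite mulrAC ler_wpM2r// invr_ge0 ltW.
  rewrite lw ?leq_maxr// ?addr_ge0//.
  rewrite (@le_trans _ _ (`|K2| / v))//; last by rewrite lerDr.
  by rewrite ler_wpM2r ?ler_norm// invr_ge0 ltW.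
Qed.

End gfam.

(** * From Gaussian linear combinations to cosine expectations *)

Section gauss_vec_cos.
Context (R : realType) d (T : measurableType d) (P : probability T R) (J : finType).
Variables (V : J -> T -> R) (S : J -> J -> R).
Hypotheses (mV : forall j, measurable_fun setT (V j)).
Hypothesis VS : gauss_vec P V S.

Let mlin (t : J -> R) : measurable_fun setT (fun w => \sum_j t j * V j w).
Proof. by apply: measurable_sum => j; exact: measurable_funM. Qed.

(* For a negative variance [gauss_law] would be the uniform law on [0, 1], which is not symmetric. *)
Lemma gauss_vec_qf_ge0 (t : J -> R) : 0 <= qf S t t.
Proof.
rewrite leNgt; apply/negP => q0.
have qN : qf S (fun j => - t j) (fun j => - t j) = qf S t t.
  by apply: eq_bigr => i _; apply: eq_bigr => j _; ring.
have law0 (A : set R) : measurable A -> gauss_law (qf S t t) A = normal_prob 0 0 A.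
  by move=> mA; rewrite /gauss_law (lt_eqF q0) (ler0_sqrtr (ltW q0)).
have H1 : P [set w | `]-oo, (0 : R)[%classic (\sum_j t j * V j w)] =
  gauss_law (qf S t t) `]-oo, (0 : R)[%classic by exact: VS.
have H2 : P [set w | `](0 : R), +oo[%classic (\sum_j (- t j) * V j w)] =
  gauss_law (qf S (fun j => - t j) (fun j => - t j)) `](0 : R), +oo[%classic.
  by apply: (VS (fun j => - t j)).
have E : [set w | `](0 : R), +oo[%classic (\sum_j (- t j) * V j w)] =
    [set w | `]-oo, (0 : R)[%classic (\sum_j t j * V j w)].
  have SN w : \sum_j (- t j) * V j w = - \sum_j t j * V j w.
    by rewrite -sumrN; apply: eq_bigr => j _; rewrite mulNr.
  by apply/seteqP; split => w /=; rewrite SN !in_itv/= ?andbT oppr_gt0.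
rewrite E H1 qN !law0// in H2; move: H2.
rewrite /normal_prob /normal_pdf eqxx !integral_indic//.
have -> : `[(0 : R), 1]%classic `&` `]-oo, (0 : R)[%classic = set0.
  by rewrite -subset0 => x [] /=; rewrite !in_itv/= => /andP[x0 _]; rewrite ltNge x0.
have -> : `[(0 : R), 1]%classic `&` `](0 : R), +oo[%classic = `](0 : R), 1]%classic.
  apply/seteqP; split => x /=; rewrite !in_itv/= ?andbT; first by move=> [/andP[_ ->] ->].
  by move=> /andP[x0 ->]; rewrite x0 ltW.
rewrite measure0.
move=> H; have := etrans H (lebesgue_measure_itv `](0 : R), 1]).
by rewrite /= lte_fin ltr01 oppr0 adde0 => /eqP; rewrite eqe eq_sym oner_eq0.
Qed.

Lemma gauss_vec_cos (t : J -> R) (th : R) :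
  \int[P]_w cos (\sum_j t j * V j w + th) = expR (- (qf S t t / 2)) * cos th.
Proof.
have := gauss_vec_qf_ge0 t; rewrite le_eqVlt => /predU1P[q0|q0].
  have lawE B : measurable B -> P ((fun w => \sum_j t j * V j w) @^-1` B) = \d_(0 : measurableTypeR R) B.
    by move=> mB; apply: (etrans (VS t mB)); rewrite -/(qf S t t) -q0 /gauss_law eqxx.
  have mc : measurable_fun setT (fun x : measurableTypeR R => cos (x + th)).
    by apply: (measurableT_comp (@measurable_cosE R)); apply: measurable_funD.
  rewrite (Rintegral_law (mlin t) lawE mc); last first.
    by apply: (@integrable_le_cst _ _ _ _ _ 1) => // x; exact: normr_cos_le1.
  rewrite -q0 mul0r oppr0 expR0 mul1r /Rintegral integral_dirac//; last exact/measurable_EFinP.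
  by rewrite diracT mul1e /= add0r.
have lawE B : measurable B -> P ((fun w => \sum_j t j * V j w) @^-1` B) = normal_prob 0 (Num.sqrt (qf S t t)) B.
  by move=> mB; apply: (etrans (VS t mB)); rewrite -/(qf S t t) /gauss_law gt_eqF.
have mc : measurable_fun setT (fun x : measurableTypeR R => cos (x + th)).
  by apply: (measurableT_comp (@measurable_cosE R)); apply: measurable_funD.
rewrite (Rintegral_law (mlin t) lawE mc); last first.
  by apply: (@integrable_le_cst _ _ _ _ _ 1) => // x; exact: normr_cos_le1.
have := @normal_cos R (Num.sqrt (qf S t t)) 1 th; rewrite sqrtr_gt0 => /(_ q0).
rewrite sqr_sqrtr ?(ltW q0)// expr1n mulr1 => <-.
by apply: eq_Rintegral => x _; rewrite mul1r.
Qed.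

End gauss_vec_cos.

Section cos_indep2.
Context (R : realType) d (T : measurableType d) (P : probability T R) (I J : finType).
Variables (U : I -> T -> R) (V : J -> T -> R) (qU : (I -> R) -> R) (qV : (J -> R) -> R).
Hypotheses (mU : forall i, measurable_fun setT (U i)) (mV : forall j, measurable_fun setT (V j)).
Hypothesis UV : indep2 P U V.
Hypothesis cU : forall t th, \int[P]_w cos (\sum_i t i * U i w + th) = expR (- (qU t / 2)) * cos th.
Hypothesis cV : forall t th, \int[P]_w cos (\sum_j t j * V j w + th) = expR (- (qV t / 2)) * cos th.

Lemma cos_indep2 (t : I -> R) (s : J -> R) (th : R) :
  \int[P]_w cos (\sum_i t i * U i w + \sum_j s j * V j w + th) =
  expR (- ((qU t + qV s) / 2)) * cos th.
Proof.
pose f (z : family_space U * family_space V) :=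
  cos (\sum_i t i * U i z.1 + \sum_j s j * V j z.2 + th).
have mf : measurable_fun setT f.
  apply: (measurableT_comp (@measurable_cosE R)); apply: measurable_funD => //.
  apply: measurable_funD; apply: measurable_sum => k; apply: measurable_funM => //.
    exact: (measurableT_comp (@measurable_family_member _ _ _ _ U k) measurable_fst).
  exact: (measurableT_comp (@measurable_family_member _ _ _ _ V k) measurable_snd).
have mlU : measurable_fun setT (fun w => \sum_i t i * U i w).
  by apply: measurable_sum => k; exact: measurable_funM.
have mlV : measurable_fun setT (fun w => \sum_i s i * V i w).
  by apply: measurable_sum => k; exact: measurable_funM.
have := @Rintegral_indep_families _ _ _ P _ _ U V mU mV UV f mf.
rewrite /f /= => ->.
- have E w : \int[P]_w' cos (\sum_i t i * U i w + \sum_j s j * V j w' + th) =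
    expR (- (qV s / 2)) * cos (\sum_i t i * U i w + th).
    rewrite -cV; apply: eq_Rintegral => w' _; congr cos; ring.
  under eq_Rintegral do rewrite E.
  rewrite RintegralZl//; last first.
    apply: (@integrable_le_cst _ _ _ _ _ 1) => [|w]; last exact: normr_cos_le1.
    by apply: (measurableT_comp (@measurable_cosE R)); exact: measurable_funD.
  by rewrite cU mulrA -expRD; congr (expR _ * _); field.
- apply: (@integrable_le_cst _ _ _ _ _ 1) => [|w]; last exact: normr_cos_le1.
  apply: (measurableT_comp (@measurable_cosE R)); apply: measurable_funD => //.
  exact: measurable_funD.
- move=> w; apply: (@integrable_le_cst _ _ _ _ _ 1) => [|w']; last exact: normr_cos_le1.
  apply: (measurableT_comp (@measurable_cosE R)); apply: measurable_funD => //.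
  exact: measurable_funD.
Qed.

End cos_indep2.

(** * Stacking independent Gaussian rows *)

Section rows.
Context (R : realType) d (T : measurableType d) (P : probability T R) (n : nat) (J : finType).
Variables (V : 'I_n -> J -> T -> R) (S : J -> J -> R).
Hypotheses (mV : forall i j, measurable_fun setT (V i j)).
Hypothesis iV : mutual_indep P V.
Hypothesis gV : forall i, gauss_vec P (V i) S.

(** Rows from [m] on are set to 0 instead of being removed, so the index type stays fixed during the
    induction on the number of rows. *)
Let U m (ij : 'I_n * J) w := if (ij.1 < m)%N then V ij.1 ij.2 w else 0.

Let mU m ij : measurable_fun setT (U m ij).
Proof. by rewrite /U; case: (ij.1 < m)%N. Qed.

Let indepU (m : 'I_n) : indep2 P (U m) (V m).
Proof.
move=> A B mA mB.
pose A' (i : 'I_n) (j : J) := if (i < m)%N then A (i, j) else setT.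
pose AB (i : 'I_n) (j : J) := if (i < m)%N then A (i, j) else if i == m then B j else setT.
have mA' i j : measurable (A' i j) by rewrite /A'; case: ifP.
have mAB i j : measurable (AB i j) by rewrite /AB; case: ifP => // _; case: ifP.
(* The suppressed entries are constantly 0: if one of their boxes misses 0 the event is empty,
   otherwise those boxes impose nothing. *)
have [A0|] := pselect (forall (i : 'I_n) (j : J), ~~ (i < m)%N -> A (i, j) 0); last first.
  move=> nA; have -> : rect (U m) A = set0.
    rewrite -subset0 => w H; apply: nA => i j im.
    by have := H (i, j); rewrite /U /= (negbTE im).
  by rewrite set0I measure0 mul0e.
have -> : rect (U m) A = [set w | forall i j, A' i j (V i j w)].
  apply/seteqP; split => w H.
    by move=> i j; have := H (i, j); rewrite /A' /U /=; case: ifP.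
  move=> [i j]; have := H i j; rewrite /A' /U /=; case: ifP => // im _.
  by apply: A0; rewrite im.
have -> : [set w | forall i j, A' i j (V i j w)] `&` rect (V m) B =
    [set w | forall i j, AB i j (V i j w)].
  apply/seteqP; split => w.
    move=> [H1 H2] i j; have := H1 i j; rewrite /A' /AB; case: ifP => // _ _.
    by case: eqP => // ->; exact: H2.
  move=> H; split => [i j|j]; first by have := H i j; rewrite /A' /AB; case: ifP.
  by have := H m j; rewrite /AB ltnn eqxx.
rewrite !iV// (bigD1 m)//= [in RHS](bigD1 m)//=.
have -> : rect (V m) (A' m) = setT.
  by apply/seteqP; split => // w _ j; rewrite /A' ltnn.
have -> : rect (V m) (AB m) = rect (V m) B.
  by apply/seteqP; split => w H j; have := H j; rewrite /AB ltnn eqxx.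
rewrite probability_setT mul1e muleC; congr (_ * _)%E.
apply: eq_bigr => i im; congr (P _); apply/seteqP; split => w H j; have := H j.
  by rewrite /A' /AB (negbTE im).
by rewrite /A' /AB (negbTE im).
Qed.

Lemma rows_cos (t : 'I_n * J -> R) (th : R) :
  \int[P]_w cos (\sum_ij t ij * V ij.1 ij.2 w + th) =
  expR (- (\sum_i qf S (fun j => t (i, j)) (fun j => t (i, j)) / 2)) * cos th.
Proof.
pose q m (t : 'I_n * J -> R) := \sum_(i < n | (i < m)%N) qf S (fun j => t (i, j)) (fun j => t (i, j)).
have H m : (m <= n)%N -> forall t th, \int[P]_w cos (\sum_ij t ij * U m ij w + th) =
    expR (- (q m t / 2)) * cos th.
  elim: m => [_|m IH mn] {}t {}th.
    rewrite /q big_pred0// mul0r oppr0 expR0 mul1r.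
    under eq_Rintegral do (rewrite big1; last by move=> ij _; rewrite /U ltn0 mulr0).
    by under eq_Rintegral do rewrite add0r; rewrite Rintegral_prob_cst.
  pose o := Ordinal mn.
  have := @cos_indep2 _ _ _ P _ _ (U o) (V o) _ _ (mU o) (mV o) (@indepU o) (IH (ltnW mn))
    (gauss_vec_cos (mV o) (gV o)) t (fun j => t (o, j)) th.
  have -> : q o t + qf S (fun j => t (o, j)) (fun j => t (o, j)) = q m.+1 t.
    rewrite /q [in RHS](bigD1 o)//= addrC; congr (_ + _); apply: eq_bigl => i.
    by rewrite ltnS [in RHS]leq_eqVlt -val_eqE /=; case: ltngtP.
  move=> <-; apply: eq_Rintegral => w _; congr (cos (_ + _)).
  have -> : \sum_j t (o, j) * V o j w = \sum_(ij : 'I_n * J) (if ij.1 == o then t ij * V ij.1 ij.2 w else 0).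
    rewrite [RHS](eq_bigr (fun ij : 'I_n * J =>
      if ij.1 == o then t (ij.1, ij.2) * V ij.1 ij.2 w else 0)); last by case.
    rewrite -(pair_bigA _ (fun i j => if i == o then t (i, j) * V i j w else 0)) /=.
    rewrite (bigD1 o)//= [X in _ + X]big1 ?addr0; first by apply: eq_bigr => j _; rewrite eqxx.
    by move=> i /negPf ->; rewrite big1.
  rewrite -big_split; apply: eq_bigr => -[i j] _ /=.
  rewrite /U /= ltnS leq_eqVlt -val_eqE /=; case: ltngtP => im /=; rewrite ?mulr0 ?addr0 ?add0r//.
have := H n (leqnn n) t th.
rewrite /q big_mkcond /= => E.
transitivity (\int[P]_w cos (\sum_ij t ij * U n ij w + th)).
  apply: eq_Rintegral => w _; congr (cos (_ + _)); apply: eq_bigr => -[i j] _.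
  by rewrite /U /= ltn_ord.
rewrite E big_distrl /=; congr (expR (- _) * _); apply: eq_bigr => i _.
by rewrite ltn_ord.
Qed.

End rows.

(** * The Gaussian family of responses and residuals *)

Section regression_family.
Context (R : realType) d (T : measurableType d) (P : probability T R) (n p : nat).
Variables (X : 'I_n -> 'I_p -> T -> R) (eps : 'I_n -> T -> R).
Variables (S : 'I_p -> 'I_p -> R) (beta : 'I_p -> R) (s2 : R).
Hypotheses (mX : forall i k, measurable_fun setT (X i k)) (me : forall i, measurable_fun setT (eps i)).
Hypothesis Ssym : forall k l, S k l = S l k.
Hypothesis iX : mutual_indep P X.
Hypothesis gX : forall i, gauss_vec P (X i) S.
Hypothesis ge : gauss_vec P eps (fun i j => s2 * (i == j)%:R).
Hypothesis iXe : indep2 P (fun (ij : 'I_n * 'I_p) w => X ij.1 ij.2 w) eps.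

Let b k := \sum_l S k l * beta l.
Let tau := \sum_k \sum_l beta k * beta l * S k l + s2.
Hypothesis tau0 : tau != 0.

Definition resid_cov (k l : 'I_p) : R := S k l - b k * b l / tau.

Definition reg_cov (j j' : 'I_n + 'I_n * 'I_p) : R :=
  match j, j' with
  | inl i, inl i' => tau * (i == i')%:R
  | inr (i, k), inr (i', l) => (i == i')%:R * resid_cov k l
  | _, _ => 0
  end.

Definition response (i : 'I_n) (w : T) : R := \sum_k X i k w * beta k + eps i w.

Definition reg_fam (j : 'I_n + 'I_n * 'I_p) (w : T) : R :=
  match j with
  | inl i => response i w
  | inr (i, k) => X i k w - b k / tau * response i w
  end.

Lemma measurable_reg_fam j : measurable_fun setT (reg_fam j).
Proof.
have mY i : measurable_fun setT (response i).
  apply: measurable_funD => //; apply: measurable_sum => k; exact: measurable_funM.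
case: j => [i|[i k]] /=; first exact: mY.
by apply: measurable_funB => //; exact: measurable_funM.
Qed.

(** Testing [(Y, W)] against [t] amounts to testing [X] against [tX] and [eps] against [u]. For each
    row the exponent is [tW'S tW + 2 u bt + tau u^2] with [u = tY - bt / tau]; completing the square
    leaves [tau tY^2 + tW'S tW - bt^2 / tau], without cross terms between [Y] and [W]. *)
Lemma gfam_reg_fam : gfam P reg_fam reg_cov.
Proof.
move=> t th.
pose tY i := t (inl i); pose tW i k := t (inr (i, k)).
pose u i := tY i - \sum_k tW i k * (b k / tau).
pose tX (ij : 'I_n * 'I_p) := tW ij.1 ij.2 + u ij.1 * beta ij.2.
have lin w : \sum_j t j * reg_fam j w =
    \sum_ij tX ij * X ij.1 ij.2 w + \sum_i u i * eps i w.
  rewrite big_sumType /=.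
  rewrite (eq_bigr (fun ij : 'I_n * 'I_p => tW ij.1 ij.2 *
    (X ij.1 ij.2 w - b ij.2 / tau * response ij.1 w))); last by case.
  rewrite -(pair_bigA _ (fun i k => tW i k * (X i k w - b k / tau * response i w))) /=.
  rewrite -(pair_bigA _ (fun i k => (tW i k + u i * beta k) * X i k w)) /=.
  rewrite -!big_split; apply: eq_bigr => i _ /=.
  under [in RHS]eq_bigr do rewrite mulrDl.
  under [in LHS]eq_bigr do rewrite mulrBr.
  rewrite sumrB big_split /= -/(tY i).
  have -> : \sum_k tW i k * (b k / tau * response i w) =
      (\sum_k tW i k * (b k / tau)) * response i w.
    by rewrite big_distrl; apply: eq_bigr => k _ /=; ring.
  have -> : \sum_k u i * beta k * X i k w = u i * \sum_k X i k w * beta k.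
    by rewrite big_distrr; apply: eq_bigr => k _ /=; ring.
  by rewrite /u /response; ring.
under eq_Rintegral do rewrite lin.
have cX := rows_cos mX iX gX.
have ce := gauss_vec_cos me ge.
rewrite (@cos_indep2 _ _ _ _ _ _ _ _ (fun t => \sum_i qf S (fun j => t (i, j)) (fun j => t (i, j)))
   (fun t => qf (fun i j => s2 * (i == j)%:R) t t) _ me iXe _ ce); last 2 first.
- by case=> i k; exact: mX.
- by move=> t' th'; rewrite cX big_distrl.
congr (expR (- (_ / 2)) * _).
have -> : qf (fun i j => s2 * (i == j)%:R) u u = \sum_i s2 * u i ^+ 2.
  apply: eq_bigr => i _; rewrite (bigD1 i)//= eqxx big1 ?addr0 ?mulr1; first by ring.
  by move=> j /negPf ji; rewrite eq_sym ji !(mulr0, mul0r).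
rewrite -big_split /=.
have -> : qf reg_cov t t = \sum_i (tau * tY i ^+ 2 + qf resid_cov (tW i) (tW i)).
  rewrite /qf big_sumType /= big_split /=; congr (_ + _).
    apply: eq_bigr => i _; rewrite big_sumType /= [X in _ + X]big1 ?addr0; last first.
      by move=> [i' k] _; rewrite mulr0 mul0r.
    rewrite (bigD1 i)//= eqxx big1 ?addr0 ?mulr1; first by rewrite /tY; ring.
    by move=> j /negPf ji; rewrite eq_sym ji !(mulr0, mul0r).
  rewrite (eq_bigr (fun ik : 'I_n * 'I_p => \sum_l tW ik.1 ik.2 * resid_cov ik.2 l * tW ik.1 l)).
    by rewrite -(pair_bigA _ (fun i k => \sum_l tW i k * resid_cov k l * tW i l)).
  move=> [i k] _; rewrite big_sumType /= big1 ?add0r; last by move=> i' _; rewrite mulr0 mul0r.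
  rewrite (eq_bigr (fun il : 'I_n * 'I_p => if il.1 == i then tW i k * resid_cov k il.2 * tW i il.2 else 0)).
    rewrite -(pair_bigA _ (fun i' l => if i' == i then tW i k * resid_cov k l * tW i l else 0)) /=.
    rewrite (bigD1 i)//= [X in _ + X]big1 ?addr0; first by apply: eq_bigr => l _; rewrite eqxx.
    by move=> i' /negPf ->; rewrite big1.
  move=> [i' l] _ /=; rewrite eq_sym; case: eqP => [->|_]; first by rewrite mul1r.
  by rewrite mul0r mulr0 mul0r.
apply: eq_bigr => i _.
pose bt := \sum_k tW i k * b k.
have E1 : qf S (fun j => tX (i, j)) (fun j => tX (i, j)) =
    qf S (tW i) (tW i) + 2 * u i * bt + u i ^+ 2 * (tau - s2).
  have qZ (a : R) (f g : 'I_p -> R) : qf S (fun k => a * f k) g = a * qf S f g.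
    rewrite /qf big_distrr; apply: eq_bigr => k _ /=; rewrite big_distrr.
    by apply: eq_bigr => l _ /=; ring.
  have qbt : qf S beta (tW i) = bt.
    rewrite (qfC Ssym) /qf /bt; apply: eq_bigr => k _; rewrite /b big_distrr.
    by apply: eq_bigr => l _ /=; ring.
  have qbb : qf S beta beta = tau - s2.
    rewrite /tau addrK; apply: eq_bigr => k _; apply: eq_bigr => l _; ring.
  rewrite /tX /= qfDl ![qf S _ (fun j => _ + _)](qfC Ssym) !qfDl !qZ.
  rewrite (qfC Ssym (tW i) (fun k => u i * beta k)) (qfC Ssym beta (fun k => u i * beta k)).
  rewrite !qZ qbb !qbt; ring.
have E2 : qf resid_cov (tW i) (tW i) = qf S (tW i) (tW i) - bt ^+ 2 / tau.
  rewrite expr2 [X in X / tau]big_distrl /= [X in _ - X]big_distrl /= /qf -sumrB.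
  apply: eq_bigr => k _; rewrite big_distrr /= [X in _ - X]big_distrl /= -sumrB.
  by apply: eq_bigr => l _; rewrite /resid_cov; ring.
have ui : u i = tY i - bt / tau.
  by rewrite /u /bt big_distrl; congr (_ - _); apply: eq_bigr => k _ /=; ring.
by rewrite E1 E2 ui; field.
Qed.

End regression_family.

(** * Moments *)

Section regression_moments.
Context (R : realType) d (T : measurableType d) (P : probability T R) (n p : nat).
Local Notation J := ('I_n + 'I_n * 'I_p)%type.
Variables (V : J -> T -> R) (G : 'I_p -> 'I_p -> R) (tau : R).

Definition split_cov (j j' : J) : R :=
  match j, j' with
  | inl i, inl i' => tau * (i == i')%:R
  | inr (i, k), inr (i', l) => (i == i')%:R * G k l
  | _, _ => 0
  end.

Hypotheses (mV : forall j, measurable_fun setT (V j)) (Gsym : forall k l, G k l = G l k).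
Hypothesis VC : gfam P V split_cov.

Let split_cov_sym j j' : split_cov j j' = split_cov j' j.
Proof.
case: j => [i|[i k]]; case: j' => [i'|[i' l]] //=; first by rewrite eq_sym.
by rewrite eq_sym Gsym.
Qed.

Let inice (g : (J -> R) -> R) (ng : nice g) := integrable_nice mV VC ng.

Definition gexp (g : (J -> R) -> R) : R := \int[P]_w g (V ^~ w).
Local Notation E := gexp.

Let ibp j g dg : nice g -> nice dg -> has_dir (split_cov j) g dg ->
  E (fun x => x j * g x) = E dg.
Proof. exact: (gfam_ibp mV split_cov_sym VC). Qed.

Lemma gexpD g h : nice g -> nice h -> E (fun x => g x + h x) = E g + E h.
Proof.
move=> ng nh; exact: (RintegralD measurableT (inice ng) (inice nh)).
Qed.

Lemma gexpZ (c : R) g : nice g -> E (fun x => c * g x) = c * E g.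
Proof.
by move=> ng; exact: (RintegralZl c measurableT (inice ng)).
Qed.

Lemma gexp_cst (c : R) : E (fun=> c) = c.
Proof. exact: Rintegral_prob_cst. Qed.

Lemma gexp_sum (I : finType) (g : I -> (J -> R) -> R) :
  (forall i, nice (g i)) -> E (fun x => \sum_i g i x) = \sum_i E (g i).
Proof.
move=> ng; elim: (index_enum I) => [|i r IH].
  by rewrite big_nil -[RHS](gexp_cst 0); congr E; apply/funext => x; rewrite big_nil.
rewrite big_cons -IH -gexpD//; last exact: nice_sum.
by congr E; apply/funext => x; rewrite big_cons.
Qed.

Lemma ler_gexp g h : nice g -> nice h -> (forall x, g x <= h x) -> E g <= E h.
Proof.
move=> ng nh gh; exact: (le_Rintegral measurableT (inice ng) (inice nh)).
Qed.

Definition qY (x : J -> R) : R := \sum_i x (inl i) ^+ 2.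
Definition hW (k : 'I_p) (x : J -> R) : R := \sum_i x (inr (i, k)) * x (inl i).

Lemma nice_qY : nice qY.
Proof.
apply: nice_sum => i; rewrite (_ : (fun _ => _) = fun x : J -> R => x (inl i) * x (inl i)).
  by apply: niceM; exact: nice_coord.
by apply/funext => x; rewrite expr2.
Qed.

Lemma nice_hW k : nice (hW k).
Proof. by apply: nice_sum => i; apply: niceM; exact: nice_coord. Qed.

(* The derivative of [g] along the covariance direction of W_ik is y_i g'
   when [g] depends only on [qY] and [hW]. *)
Record hder (k : 'I_p) (g g' : (J -> R) -> R) : Prop := Hder {
  hder_nice : nice g; hder_nice' : nice g';
  hder_dir : forall i, has_dir (split_cov (inr (i, k))) g (fun x => x (inl i) * g' x) }.

(* Likewise, [g'] is the image of [g] under the Euler field of the y-variables. *)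
Record eder (g g' : (J -> R) -> R) : Prop := Eder {
  eder_nice : nice g; eder_nice' : nice g';
  eder_dir : exists dg : 'I_n -> (J -> R) -> R,
    [/\ forall i, nice (dg i), forall i, has_dir (split_cov (inl i)) g (dg i)
      & forall x, \sum_i x (inl i) * dg i x = tau * g' x] }.

Lemma gexp_hW k g g' : hder k g g' -> E (fun x => hW k x * g x) = E (fun x => qY x * g' x).
Proof.
move=> [ng ng' dg].
have nc i : nice (fun x : J -> R => x (inl i)) by exact: nice_coord.
transitivity (\sum_i E (fun x => x (inr (i, k)) * (x (inl i) * g x))).
  rewrite -gexp_sum; last by move=> i; apply: niceM; [exact: nice_coord|exact: niceM].
  by congr E; apply/funext => x; rewrite /hW big_distrl; apply: eq_bigr => i _ /=; rewrite mulrA.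
transitivity (\sum_i E (fun x => x (inl i) * (x (inl i) * g' x))).
  apply: eq_bigr => i _; apply: (ibp (j := inr (i, k)) (g := fun x => x (inl i) * g x)).
  - exact: niceM.
  - by do 2 apply: niceM => //.
  - apply: has_dir_eq (has_dirM (has_dir_coord _ (inl i)) (dg i)) _ => x /=.
    by rewrite mul0r add0r.
rewrite -gexp_sum; last by move=> i; do 2 apply: niceM => //.
by congr E; apply/funext => x; rewrite /qY big_distrl; apply: eq_bigr => i _ /=; ring.
Qed.

(** In [E[y_i (y_i g)]] the derivative of the inner [y_i] contributes [tau] for each of the [n]
    indices, and the derivative of [g] contributes the Euler term. *)
Lemma gexp_qY g g' : eder g g' ->
  E (fun x => qY x * g x) = n%:R * tau * E g + tau * E g'.
Proof.
move=> [ng ng' [dg [ndg Hdg Edg]]].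
have nc i : nice (fun x : J -> R => x (inl i)) by exact: nice_coord.
transitivity (\sum_i E (fun x => x (inl i) * (x (inl i) * g x))).
  rewrite -gexp_sum; last by move=> i; do 2 apply: niceM => //.
  by congr E; apply/funext => x; rewrite /qY big_distrl; apply: eq_bigr => i _ /=; ring.
transitivity (\sum_i E (fun x => tau * g x + x (inl i) * dg i x)).
  apply: eq_bigr => i _; apply: (ibp (j := inl i) (g := fun x => x (inl i) * g x)).
  - exact: niceM.
  - by apply: niceD; apply: niceM => //; exact: nice_cst.
  - apply: has_dir_eq (has_dirM (has_dir_coord _ (inl i)) (Hdg i)) _ => x /=.
    by rewrite eqxx mulr1.
rewrite -gexp_sum; last by move=> i; apply: niceD; apply: niceM => //; exact: nice_cst.
rewrite -!gexpZ// -gexpD; last 2 first.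
  by apply: niceM => //; exact: nice_cst.
  by apply: niceM => //; exact: nice_cst.
congr E; apply/funext => x; rewrite big_split /= sumr_const card_ord Edg -mulrnAl.
by rewrite mulr_natl.
Qed.

Lemma hder_eq k g g' f f' : hder k g g' -> g =1 f -> g' =1 f' -> hder k f f'.
Proof. by move=> H /funext <- /funext <-. Qed.

Lemma hder_cst k c : hder k (fun=> c) (fun=> 0).
Proof.
split; [exact: nice_cst|exact: nice_cst|move=> i].
by apply: has_dir_eq (has_dir_cst _ _) _ => x; rewrite mulr0.
Qed.

Lemma hderD k g g' f f' : hder k g g' -> hder k f f' ->
  hder k (fun x => g x + f x) (fun x => g' x + f' x).
Proof.
move=> [? ? dg] [? ? df]; split; [exact: niceD|exact: niceD|move=> i].
by apply: has_dir_eq (has_dirD (dg i) (df i)) _ => x; rewrite mulrDr.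
Qed.

Lemma hderM k g g' f f' : hder k g g' -> hder k f f' ->
  hder k (fun x => g x * f x) (fun x => g' x * f x + g x * f' x).
Proof.
move=> [? ? dg] [? ? df]; split; [exact: niceM|by apply: niceD; exact: niceM|move=> i].
by apply: has_dir_eq (has_dirM (dg i) (df i)) _ => x; ring.
Qed.

Lemma hder_sum k (I : finType) (g g' : I -> (J -> R) -> R) : (forall i, hder k (g i) (g' i)) ->
  hder k (fun x => \sum_i g i x) (fun x => \sum_i g' i x).
Proof.
move=> H; split; [by apply: nice_sum => i; case: (H i)|by apply: nice_sum => i; case: (H i)|].
move=> i; apply: has_dir_eq.
  by apply: has_dir_sum => j; case: (H j) => _ _; exact.
by move=> x; rewrite big_distrr.
Qed.

Lemma hder_comp k (phi dphi : R -> R) (K : R) g g' : continuous phi -> continuous dphi ->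
  (forall y, `|phi y| <= K * (1 + `|y|)) -> (forall y, `|dphi y| <= K * (1 + `|y|)) ->
  (forall y : R, is_derive y (1 : R) phi (dphi y)) -> hder k g g' ->
  hder k (fun x => phi (g x)) (fun x => dphi (g x) * g' x).
Proof.
move=> cp cd pK dK H [ng ng' dg]; split.
- exact: nice_comp pK ng.
- by apply: niceM => //; exact: nice_comp dK ng.
- by move=> i; apply: has_dir_eq (has_dir_comp H (dg i)) _ => x; ring.
Qed.

Lemma hder_qY k : hder k qY (fun=> 0).
Proof.
split; [exact: nice_qY|exact: nice_cst|move=> i].
apply: has_dir_eq.
  apply: (has_dir_sum _ _ (g := fun i x => x (inl i) ^+ 2) (dg := fun _ => fun=> 0)) => j.
  rewrite (_ : (fun _ => _) = fun x : J -> R => x (inl j) * x (inl j)); last first.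
    by apply/funext => x; rewrite expr2.
  apply: has_dir_eq (has_dirM (has_dir_coord _ (inl j)) (has_dir_coord _ (inl j))) _ => x /=.
  by rewrite mulr0 mul0r addr0.
by move=> x; rewrite big1 ?mulr0.
Qed.

Lemma hder_hW k l : hder k (hW l) (fun=> G k l).
Proof.
split; [exact: nice_hW|exact: nice_cst|move=> i].
apply: has_dir_eq.
  apply: has_dir_sum => j.
  exact: (has_dirM (has_dir_coord _ (inr (j, l))) (has_dir_coord _ (inl j))).
move=> x /=; rewrite (bigD1 i)//= eqxx big1 => [|j /negPf ji].
  by rewrite addr0 mulr0 addr0 mul1r mulrC.
by rewrite eq_sym ji mulr0 addr0 !mul0r.
Qed.

Lemma eder_eq g g' f f' : eder g g' -> g =1 f -> g' =1 f' -> eder f f'.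
Proof. by move=> H /funext <- /funext <-. Qed.

Lemma eder_cst c : eder (fun=> c) (fun=> 0).
Proof.
split; [exact: nice_cst|exact: nice_cst|exists (fun _ => fun=> 0); split].
- by move=> i; exact: nice_cst.
- by move=> i; exact: has_dir_cst.
- by move=> x; rewrite big1 ?mulr0// => i _; rewrite mulr0.
Qed.

Lemma ederD g g' f f' : eder g g' -> eder f f' ->
  eder (fun x => g x + f x) (fun x => g' x + f' x).
Proof.
move=> [? ? [dg [ndg Hdg Edg]]] [? ? [df [ndf Hdf Edf]]]; split; [exact: niceD|exact: niceD|].
exists (fun i x => dg i x + df i x); split.
- by move=> i; exact: niceD.
- by move=> i; exact: has_dirD.
- move=> x; rewrite mulrDr -Edg -Edf -big_split.
  by apply: eq_bigr => i _ /=; rewrite mulrDr.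
Qed.

Lemma ederM g g' f f' : eder g g' -> eder f f' ->
  eder (fun x => g x * f x) (fun x => g' x * f x + g x * f' x).
Proof.
move=> [? ? [dg [ndg Hdg Edg]]] [? ? [df [ndf Hdf Edf]]].
split; [exact: niceM|by apply: niceD; exact: niceM|].
exists (fun i x => dg i x * f x + g x * df i x); split.
- by move=> i; apply: niceD; exact: niceM.
- by move=> i; exact: has_dirM.
- move=> x; rewrite mulrDr mulrA -Edg mulrCA -Edf big_distrl big_distrr -big_split.
  by apply: eq_bigr => i _ /=; ring.
Qed.

Lemma eder_sum (I : finType) (g g' : I -> (J -> R) -> R) : (forall i, eder (g i) (g' i)) ->
  eder (fun x => \sum_i g i x) (fun x => \sum_i g' i x).
Proof.
move=> H; elim: (index_enum I) => [|i r IH].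
  by apply: eder_eq (eder_cst 0) _ _ => x; rewrite big_nil.
by apply: eder_eq (ederD (H i) IH) _ _ => x; rewrite big_cons.
Qed.

Lemma eder_comp (phi dphi : R -> R) (K : R) g g' : continuous phi -> continuous dphi ->
  (forall y, `|phi y| <= K * (1 + `|y|)) -> (forall y, `|dphi y| <= K * (1 + `|y|)) ->
  (forall y : R, is_derive y (1 : R) phi (dphi y)) -> eder g g' ->
  eder (fun x => phi (g x)) (fun x => dphi (g x) * g' x).
Proof.
move=> cp cd pK dK H [ng ng' [dg [ndg Hdg Edg]]]; split.
- exact: nice_comp pK ng.
- by apply: niceM => //; exact: nice_comp dK ng.
- exists (fun i x => dphi (g x) * dg i x); split.
  + by move=> i; apply: niceM => //; exact: nice_comp dK ng.
  + by move=> i; exact: has_dir_comp.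
  + by move=> x; rewrite mulrCA -Edg big_distrr; apply: eq_bigr => i _ /=; ring.
Qed.

Lemma eder_qY : eder qY (fun x => 2 * qY x).
Proof.
have n2 c i : nice (fun x : J -> R => c * x (inl i)) by apply: niceM; [exact: nice_cst|exact: nice_coord].
split; [exact: nice_qY|by apply: niceM; [exact: nice_cst|exact: nice_qY]|].
exists (fun i x => 2 * tau * x (inl i)); split => // [i|x].
  apply: has_dir_eq.
    apply: (has_dir_sum _ _ (g := fun j x => x (inl j) ^+ 2)
      (dg := fun j x => 2 * (tau * (i == j)%:R) * x (inl j))) => j.
    rewrite (_ : (fun _ => _) = fun x : J -> R => x (inl j) * x (inl j)); last first.
      by apply/funext => x; rewrite expr2.
    by apply: has_dir_eq (has_dirM (has_dir_coord _ (inl j)) (has_dir_coord _ (inl j))) _ => x /=; ring.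
  move=> x /=; rewrite (bigD1 i)//= eqxx big1 ?addr0 ?mulr1// => j /negPf ji.
  by rewrite eq_sym ji !mulr0 mul0r.
by rewrite /qY !big_distrr; apply: eq_bigr => i _ /=; ring.
Qed.

Lemma eder_hW k : eder (hW k) (hW k).
Proof.
split; [exact: nice_hW|exact: nice_hW|].
exists (fun i x => tau * x (inr (i, k))); split => [i|i|x].
- by apply: niceM; [exact: nice_cst|exact: nice_coord].
- apply: has_dir_eq.
    apply: has_dir_sum => j.
    exact: (has_dirM (has_dir_coord _ (inr (j, k))) (has_dir_coord _ (inl j))).
  move=> x /=; rewrite (bigD1 i)//= eqxx big1 => [|j /negPf ji].
    by rewrite mul0r add0r addr0 mulr1 mulrC.
  by rewrite eq_sym ji !mulr0 mul0r addr0.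
- by rewrite /hW big_distrr; apply: eq_bigr => i _ /=; ring.
Qed.

End regression_moments.

(** * Linear and quadratic forms in h *)

Section quadratic_forms.
Context (R : realType) d (T : measurableType d) (P : probability T R) (n p : nat).
Local Notation J := ('I_n + 'I_n * 'I_p)%type.
Variables (V : J -> T -> R) (G : 'I_p -> 'I_p -> R) (tau : R).
Hypotheses (mV : forall j, measurable_fun setT (V j)) (Gsym : forall k l, G k l = G l k).
Hypothesis VC : gfam P V (split_cov G tau).
Local Notation E := (gexp P V).
Local Notation hder := (hder G tau).
Local Notation eder := (eder G tau).

Definition lin (c : 'I_p -> R) (x : J -> R) : R := \sum_k c k * hW k x.
Definition bil (B : 'I_p -> 'I_p -> R) (x : J -> R) : R :=
  \sum_k \sum_l B k l * (hW k x * hW l x).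
(** The Frobenius product. As [mx3] is a product of three matrices, for symmetric [G] the values
    [mxdot G G] and [mxdot (mx3 G G G) G] are tr G^2 and tr G^4. *)
Definition mxdot (A B : 'I_p -> 'I_p -> R) : R := \sum_k \sum_l A k l * B k l.
Definition mx3 (A B C : 'I_p -> 'I_p -> R) (k l : 'I_p) : R :=
  \sum_a \sum_b A k a * B a b * C b l.

Lemma nice_lin c : nice (lin c).
Proof. by apply: nice_sum => k; apply: niceM; [exact: nice_cst|exact: nice_hW]. Qed.

Lemma nice_bil B : nice (bil B).
Proof.
apply: nice_sum => k; apply: nice_sum => l.
by apply: niceM; [exact: nice_cst|apply: niceM; exact: nice_hW].
Qed.

Lemma niceX (I : finType) (g : (I -> R) -> R) j : nice g -> nice (fun x => g x ^+ j).
Proof.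
move=> ng; elim: j => [|j IH]; first exact: nice_cst.
by under eq_fun do rewrite exprS; exact: niceM.
Qed.

Lemma nice_qX j : nice (fun x : J -> R => qY x ^+ j).
Proof. by apply: niceX; exact: nice_qY. Qed.

Lemma hder_qX k j : hder k (fun x : J -> R => qY x ^+ j) (fun=> 0).
Proof.
elim: j => [|j IH]; first exact: hder_cst.
by apply: (hder_eq (hderM (hder_qY n G tau k) IH)) => x; rewrite ?exprS// mul0r mulr0 addr0.
Qed.

Lemma eder_qX j : eder (fun x : J -> R => qY x ^+ j) (fun x => (2 * j%:R) * qY x ^+ j).
Proof.
elim: j => [|j IH].
  by apply: (eder_eq (eder_cst n G tau 1)) => x; rewrite ?expr0// mulr0 mul0r.
apply: (eder_eq (ederM (eder_qY n G tau) IH)) => x; rewrite ?exprS//.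
by rewrite -natr1; ring.
Qed.

Lemma hder_lin k c : hder k (lin c) (fun=> \sum_l c l * G k l).
Proof.
apply: hder_sum => l.
by apply: (hder_eq (hderM (hder_cst n G tau k (c l)) (hder_hW n G tau k l))) => // x; ring.
Qed.

Lemma hder_bil k B : (forall k l, B k l = B l k) ->
  hder k (bil B) (fun x => 2 * lin (fun m => \sum_l G k l * B l m) x).
Proof.
move=> Bsym; apply: (hder_eq (f := bil B)).
  apply: hder_sum => a; apply: hder_sum => b.
  exact: (hderM (hder_cst n G tau k (B a b)) (hderM (hder_hW n G tau k a) (hder_hW n G tau k b))).
  by [].
move=> x; rewrite mulr_natl mulr2n {1}/lin.
under eq_bigr do (under eq_bigr do rewrite mul0r add0r mulrDr; rewrite big_split /=).
rewrite big_split /=; congr (_ + _).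
  rewrite exchange_big; apply: eq_bigr => b _ /=; rewrite big_distrl; apply: eq_bigr => a _ /=; ring.
apply: eq_bigr => a _; rewrite big_distrl; apply: eq_bigr => b _ /=.
by rewrite (Bsym b a); ring.
Qed.

(** The chi-square moment recursion: [q^j] is homogeneous of degree [2 j] in the [y]-variables. *)
Lemma gexp_qXS j : E (fun x : J -> R => qY x ^+ j.+1) = tau * (n%:R + 2 * j%:R) * E (fun x : J -> R => qY x ^+ j).
Proof.
under eq_fun do rewrite exprS.
rewrite (gexp_qY mV Gsym VC (eder_qX j)) (gexpZ mV VC); last exact: nice_qX.
ring.
Qed.

Lemma gexp_qX_hW k j g g' : hder k g g' ->
  E (fun x : J -> R => qY x ^+ j * (hW k x * g x)) = E (fun x : J -> R => qY x ^+ j.+1 * g' x).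
Proof.
move=> H.
under eq_fun do rewrite mulrCA.
rewrite (gexp_hW mV Gsym VC (hderM (hder_qX k j) H)).
by congr gexp; apply/funext => x; rewrite mul0r add0r exprS mulrA.
Qed.

Lemma gexp_qX_lin j c g (g' : 'I_p -> (J -> R) -> R) : (forall k, hder k g (g' k)) ->
  E (fun x : J -> R => qY x ^+ j * (lin c x * g x)) = E (fun x : J -> R => qY x ^+ j.+1 * \sum_k c k * g' k x).
Proof.
move=> H.
transitivity (\sum_k E (fun x : J -> R => qY x ^+ j * (hW k x * (c k * g x)))).
  rewrite -(gexp_sum mV VC).
    congr gexp; apply/funext => x; rewrite /lin big_distrl big_distrr.
    by apply: eq_bigr => k _ /=; ring.
  move=> k; apply: niceM; first exact: nice_qX.
  apply: niceM; first exact: nice_hW.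
  by apply: niceM; [exact: nice_cst|exact: (hder_nice (H k))].
under eq_bigr => k _ do rewrite (gexp_qX_hW _ (hderM (hder_cst n G tau k (c k)) (H k))).
rewrite -(gexp_sum mV VC).
  congr gexp; apply/funext => x; rewrite big_distrr; apply: eq_bigr => k _ /=.
  by rewrite mul0r add0r.
move=> k; apply: niceM; first exact: nice_qX.
exact: hder_nice' (hderM (hder_cst n G tau k (c k)) (H k)).
Qed.

(** In accordance with the conditional law N(0, q G) of [h] given [y], under which [<c, h>] has
    variance [q c'Gc]. *)
Lemma gexp_lin2 j c :
  E (fun x : J -> R => qY x ^+ j * lin c x ^+ 2) = qf G c c * E (fun x : J -> R => qY x ^+ j.+1).
Proof.
under eq_fun do rewrite expr2.
rewrite (gexp_qX_lin j c (fun k => hder_lin k c)) -(gexpZ mV VC); last exact: nice_qX.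
congr gexp; apply/funext => x; rewrite mulrC; congr (_ * _).
apply: eq_bigr => k _; rewrite big_distrr; apply: eq_bigr => l _ /=; ring.
Qed.

(** Integration by parts is done in the first factor [h_k] of the form only; the derivative of the
    second factor [h_l] is [G k l] and produces the trace term [mxdot B G]. *)
Lemma gexp_qX_bil j B g (g' : 'I_p -> (J -> R) -> R) : (forall k, hder k g (g' k)) ->
  E (fun x : J -> R => qY x ^+ j * (bil B x * g x)) =
  E (fun x : J -> R => qY x ^+ j.+1 * (mxdot B G * g x + \sum_k \sum_l B k l * (hW l x * g' k x))).
Proof.
move=> H.
have Hk k : hder k (fun x => \sum_l B k l * (hW l x * g x))
    (fun x => \sum_l B k l * (G k l * g x + hW l x * g' k x)).
  apply: hder_sum => l.
  by apply: (hder_eq (hderM (hder_cst n G tau k (B k l)) (hderM (hder_hW n G tau k l) (H k)))) => // x; ring.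
transitivity (\sum_k E (fun x : J -> R => qY x ^+ j * (hW k x * \sum_l B k l * (hW l x * g x)))).
  rewrite -(gexp_sum mV VC).
    congr gexp; apply/funext => x; rewrite /bil big_distrl big_distrr.
    apply: eq_bigr => k _ /=; rewrite !mulrA -!mulrA; congr (_ * _); rewrite big_distrl big_distrr.
    by apply: eq_bigr => l _ /=; ring.
  move=> k; apply: niceM; first exact: nice_qX.
  by apply: niceM; [exact: nice_hW|exact: (hder_nice (Hk k))].
under eq_bigr => k _ do rewrite (gexp_qX_hW _ (Hk k)).
rewrite -(gexp_sum mV VC); last first.
  by move=> k; apply: niceM; [exact: nice_qX|exact: hder_nice' (Hk k)].
congr gexp; apply/funext => x; rewrite -big_distrr /=; congr (_ * _).
rewrite /mxdot big_distrl -big_split; apply: eq_bigr => k _ /=.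
rewrite big_distrl -big_split; apply: eq_bigr => l _ /=; ring.
Qed.

Lemma gexp_bil j B :
  E (fun x : J -> R => qY x ^+ j * bil B x) = mxdot B G * E (fun x : J -> R => qY x ^+ j.+1).
Proof.
under eq_fun do rewrite -[bil B _]mulr1.
rewrite (gexp_qX_bil j B (fun k => hder_cst n G tau k 1)) -(gexpZ mV VC); last exact: nice_qX.
congr gexp; apply/funext => x; rewrite mulr1 [X in _ + X]big1 ?addr0 1?mulrC// => k _.
by rewrite big1// => l _; rewrite !mulr0.
Qed.

Let mx3_sum (B : 'I_p -> 'I_p -> R) (u : 'I_p -> R) : (forall k l, B k l = B l k) ->
  \sum_k \sum_l B k l * (u l * (2 * \sum_m (\sum_a G k a * B a m) * u m)) =
  2 * \sum_k \sum_l mx3 B G B k l * (u k * u l).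
Proof.
move=> Bsym.
transitivity (2 * \sum_k \sum_l \sum_m \sum_a B k l * (u l * (G k a * B a m * u m))).
  rewrite [RHS]big_distrr; apply: eq_bigr => k _ /=.
  rewrite [RHS]big_distrr; apply: eq_bigr => l _ /=.
  have E2 s : B k l * (u l * (2 * s)) = 2 * (B k l * (u l * s)) by ring.
  rewrite E2; congr (_ * _).
  rewrite !big_distrr; apply: eq_bigr => m _ /=; rewrite big_distrl !big_distrr.
  by apply: eq_bigr => a _ /=; ring.
congr (_ * _); rewrite exchange_big /=; apply: eq_bigr => l _.
rewrite exchange_big /=; apply: eq_bigr => m _; rewrite /mx3 big_distrl /=.
apply: eq_bigr => k _; rewrite big_distrl; apply: eq_bigr => a _ /=.
by rewrite (Bsym l k); ring.
Qed.

(** The variance of a Gaussian quadratic form: given [y], [h'Bh] has mean [q tr(BG)] and variance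
    [2 q^2 tr(BGBG)]. *)
Lemma gexp_bil2 j B : (forall k l, B k l = B l k) ->
  E (fun x : J -> R => qY x ^+ j * (bil B x - mxdot B G * qY x) ^+ 2) =
  2 * mxdot (mx3 B G B) G * E (fun x : J -> R => qY x ^+ j.+2).
Proof.
move=> Bsym.
have nq := nice_qX; have nB := nice_bil B.
have nZ (c : R) g : nice g -> nice (fun x : J -> R => c * g x).
  by move=> ?; apply: niceM => //; exact: nice_cst.
have E2 : E (fun x : J -> R => qY x ^+ j * (bil B x * bil B x)) =
    mxdot B G * (mxdot B G * E (fun x : J -> R => qY x ^+ j.+2))
    + 2 * (mxdot (mx3 B G B) G * E (fun x : J -> R => qY x ^+ j.+2)).
  rewrite (gexp_qX_bil j B (fun k => hder_bil k Bsym)) -!gexp_bil.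
  rewrite -!(gexpZ mV VC); last 2 first.
    by apply: niceM => //; exact: nice_bil.
    by apply: niceM => //.
  rewrite -(gexpD mV VC); last 2 first.
    by apply: nZ; apply: niceM.
    by apply: nZ; apply: niceM => //; exact: nice_bil.
  congr gexp; apply/funext => x; rewrite mulrDr; congr (_ + _); first by ring.
  rewrite [RHS]mulrCA; apply: (f_equal (fun t => qY x ^+ j.+1 * t)).
  exact: (mx3_sum (fun k => hW k x) Bsym).
transitivity (E (fun x : J -> R => qY x ^+ j * (bil B x * bil B x) +
   ((- 2 * mxdot B G) * (qY x ^+ j.+1 * bil B x) + mxdot B G ^+ 2 * qY x ^+ j.+2))).
  by congr gexp; apply/funext => x; rewrite !exprS; ring.
rewrite !(gexpD mV VC) ?(gexpZ mV VC) ?E2 ?gexp_bil//; first by ring.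
all: try by apply: niceM.
- by apply: nZ; apply: niceM.
- exact: nZ.
- by apply: niceM => //; apply: niceM.
- by apply: niceD; apply: nZ => //; exact: niceM.
Qed.

End quadratic_forms.

(** * The Stein identity *)

Section stein_identity.
Context (R : realType) d (T : measurableType d) (P : probability T R) (n p : nat).
Local Notation J := ('I_n + 'I_n * 'I_p)%type.
Variables (V : J -> T -> R) (G : 'I_p -> 'I_p -> R) (tau : R).
Hypotheses (mV : forall j, measurable_fun setT (V j)) (Gsym : forall k l, G k l = G l k).
Hypothesis VC : gfam P V (split_cov G tau).
Local Notation E := (gexp P V).
Variables (a : 'I_p -> R) (N D : R).

Definition dlt (k l : 'I_p) : R := (k == l)%:R.

Lemma sum_dltl (k : 'I_p) (f : 'I_p -> R) : \sum_l dlt k l * f l = f k.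
Proof.
rewrite (bigD1 k)//= /dlt eqxx mul1r big1 ?addr0// => l /negPf lk.
by rewrite eq_sym lk mul0r.
Qed.

Lemma dltC k l : dlt k l = dlt l k.
Proof. by rewrite /dlt eq_sym. Qed.

Definition vimg (c : 'I_p -> R) (k : 'I_p) : R := \sum_l c l * G k l.

(** Regrouped as [2 q <a, h> + (|h|^2 - tr(G) q) + D (q - n tau)], up to the factor [N^-1], it is a
    sum of three centred terms; [D] stays free until the linearisation fixes it. *)
Definition lstat (x : J -> R) : R :=
  N^-1 * (2 * (qY x * lin a x) + bil dlt x + (D - mxdot dlt G) * qY x - D * (n%:R * tau)).

(** The two lines collect the contributions of the [h]-terms and of [D (q - n tau)]. The first 6 is
    4 + 2, from [2 q <a, h>] and from [|h|^2]; the second is the Euler image of [2 q <a, h>], which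
    has degree 3 in the [y]-variables. *)
Definition lstein (x : J -> R) : R :=
  N^-1 ^+ 2 * (qY x * (4 * qf G a a * qY x ^+ 2 + 6 * (qY x * lin (vimg a) x) + 2 * bil G x)
    + D * tau * (2 * D * qY x + 6 * (qY x * lin a x) + 2 * (bil dlt x - mxdot dlt G * qY x))).

Lemma hder_lstat k : hder G tau k lstat
  (fun x => N^-1 * (2 * (qY x * vimg a k) + 2 * lin (G k) x)).
Proof.
have Hc c := hder_cst n G tau k c; have Hq := hder_qY n G tau k.
have Hl := hder_lin n G tau k a.
have Hb := @hder_bil _ n p G tau k dlt dltC.
apply: (hder_eq (hderM (Hc N^-1) (hderD (hderD (hderD (hderM (Hc 2) (hderM Hq Hl)) Hb)
   (hderM (Hc (D - mxdot dlt G)) Hq)) (Hc (- (D * (n%:R * tau))))))) => // x.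
rewrite mul0r add0r; congr (_ * _).
have -> : lin (fun m => \sum_l G k l * dlt l m) x = lin (G k) x.
  apply: eq_bigr => m _; congr (_ * _).
  by under eq_bigr do rewrite mulrC dltC; rewrite sum_dltl.
by rewrite /vimg; ring.
Qed.

Lemma eder_lin (c : 'I_p -> R) : eder G tau (lin (n := n) c) (lin c).
Proof.
apply: eder_sum => k.
by apply: (eder_eq (ederM (eder_cst n G tau (c k)) (eder_hW n G tau k))) => // x; ring.
Qed.

Lemma eder_bil (B : 'I_p -> 'I_p -> R) : eder G tau (bil (n := n) B) (fun x => 2 * bil B x).
Proof.
apply: eder_eq.
- apply: eder_sum => k; apply: eder_sum => l.
  exact: (ederM (eder_cst n G tau (B k l)) (ederM (eder_hW n G tau k) (eder_hW n G tau l))).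
- by [].
- move=> x; rewrite /bil big_distrr; apply: eq_bigr => k _ /=.
  by rewrite big_distrr; apply: eq_bigr => l _ /=; ring.
Qed.

Lemma eder_lstat : eder G tau lstat
  (fun x => N^-1 * (6 * (qY x * lin a x) + 2 * bil dlt x + 2 * (D - mxdot dlt G) * qY x)).
Proof.
have Hc c := eder_cst n G tau c; have Hq := eder_qY n G tau.
apply: (eder_eq (ederM (Hc N^-1) (ederD (ederD (ederD (ederM (Hc 2) (ederM Hq (eder_lin a)))
  (eder_bil dlt)) (ederM (Hc (D - mxdot dlt G)) Hq)) (Hc (- (D * (n%:R * tau))))))) => // x.
by rewrite mul0r add0r; congr (_ * _); ring.
Qed.

Lemma nice_lstat : nice lstat. Proof. exact: eder_nice eder_lstat. Qed.

Let nq := @nice_qY R n p.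
Let nl c := @nice_lin R n p c.
Let nb B := @nice_bil R n p B.
Let nZ (c : R) (g : (J -> R) -> R) : nice g -> nice (fun x : J -> R => c * g x).
Proof. by move=> ?; apply: niceM => //; exact: nice_cst. Qed.

Lemma nice_lstein : nice lstein.
Proof.
apply: nZ; apply: niceD.
  apply: niceM => //; apply: niceD; last exact: nZ.
  by apply: niceD; [apply/nZ/niceX|apply/nZ/niceM].
apply: nZ; apply: niceD; first by apply: niceD; [exact: nZ|apply/nZ/niceM].
apply: nZ; apply: niceD => //.
by under eq_fun do rewrite -mulNr; exact: nZ.
Qed.

(** The [h]-terms are integrated by parts with [gexp_qX_lin] and [gexp_qX_bil], the radial term with
    [gexp_qY]. All terms in which [phi] is not differentiated cancel, because every piece of the
    statistic is centred: tr(G) from [|h|^2] against [- tr(G) q], and [D n tau] against the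
    constant. *)
Lemma gexp_lstat (phi dphi : R -> R) (K : R) : continuous phi -> continuous dphi ->
  (forall y, `|phi y| <= K * (1 + `|y|)) -> (forall y, `|dphi y| <= K * (1 + `|y|)) ->
  (forall y : R, is_derive y (1 : R) phi (dphi y)) ->
  E (fun x => lstat x * phi (lstat x)) = E (fun x => dphi (lstat x) * lstein x).
Proof.
move=> cp cd pK dK Hp.
have Hh k := hder_comp cp cd pK dK Hp (hder_lstat k).
have He := eder_comp cp cd pK dK Hp eder_lstat.
have nphi : nice (fun x => phi (lstat x)) by exact: eder_nice He.
have ndphi : nice (fun x => dphi (lstat x)) by exact: nice_comp dK nice_lstat.
have E1 := gexp_qX_lin mV Gsym VC 1 a Hh.
have E2 := gexp_qX_bil mV Gsym VC 0 dlt Hh.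
have E3 := gexp_qY mV Gsym VC He.
have n1 : nice (fun x : J -> R => qY x ^+ 1 * (lin a x * phi (lstat x))).
  by apply: niceM; [exact: niceX|exact: niceM].
have n2 : nice (fun x : J -> R => qY x ^+ 0 * (bil dlt x * phi (lstat x))).
  by apply: niceM; [exact: niceX|exact: niceM].
have n3 : nice (fun x : J -> R => qY x * phi (lstat x)) by exact: niceM.
have n4 k : nice (fun x : J -> R => dphi (lstat x) * (N^-1 * (2 * (qY x * vimg a k) + 2 * lin (G k) x))).
  exact: hder_nice' (Hh k).
have n5 : nice (fun x : J -> R => dphi (lstat x) *
    (N^-1 * (6 * (qY x * lin a x) + 2 * bil dlt x + 2 * (D - mxdot dlt G) * qY x))).
  exact: eder_nice' He.
have n6 : nice (fun x : J -> R => qY x ^+ 2 * \sum_k a k * (dphi (lstat x) *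
    (N^-1 * (2 * (qY x * vimg a k) + 2 * lin (G k) x)))).
  by apply: niceM; [exact: niceX|apply: nice_sum => k; exact: nZ].
have n7 : nice (fun x : J -> R => qY x * \sum_k \sum_l dlt k l * (hW l x * (dphi (lstat x) *
    (N^-1 * (2 * (qY x * vimg a k) + 2 * lin (G k) x))))).
  apply: niceM => //; apply: nice_sum => k; apply: nice_sum => l; apply: nZ.
  by apply: niceM => //; exact: nice_hW.
have -> : E (fun x => lstat x * phi (lstat x)) =
    N^-1 * (2 * E (fun x => qY x ^+ 1 * (lin a x * phi (lstat x)))
     + E (fun x => qY x ^+ 0 * (bil dlt x * phi (lstat x)))
     + (D - mxdot dlt G) * E (fun x => qY x * phi (lstat x))
     + - (D * (n%:R * tau)) * E (fun x => phi (lstat x))).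
  rewrite -!(gexpZ mV VC)// -!(gexpD mV VC) -?(gexpZ mV VC)//.
  - by congr gexp; apply/funext => x; rewrite /lstat expr1 expr0; ring.
  - by apply: niceD; [apply: niceD; [apply: niceD|]|]; try exact: nZ.
  - by apply: niceD; [apply: niceD|]; try exact: nZ.
  - exact: nZ.
  - by apply: niceD; try exact: nZ.
  - exact: nZ.
  - exact: nZ.
rewrite E1 E2 E3.
have -> : E (fun x => qY x ^+ 1 * (mxdot dlt G * phi (lstat x) + \sum_k \sum_l dlt k l *
    (hW l x * (dphi (lstat x) * (N^-1 * (2 * (qY x * vimg a k) + 2 * lin (G k) x)))))) =
    mxdot dlt G * E (fun x => qY x * phi (lstat x)) +
    E (fun x => qY x * \sum_k \sum_l dlt k l *
    (hW l x * (dphi (lstat x) * (N^-1 * (2 * (qY x * vimg a k) + 2 * lin (G k) x))))).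
  rewrite -(gexpZ mV VC)// -(gexpD mV VC)//; last exact: nZ.
  by congr gexp; apply/funext => x; rewrite expr1; ring.
rewrite E3.
transitivity (N^-1 * (2 * E (fun x => qY x ^+ 2 * \sum_k a k * (dphi (lstat x) *
    (N^-1 * (2 * (qY x * vimg a k) + 2 * lin (G k) x))))
  + E (fun x => qY x * \sum_k \sum_l dlt k l * (hW l x * (dphi (lstat x) *
    (N^-1 * (2 * (qY x * vimg a k) + 2 * lin (G k) x)))))
  + D * tau * E (fun x => dphi (lstat x) *
    (N^-1 * (6 * (qY x * lin a x) + 2 * bil dlt x + 2 * (D - mxdot dlt G) * qY x))))).
  by ring.
rewrite -!(gexpZ mV VC)// -!(gexpD mV VC) -?(gexpZ mV VC)//; last 4 first.
- by apply: niceD; [apply: niceD|]; try exact: nZ.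
- by apply: niceD; try exact: nZ.
- exact: nZ.
- exact: nZ.
congr gexp; apply/funext => x.
have S1 : \sum_k a k * (dphi (lstat x) * (N^-1 * (2 * (qY x * vimg a k) + 2 * lin (G k) x))) =
    dphi (lstat x) * N^-1 * (2 * qY x * qf G a a + 2 * lin (vimg a) x).
  have -> : qf G a a = \sum_k a k * vimg a k.
    by apply: eq_bigr => k _; rewrite big_distrr; apply: eq_bigr => l _ /=; ring.
  have -> : lin (vimg a) x = \sum_k a k * lin (G k) x.
    rewrite [RHS](eq_bigr (fun k => \sum_l a k * (G k l * hW l x))); last first.
      by move=> k _; rewrite /lin big_distrr.
    rewrite exchange_big; apply: eq_bigr => l _ /=; rewrite /vimg mulr_suml.
    by apply: eq_bigr => k _; rewrite Gsym; ring.
  rewrite !mulrDr -!mulrA !mulr_sumr -big_split; apply: eq_bigr => k _ /=; ring.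
have S2 : \sum_k \sum_l dlt k l * (hW l x * (dphi (lstat x) *
    (N^-1 * (2 * (qY x * vimg a k) + 2 * lin (G k) x)))) =
    dphi (lstat x) * N^-1 * (2 * qY x * lin (vimg a) x + 2 * bil G x).
  have -> : bil G x = \sum_k hW k x * lin (G k) x.
    by apply: eq_bigr => k _; rewrite /lin mulr_sumr; apply: eq_bigr => l _ /=; ring.
  rewrite /lin -/(lin _ x) !mulrDr -!mulrA !mulr_sumr -big_split; apply: eq_bigr => k _ /=.
  by rewrite sum_dltl; ring.
rewrite S1 S2 /lstein; ring.
Qed.

End stein_identity.

(** * Second moment of the Stein kernel *)

Section stein_variance.
Context (R : realType) d (T : measurableType d) (P : probability T R) (n p : nat).
Local Notation J := ('I_n + 'I_n * 'I_p)%type.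
Variables (V : J -> T -> R) (G : 'I_p -> 'I_p -> R) (tau : R).
Hypotheses (mV : forall j, measurable_fun setT (V j)) (Gsym : forall k l, G k l = G l k).
Hypothesis VC : gfam P V (split_cov G tau).
Local Notation E := (gexp P V).
Local Notation q := (@qY R n p).
Variables (a : 'I_p -> R) (D N s : R).
Hypotheses (n0 : (0 < n)%N) (N3 : N ^+ 2 = n%:R ^+ 3).

(** The moment of order [j] of [q / n], as the product of the factors [tau (1 + 2 i / n)]; it tends
    to [tau^j], so variances of powers of [q / n] vanish in the limit. *)
Fixpoint qmom (n : nat) (tau : R) (j : nat) : R :=
  if j is i.+1 then tau * (1 + 2 * i%:R / n%:R) * qmom n tau i else 1.

Let nR : n%:R != 0 :> R. Proof. by rewrite pnatr_eq0 -lt0n. Qed.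

Lemma gexp_qmom j : E (fun x => q x ^+ j) = n%:R ^+ j * qmom n tau j.
Proof.
elim: j => [|j IH]; first by rewrite /= mulr1 expr0 -[RHS](gexp_cst P V 1).
by rewrite (gexp_qXS mV Gsym VC) IH /= exprS; field.
Qed.

(** The summands are, in order, the second moments of the eight pieces into which the kernel minus
    [s] is cut: fluctuation of [q^3], [<Ga, h>], centred [h'Gh], fluctuation of [q^2], fluctuation
    of [q], [<a, h>], centred [|h|^2], and the deterministic bias. *)
Definition stein_var : R :=
  let m := qmom n tau in let v := n%:R in
  let al := qf G a a in let g2 := mxdot G G in
  8 * (16 * al ^+ 2 * (m 6%N - 2 * tau ^+ 3 * m 3%N + tau ^+ 6)
    + 36 * qf G (vimg G a) (vimg G a) * m 5%N / v
    + 8 * mxdot (mx3 G G G) G * m 4%N / v ^+ 2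
    + 4 * (g2 / v) ^+ 2 * (m 4%N - 2 * tau ^+ 2 * m 2%N + tau ^+ 4)
    + 4 * (D / v) ^+ 4 * tau ^+ 2 * (m 2%N - 2 * tau * m 1%N + tau ^+ 2)
    + 36 * (D / v) ^+ 2 * tau ^+ 2 * m 3%N * al / v
    + 8 * (D / v) ^+ 2 * tau ^+ 2 * m 2%N * g2 / v ^+ 2
    + (4 * al * tau ^+ 3 + 2 * (g2 / v) * tau ^+ 2 + 2 * (D / v) ^+ 2 * tau ^+ 2 - s) ^+ 2).

Let nX j : nice (fun x => q x ^+ j). Proof. exact: nice_qX. Qed.
Let nl (c : 'I_p -> R) : nice (fun x : J -> R => lin c x). Proof. exact: nice_lin. Qed.
Let nb (B : 'I_p -> 'I_p -> R) : nice (fun x : J -> R => bil B x). Proof. exact: nice_bil. Qed.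
Let nZ (c : R) (g : (J -> R) -> R) : nice g -> nice (fun x : J -> R => c * g x).
Proof. by move=> ?; apply: niceM => //; exact: nice_cst. Qed.

Let nsq g j : nice g -> nice (fun x => q x ^+ j * g x ^+ 2).
Proof. by move=> ng; apply: niceM => //; exact: niceX. Qed.

Let nbq B (c : R) : nice (fun x : J -> R => bil B x - c * q x).
Proof.
under eq_fun do rewrite -mulNr; apply: niceD => //; apply: nZ; exact: nice_qY.
Qed.

Lemma gexp_qvar j (c : R) : E (fun x => (q x ^+ j - c) ^+ 2) =
  n%:R ^+ (2 * j) * qmom n tau (2 * j) - 2 * c * n%:R ^+ j * qmom n tau j + c ^+ 2.
Proof.
transitivity (E (fun x => q x ^+ (2 * j) + ((- 2 * c) * q x ^+ j + c ^+ 2))).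
  by congr gexp; apply/funext => x; rewrite mul2n -addnn exprD; ring.
rewrite !(gexpD mV VC) ?(gexpZ mV VC) ?gexp_cst ?gexp_qmom//; first by ring.
all: by do ?[exact: nice_cst | exact: nX | apply: niceD | apply: nZ].
Qed.

Lemma sqr_sum8 (x1 x2 x3 x4 x5 x6 x7 x8 : R) :
  (x1 + x2 + x3 + x4 + x5 + x6 + x7 + x8) ^+ 2 <=
  8 * (x1 ^+ 2 + x2 ^+ 2 + x3 ^+ 2 + x4 ^+ 2 + x5 ^+ 2 + x6 ^+ 2 + x7 ^+ 2 + x8 ^+ 2).
Proof.
have H (x y m : R) : 0 <= m -> (x + y) ^+ 2 * m <= (m + 1) * x ^+ 2 + m * (m + 1) * y ^+ 2.
  by move=> m0; have := sqr_ge0 (x - m * y); nra.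
suff S2 (x y : R) : (x + y) ^+ 2 <= 2 * x ^+ 2 + 2 * y ^+ 2.
  have := S2 (x1 + x2 + x3 + x4) (x5 + x6 + x7 + x8).
  have := S2 (x1 + x2) (x3 + x4); have := S2 (x5 + x6) (x7 + x8).
  have := S2 x1 x2; have := S2 x3 x4; have := S2 x5 x6; have := S2 x7 x8.
  by rewrite !addrA; lra.
by have := sqr_ge0 (x - y); lra.
Qed.

(** Each random quantity is replaced by its deviation from its natural centre, [h'Bh] from
    [tr(BG) q] and [q^j] from [(n tau)^j], and the centres are collected in the bias [c8].
    Covariances between pieces are not computed: the inequality with factor 8 disposes of them. *)
Lemma gexp_lstein_var : E (fun x => (lstein G tau a N D x - s) ^+ 2) <= stein_var.
Proof.
pose v : R := n%:R; pose al := qf G a a; pose g2 := mxdot G G.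
pose c8 := 4 * al * tau ^+ 3 + 2 * (g2 / v) * tau ^+ 2 + 2 * (D / v) ^+ 2 * tau ^+ 2 - s.
have vN : N^-1 ^+ 2 = v ^- 3 by rewrite exprVn N3.
have nq j (c : R) : nice (fun x => (q x ^+ j - c) ^+ 2).
  by apply: niceX; apply: niceD => //; exact: nice_cst.
pose bound (x : J -> R) : R := 8 * (
   (4 * al / v ^+ 3) ^+ 2 * (q x ^+ 3 - v ^+ 3 * tau ^+ 3) ^+ 2
 + (6 / v ^+ 3) ^+ 2 * (q x ^+ 4 * lin (vimg G a) x ^+ 2)
 + (2 / v ^+ 3) ^+ 2 * (q x ^+ 2 * (bil G x - g2 * q x) ^+ 2)
 + (2 * g2 / v ^+ 3) ^+ 2 * (q x ^+ 2 - v ^+ 2 * tau ^+ 2) ^+ 2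
 + (2 * D ^+ 2 * tau / v ^+ 3) ^+ 2 * (q x ^+ 1 - v * tau) ^+ 2
 + (6 * D * tau / v ^+ 3) ^+ 2 * (q x ^+ 2 * lin a x ^+ 2)
 + (2 * D * tau / v ^+ 3) ^+ 2 * (q x ^+ 0 * (bil (@dlt R p) x - mxdot (@dlt R p) G * q x) ^+ 2)
 + c8 ^+ 2).
have n1 (c c' : R) j : nice (fun x => c * (q x ^+ j - c') ^+ 2) by exact: nZ.
have n2 (c : R) j b : nice (fun x => c * (q x ^+ j * lin b x ^+ 2)) by apply: nZ; exact: nsq.
have n3 (c c' : R) j B : nice (fun x => c * (q x ^+ j * (bil B x - c' * q x) ^+ 2)).
  by apply: nZ; exact: (nsq _ (nbq _ _)).
have nc (c : R) : nice (fun _ : J -> R => c) by exact: nice_cst.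
have nbd : nice bound by apply: nZ; repeat apply: niceD => //.
have ns : nice (fun x : J -> R => (lstein G tau a N D x - s) ^+ 2).
  by apply: niceX; apply: niceD => //; exact: nice_lstein.
apply: (le_trans (ler_gexp mV VC ns nbd _)) => [x|].
  have q4 : q x ^+ 4 = (q x ^+ 2) ^+ 2 by rewrite -exprM.
  rewrite /bound expr0 mul1r q4 -!exprMn.
  apply: le_trans (sqr_sum8 _ _ _ _ _ _ _ _); rewrite le_eqVlt; apply/orP; left; apply/eqP.
  congr (_ ^+ 2); rewrite /lstein vN /c8 -/g2 -/al; field.
  exact: nR.
rewrite /bound (gexpZ mV VC); last by repeat apply: niceD => //.
do 7 (rewrite (gexpD mV VC); [|by do ?apply: niceD|by []]).
pose eZ (c : R) g (ng : nice g) := gexpZ mV VC c ng.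
rewrite gexp_cst (eZ ((4 * al / v ^+ 3) ^+ 2)) ?(eZ ((6 / v ^+ 3) ^+ 2)) ?(eZ ((2 / v ^+ 3) ^+ 2)) ?(eZ ((2 * g2 / v ^+ 3) ^+ 2)) ?(eZ ((2 * D ^+ 2 * tau / v ^+ 3) ^+ 2)) ?(eZ ((6 * D * tau / v ^+ 3) ^+ 2)) ?(eZ ((2 * D * tau / v ^+ 3) ^+ 2))//; try by [exact: nsq|exact: (nsq _ (nbq _ _))].
rewrite !gexp_qvar !(gexp_lin2 mV Gsym VC) (gexp_bil2 mV Gsym VC 2 Gsym)
  (gexp_bil2 mV Gsym VC 0 (@dltC R p)).
rewrite !gexp_qmom /stein_var.
have -> : mxdot (mx3 (@dlt R p) G (@dlt R p)) G = g2.
  apply: eq_bigr => k _; apply: eq_bigr => l _; congr (_ * _); rewrite /mx3.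
  under eq_bigr do (under eq_bigr do rewrite -mulrA; rewrite -mulr_sumr).
  by rewrite sum_dltl; under eq_bigr do rewrite mulrC dltC; rewrite sum_dltl.
rewrite le_eqVlt; apply/orP; left; apply/eqP.
rewrite -/v -/al -/g2 /c8 -/v; congr (_ * _); field.
exact: nR.
Qed.

End stein_variance.

(** * Stein's equation *)

Lemma is_derive_le (R : realType) (u du : R -> R) (x y : R) : x <= y ->
  (forall z, x <= z <= y -> is_derive z (1 : R) u (du z)) ->
  (forall z, x <= z <= y -> du z <= 0) -> u y <= u x.
Proof.
move=> xy Hu du0.
have [| |z zxy] := @MVT_segment _ u du x y xy.
- by move=> z /subset_itv_oo_cc; rewrite in_itv /=; exact: Hu.
- apply: derivable_within_continuous => z; rewrite in_itv /= => /Hu H; exact: ex_derive.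
- move=> E; rewrite -subr_le0 E; apply: mulr_le0_ge0; last by rewrite subr_ge0.
  by apply: du0; rewrite in_itv /= in zxy.
Qed.

Lemma is_derive_continuous (R : realType) (f df : R -> R) :
  (forall x : R, is_derive x (1 : R) f (df x)) -> continuous f.
Proof.
move=> H x; apply/differentiable_continuous/derivable1_diffP; exact: ex_derive.
Qed.

Section stein_equation.
Context (R : realType).
Local Notation mu := (@lebesgue_measure R).
Variables (s : R) (h : R -> R).
Hypotheses (s0 : 0 < s) (ch : continuous h) (h01 : forall x, 0 <= h x <= 1).

Local Notation N := (normal_prob 0 s).
Local Notation phi := (normal_pdf 0 s).
Let k (x : R) := h x - \int[N]_y h y.
Let I (x : R) := \int[mu]_(t in `]-oo, x]) (k t * phi t).

Let mh : measurable_fun setT h. Proof. exact: continuous_measurable_fun. Qed.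

Let iN (f : R -> R) (C : R) : measurable_fun setT f -> (forall x, `|f x| <= C) ->
  N.-integrable setT (EFin \o f).
Proof.
by move=> mf fC; apply: (@integrable_normal _ s 0 f C) => // x; rewrite expr0 mulr1.
Qed.

Let mean01 : 0 <= \int[N]_y h y <= 1.
Proof.
have ih : N.-integrable setT (EFin \o h).
  by apply: (@iN _ 1) => // x; have /andP[? ?] := h01 x; rewrite ger0_norm.
apply/andP; split; first by apply: Rintegral_ge0 => x _; case/andP: (h01 x).
rewrite -[leRHS](Rintegral_prob_cst N 1); apply: le_Rintegral => //.
  by apply: (@iN (fun=> 1) 1) => // x; rewrite normr1.
by move=> x _; case/andP: (h01 x).
Qed.

Let k1 x : `|k x| <= 1.
Proof.
rewrite ler_norml; have := h01 x; have := mean01; rewrite /k; move: (\int[N]_y h y) => c.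
by move=> /andP[? ?] /andP[? ?]; apply/andP; split; lra.
Qed.

Let ck : continuous k.
Proof. by move=> x; apply: cvgB; [exact: ch|exact: cvg_cst]. Qed.

Let mk : measurable_fun setT k. Proof. exact: continuous_measurable_fun. Qed.

Let cphi : continuous phi.
Proof. exact: is_derive_continuous (fun x => is_derive_normal_pdf x s0). Qed.

Let ikphi : mu.-integrable setT (EFin \o (fun t => k t * phi t)).
Proof.
apply: (@integrable_poly_normal_pdf _ s 0 k 1) => // x.
by rewrite expr0 mulr1.
Qed.

Let dI x : is_derive x (1 : R) I (k x * phi x).
Proof.
have [] := @continuous_FTC1 _ (fun t => k t * phi t) -oo%O x (x + 1).
- by rewrite ltrDl.
- exact: integrableS ikphi.
- exact: ltNyr.
- by apply: cvgM; [exact: ck|exact: cphi].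
- by move=> dv <-; rewrite derive1E; apply: DeriveDef.
Qed.

Let IE x : I x = \int[N]_t (k t * \1_`]-oo, x] t).
Proof.
rewrite (@Rintegral_normal _ s 0 _ 1)//.
- rewrite /I Rintegral_mkcond; apply: eq_Rintegral => t _.
  by rewrite patchE indicE; case: ifPn => _; rewrite ?mulr1// mulr0 mul0r.
- by apply: measurable_funM => //; exact: measurable_indic.
- move=> t; rewrite expr0 mulr1 normrM -[1]mulr1 ler_pM//.
  by rewrite indicE; case: (_ \in _); rewrite ?normr1 ?normr0.
Qed.

(** The integral converges to [l E[k]], with [l = 1] at plus infinity and [l = 0] at minus infinity.
    The limit is 0 in both cases because [k] is centred. *)
Let cvgI (z : nat -> R) (l : R) : (forall t : R, \1_`]-oo, z n] t @[n --> \oo] --> l) ->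
  I (z n) @[n --> \oo] --> 0.
Proof.
move=> H.
rewrite (_ : (fun n => I (z n)) = fun n => \int[N]_t (k t * \1_`]-oo, z n] t)); last first.
  by apply/funext => n; exact: IE.
have E0 : \int[N]_t (k t * l) = 0.
  under eq_Rintegral do rewrite mulrC.
  rewrite RintegralZl//; last exact: (@iN k 1 mk k1).
  rewrite /k RintegralB//.
  - by rewrite Rintegral_prob_cst subrr mulr0.
  - by apply: (@iN h 1) => // x; have /andP[? ?] := h01 x; rewrite ger0_norm.
  - exact: (@iN (fun=> \int[N]_y h y) `|\int[N]_y h y|).
rewrite -[X in _ --> X]E0; apply: (@bounded_Rintegral_cvg _ _ _ N _ _ 1).
- by move=> n; apply: measurable_funM => //; exact: measurable_indic.
- by move=> t; apply: cvgM; [exact: cvg_cst|exact: H].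
- move=> n t; rewrite normrM -[1]mulr1 ler_pM//.
  by rewrite indicE; case: (_ \in _); rewrite ?normr1 ?normr0.
Qed.

Let cvgIy : I n%:R @[n --> \oo] --> 0.
Proof.
apply: (@cvgI (fun n => n%:R) 1) => t; apply: cvg_near_cst.
near=> n; rewrite indicE mem_set//= in_itv /=; near: n; exact: nbhs_infty_ger.
Unshelve. all: end_near. Qed.

Let cvgINy : I (- n%:R) @[n --> \oo] --> 0.
Proof.
apply: (@cvgI (fun n => - n%:R) 0) => t; apply: cvg_near_cst.
near=> n; rewrite indicE memNset//= in_itv /=; apply/negP; rewrite -ltNge ltrNl.
near: n; exact: nbhs_infty_gtr.
Unshelve. all: end_near. Qed.

Let phi_gt0 x : 0 < phi x.
Proof. by rewrite normal_pdfE ?gt_eqF// mulr_gt0 ?expR_gt0// normal_peak_gt0// gt_eqF. Qed.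

Let phi_peak x : phi x <= normal_peak s.
Proof. by apply: normal_pdf_ub; rewrite gt_eqF. Qed.

Let cvg_mills (e : R) : s ^+ 2 * phi (e * n%:R) / n%:R @[n --> \oo] --> (0 : R).
Proof.
apply/norm_cvg0P; apply: (@squeeze_cvgr _ _ _ _ (fun=> 0) (fun n => `|s ^+ 2| * normal_peak s * n%:R^-1)).
- apply: nearW => n; rewrite normr_ge0 /= !normrM (ger0_norm (ltW (phi_gt0 _))) normfV normr_nat.
  by rewrite ler_wpM2r ?invr_ge0// ler_wpM2l.
- exact: cvg_cst.
- rewrite -[X in _ --> X](mulr0 (`|s ^+ 2| * normal_peak s)).
  apply: cvgM; first exact: cvg_cst.
  by apply/gtr0_cvgV0; [near=> n; rewrite ltr0n; near: n; exists 1%N|exact: cvgr_idn].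
Unshelve. all: end_near. Qed.

(* Mills-type comparison: (s^2 phi / x)' = - phi (1 + s^2 / x^2), which dominates
   |(I)'| <= phi, and both sides vanish at infinity. *)
Let mills x : x != 0 -> `|I x| <= s ^+ 2 * phi x / `|x|.
Proof.
move=> x0.
have dM (z : R) : z != 0 -> is_derive z (1 : R) (fun z => s ^+ 2 * phi z / z)
    (- phi z - s ^+ 2 * phi z / z ^+ 2).
  move=> z0; have D1 := is_derive_normal_pdf z s0.
  have D2 := is_deriveV z0 (is_derive_id z (1 : R)).
  apply: (is_derive_eq (is_deriveM (is_deriveZ (s ^+ 2) D1) D2)).
  rewrite /GRing.scale /= /GRing.scale /=; move: (phi z) => u.
  by field; rewrite z0 gt_eqF.
(* The sign [e] treats both bounds of the absolute value at once. On either half-line the expression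
   is monotone towards 0 at infinity, hence nonnegative. *)
suff H (e : R) : `|e| = 1 -> 0 <= s ^+ 2 * phi x / `|x| + e * I x.
  rewrite ler_norml; have := H 1 (normr1 _); have := H (- 1) (normrN1 _).
  by rewrite mulN1r mul1r => ? ?; apply/andP; split; lra.
move=> e1.
have ek z : - phi z <= e * (k z * phi z) <= phi z.
  by rewrite -ler_norml !normrM e1 mul1r (ger0_norm (ltW (phi_gt0 z))) ler_piMl// ltW.
have [xp|xn] := ltrP 0 x.
- rewrite gtr0_norm//.
  have L : (s ^+ 2 * phi n%:R / n%:R + e * I n%:R) @[n --> \oo] --> (0 : R).
    rewrite -[X in _ --> X]addr0; apply: cvgD.
      rewrite (_ : (fun n => _) = fun n => s ^+ 2 * phi (1 * n%:R) / n%:R); first exact: cvg_mills.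
      by apply/funext => n; rewrite mul1r.
    rewrite -[X in _ --> X](mulr0 e); apply: cvgM; [exact: cvg_cst|exact: cvgIy].
  rewrite -[leLHS](cvg_lim (@Rhausdorff R) L); apply: limr_le; first by apply/cvg_ex; exists 0.
  near=> n.
  apply: (@is_derive_le _ (fun z => s ^+ 2 * phi z / z + e * I z)
    (fun z => - phi z - s ^+ 2 * phi z / z ^+ 2 + e * (k z * phi z))).
  + by near: n; exact: nbhs_infty_ger.
  + move=> z /andP[xz _]; apply: is_deriveD; last exact: is_deriveZ.
    by apply: dM; rewrite gt_eqF// (lt_le_trans xp).
  + move=> z _; have /andP[_ ?] := ek z.
    have ? : 0 <= s ^+ 2 * phi z / z ^+ 2 by rewrite divr_ge0 ?sqr_ge0// mulr_ge0 ?sqr_ge0// ltW.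
    lra.
- have {}xn : x < 0 by rewrite lt_neqAle x0.
  rewrite ltr0_norm// invrN mulrN.
  have L : (- (s ^+ 2 * phi (- n%:R) / (- n%:R)) + e * I (- n%:R)) @[n --> \oo] --> (0 : R).
    rewrite -[X in _ --> X]addr0; apply: cvgD.
      rewrite (_ : (fun n => _) = fun n => s ^+ 2 * phi (- 1 * n%:R) / n%:R); first exact: cvg_mills.
      by apply/funext => n; rewrite mulN1r invrN mulrN opprK.
    rewrite -[X in _ --> X](mulr0 e); apply: cvgM; [exact: cvg_cst|exact: cvgINy].
  rewrite -[leLHS](cvg_lim (@Rhausdorff R) L); apply: limr_le; first by apply/cvg_ex; exists 0.
  near=> n; rewrite -lerN2.
  apply: (@is_derive_le _ (fun z => - (- (s ^+ 2 * phi z / z) + e * I z))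
    (fun z => - (- (- phi z - s ^+ 2 * phi z / z ^+ 2) + e * (k z * phi z)))).
  + by rewrite lerNl; near: n; exact: nbhs_infty_ger.
  + move=> z /andP[_ zx]; apply: is_deriveN; apply: is_deriveD; last exact: is_deriveZ.
    by apply: is_deriveN; apply: dM; rewrite lt_eqF// (le_lt_trans zx).
  + move=> z _; have /andP[? _] := ek z.
    have ? : 0 <= s ^+ 2 * phi z / z ^+ 2 by rewrite divr_ge0 ?sqr_ge0// mulr_ge0 ?sqr_ge0// ltW.
    lra.
Unshelve. all: end_near. Qed.

(** The solution is [f = s^-2 I / phi]. The Mills bound gives [|y f y| <= 1]; the equation itself
    then bounds [df] by [2 / s^2], and the mean value theorem yields the linear growth of [f]. *)
Lemma stein_solution : exists f df : R -> R, exists K : R,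
  [/\ continuous f, continuous df, forall y, `|f y| <= K * (1 + `|y|) /\ `|df y| <= K,
      forall y : R, is_derive y (1 : R) f (df y)
    & forall y, s ^+ 2 * df y - y * f y = h y - \int[N]_x h x].
Proof.
pose f y := s ^- 2 * (I y / phi y).
pose df y := s ^- 2 * (k y + y * f y).
have s2 : s ^+ 2 != 0 by rewrite expf_neq0// gt_eqF.
have Df (y : R) : is_derive y (1 : R) f (df y).
  have p0 : phi y != 0 by rewrite gt_eqF.
  have D2 := is_deriveV p0 (is_derive_normal_pdf y s0).
  apply: (is_derive_eq (is_deriveZ (s ^- 2) (is_deriveM (dI y) D2))).
  rewrite /GRing.scale /= /df /f; field; rewrite p0 gt_eqF//.
have cf := is_derive_continuous Df.
have yf y : `|y * f y| <= 1.
  have [->|y0] := eqVneq y 0; first by rewrite mul0r normr0.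
  have := mills y0; rewrite ler_pdivlMr ?normr_gt0// => H.
  rewrite /f !normrM !normfV (ger0_norm (ltW (phi_gt0 y))) (ger0_norm (sqr_ge0 s)).
  rewrite (_ : _ * _ = `|I y| * `|y| / (s ^+ 2 * phi y)); last first.
    by field; rewrite !gt_eqF.
  by rewrite ler_pdivrMr ?mul1r// mulr_gt0// exprn_gt0.
have dfK y : `|df y| <= 2 / s ^+ 2.
  rewrite normrM normfV (ger0_norm (sqr_ge0 s)) mulrC ler_pM2r ?invr_gt0 ?exprn_gt0//.
  by rewrite (le_trans (ler_normD _ _))// (_ : 2 = 1 + 1)// lerD.
have K0 : 0 <= 2 / s ^+ 2 by rewrite divr_ge0// sqr_ge0.
exists f, df, (`|f 0| + 2 / s ^+ 2); split => //.
- move=> y; apply: cvgM; first exact: cvg_cst.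
  by apply: cvgD; [exact: ck|apply: cvgM; [exact: cvg_id|exact: cf]].
- move=> y; split; last by rewrite (le_trans (dfK y))// lerDr.
  have H a b : a <= b -> `|f b - f a| <= 2 / s ^+ 2 * `|b - a|.
    move=> ab; have [|z zab] := @MVT_segment _ f df a b ab (fun z _ => Df z).
    + by apply: continuous_subspaceT.
    + by move=> ->; rewrite normrM ler_wpM2r.
  have Hy : `|f y - f 0| <= 2 / s ^+ 2 * `|y|.
    have [y0|/ltW y0] := lerP 0 y; first by have := H _ _ y0; rewrite subr0.
    by have := H _ _ y0; rewrite sub0r normrN distrC.
  rewrite -[f y](subrK (f 0)) (le_trans (ler_normD _ _))//.
  by have := normr_ge0 y; have := normr_ge0 (f 0); nra.
- by move=> y; rewrite /df mulrA mulfV// mul1r addrK.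
Qed.

End stein_equation.

(** * The finite-sample bound *)

Lemma step_lip (R : realType) (b : R) m u v :
  `|step b m u - step b m v| <= m%:R * `|u - v|.
Proof.
wlog uv : u v / u <= v => [H|].
  have [|] := orP (le_total u v); first exact: H.
  by move=> /H; rewrite distrC [`|v - u|]distrC.
have m0 : 0 <= m%:R :> R by [].
rewrite [`|u - v|]distrC [`|v - u|]ger0_norm ?subr_ge0//.
have uv' : m%:R * (b - v) <= m%:R * (b - u) by rewrite ler_wpM2l// lerD2l lerN2.
rewrite (_ : m%:R * (v - u) = m%:R * (b - u) - m%:R * (b - v)); last by ring.
rewrite /step /=; move: (m%:R * (b - u)) (m%:R * (b - v)) uv' => x y yx.
suff H : 0 <= Num.min 1 (Num.max 0 x) - Num.min 1 (Num.max 0 y) <= x - y.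
  by case/andP: H => h0 h1; rewrite ger0_norm.
have m10 : Num.min 1 0 = 0 :> R by apply/min_idPr.
by case: (leP 0 x); case: (leP 0 y); rewrite ?m10; case: (leP 1 x); case: (leP 1 y) => *;
  apply/andP; split; lra.
Qed.

Section finite_sample.
Context (R : realType) d (T : measurableType d) (P : probability T R) (n p : nat).
Local Notation J := ('I_n + 'I_n * 'I_p)%type.
Variables (V : J -> T -> R) (G : 'I_p -> 'I_p -> R) (tau : R).
Hypotheses (mV : forall j, measurable_fun setT (V j)) (Gsym : forall k l, G k l = G l k).
Hypothesis VC : gfam P V (split_cov G tau).
Local Notation E := (gexp P V).
Local Notation q := (@qY R n p).
Variables (a : 'I_p -> R) (N : R).
Hypotheses (n0 : (0 < n)%N) (N0 : 0 < N) (N3 : N ^+ 2 = n%:R ^+ 3).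

Let A := \sum_k a k ^+ 2.
Let g1 := mxdot (@dlt R p) G.
(** The derivative of [A q^2 + g1 q] at [q = n tau]. *)
Definition lstat_slope : R := 2 * A * n%:R * tau + g1.
Local Notation D := lstat_slope.

Definition fstat (x : J -> R) : R :=
  N^-1 * (\sum_k (hW k x + a k * q x) ^+ 2 - n%:R ^+ 2 * (A * tau ^+ 2) - n%:R * tau * (g1 + A * tau)).

(** The square is the Taylor remainder of [A q^2] at [n tau]. The constant appears because the
    centring of the statistic differs from its exact mean by [n A tau^2]. *)
Lemma fstat_lstat x :
  fstat x - lstat G tau a N D x = N^-1 * (A * (q x - n%:R * tau) ^+ 2 - n%:R * A * tau ^+ 2).
Proof.
rewrite /fstat /lstat -mulrBr; congr (_ * _).
have -> : \sum_k (hW k x + a k * q x) ^+ 2 =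
    bil (@dlt R p) x + 2 * (q x * lin a x) + A * q x ^+ 2.
  rewrite /bil /lin /A mulr_suml mulrA mulr_sumr -!big_split; apply: eq_bigr => k _ /=.
  by rewrite sum_dltl; ring.
by rewrite -/g1 /lstat_slope -/g1; ring.
Qed.

Let nc (c : R) : nice (fun _ : J -> R => c). Proof. exact: nice_cst. Qed.

Let nZ (c : R) (g : (J -> R) -> R) : nice g -> nice (fun x : J -> R => c * g x).
Proof. by move=> ?; apply: niceM. Qed.

Let nB (g f : (J -> R) -> R) : nice g -> nice f -> nice (fun x : J -> R => g x - f x).
Proof.
move=> ng nf; rewrite (_ : (fun _ => _) = fun x => g x + (-1) * f x).
  by apply: niceD => //; exact: nZ.
by apply/funext => x; rewrite mulN1r.
Qed.

Let nl : nice (@lstat R n p G tau a N D). Proof. exact: nice_lstat. Qed.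

Let nf : nice fstat.
Proof.
apply: nZ; apply: nB => //; apply: nB => //; apply: nice_sum => k.
apply: niceX; apply: niceD; [exact: nice_hW|apply: nZ; exact: nice_qY].
Qed.

Let nstep b m g : nice g -> nice (fun x : J -> R => step b m (g x)).
Proof.
apply: (@nice_comp _ _ _ 1); first exact: continuous_step.
move=> y; have /andP[? ?] := step01 b m y; rewrite ger0_norm// mul1r.
by have := normr_ge0 y; lra.
Qed.

Lemma gexp_norm_le g f : nice g -> nice f -> (forall x, `|g x| <= f x) -> `|E g| <= E f.
Proof.
move=> ng nf' gf; rewrite ler_norml; apply/andP; split.
  rewrite -mulN1r -(gexpZ mV VC)//; apply: (ler_gexp mV VC) => //; first exact: nZ.
  by move=> x; rewrite mulN1r; have := gf x; rewrite ler_norml => /andP[].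
by apply: (ler_gexp mV VC) => // x; have := gf x; rewrite ler_norml => /andP[].
Qed.

Lemma gexpB g f : nice g -> nice f -> E (fun x => g x - f x) = E g - E f.
Proof.
move=> ng nf'; rewrite -mulN1r -(gexpZ mV VC)// -(gexpD mV VC)//; last exact: nZ.
by congr gexp; apply/funext => x; rewrite mulN1r.
Qed.

(** The ramp is [m]-Lipschitz and the variance of [q] is [2 n tau^2]; with the constant [n A tau^2]
    of the remainder this gives the factor 3 = 2 + 1. *)
Lemma gexp_step_fstat b m :
  `|E (fun x => step b m (fstat x)) - E (fun x => step b m (lstat G tau a N D x))|
  <= m%:R * (3 * n%:R * (A * tau ^+ 2) / N).
Proof.
have nA : 0 <= A by apply: sumr_ge0 => k _; exact: sqr_ge0.
have nR : n%:R != 0 :> R by rewrite pnatr_eq0 -lt0n.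
have nq : nice (fun x : J -> R => (q x ^+ 1 - n%:R * tau) ^+ 2).
  by apply: niceX; apply: nB => //; exact: nice_qX.
rewrite -gexpB; [|exact: nstep|exact: nstep].
have -> : m%:R * (3 * n%:R * (A * tau ^+ 2) / N) =
    E (fun x => (m%:R * (N^-1 * A)) * (q x ^+ 1 - n%:R * tau) ^+ 2
               + m%:R * (N^-1 * (n%:R * A * tau ^+ 2))).
  rewrite (gexpD mV VC)//; last exact: nZ.
  rewrite (gexpZ mV VC)// (gexp_qvar mV Gsym VC n0) gexp_cst /=.
  by field; rewrite nR gt_eqF.
apply: gexp_norm_le.
- by apply: nB; exact: nstep.
- by apply: niceD => //; exact: nZ.
move=> x; apply: (le_trans (step_lip _ _ _ _)).
rewrite fstat_lstat normrM (gtr0_norm (_ : 0 < N^-1)) ?invr_gt0// expr1.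
rewrite [leRHS](_ : _ = m%:R * (N^-1 * (A * (q x - n%:R * tau) ^+ 2 + n%:R * A * tau ^+ 2))); last by ring.
have Ni0 : 0 <= N^-1 by rewrite invr_ge0 ltW.
rewrite ler_wpM2l// ler_wpM2l// (le_trans (ler_normD _ _))// normrN.
rewrite (ger0_norm (mulr_ge0 nA (sqr_ge0 _))).
by rewrite (ger0_norm (mulr_ge0 (mulr_ge0 (ler0n _ _) nA) (sqr_ge0 _))).
Qed.

(** Stein's equation and the Stein identity turn the left side into [E[df (v - T)]], where
    [|df| <= K]. The inequality [t <= e + t^2 / e] passes to the second moment of [T - v] without a
    square root. *)
Lemma gexp_step_lstat b m (v c K e : R) (f df : R -> R) : 0 < e ->
  continuous f -> continuous df -> (forall y, `|f y| <= K * (1 + `|y|) /\ `|df y| <= K) ->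
  (forall y : R, is_derive y (1 : R) f (df y)) ->
  (forall y, v * df y - y * f y = step b m y - c) ->
  `|E (fun x => step b m (lstat G tau a N D x)) - c| <=
  K * (e + stein_var n G tau a D v / e).
Proof.
move=> e0 cf cdf fK Df fE.
have K0 : 0 <= K by have [_] := fK 0; exact: le_trans.
have fK1 y := (fK y).1.
have dfK1 y : `|df y| <= K * (1 + `|y|).
  by apply: (le_trans (fK y).2); rewrite ler_peMr// lerDl.
have nfl : nice (fun x : J -> R => f (lstat G tau a N D x)) by exact: nice_comp fK1 nl.
have ndfl : nice (fun x : J -> R => df (lstat G tau a N D x)) by exact: nice_comp dfK1 nl.
have nT : nice (@lstein R n p G tau a N D) by exact: nice_lstein.
have -> : E (fun x => step b m (lstat G tau a N D x)) - c =
    E (fun x => df (lstat G tau a N D x) * (v - lstein G tau a N D x)).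
  rewrite -[X in _ - X](gexp_cst P V c) -gexpB//; last exact: nstep.
  transitivity (E (fun x => v * df (lstat G tau a N D x) - lstat G tau a N D x * f (lstat G tau a N D x))).
    by congr gexp; apply/funext => x; rewrite fE.
  rewrite gexpB; [|exact: nZ|exact: niceM].
  rewrite (gexp_lstat mV Gsym VC a N D cf cdf fK1 dfK1 Df) -gexpB; [|exact: nZ|exact: niceM].
  by congr gexp; apply/funext => x; ring.
have nv : nice (fun x : J -> R => (lstein G tau a N D x - v) ^+ 2).
  by apply: niceX; apply: nB.
apply: (@le_trans _ _ (E (fun x => K * e + K / e * (lstein G tau a N D x - v) ^+ 2))).
  apply: gexp_norm_le.
  - by apply: niceM => //; exact: nB.
  - by apply: niceD => //; exact: nZ.
  move=> x; rewrite normrM distrC -mulrA -mulrDr; apply: ler_pM => //; first exact: (fK _).2.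
  rewrite -[X in _ <= _ + _ * X](real_normK (num_real _)); move: `|_ - v| (normr_ge0 (lstein G tau a N D x - v)) => t t0.
  rewrite -(ler_pM2r e0) mulrDl mulrAC mulVf ?gt_eqF// mul1r.
  by have := sqr_ge0 (t - e); nra.
rewrite (gexpD mV VC)//; last exact: nZ.
rewrite (gexpZ mV VC (K / e) nv) gexp_cst mulrDr lerD2l [leRHS]mulrCA [leRHS]mulrC.
rewrite ler_wpM2l ?divr_ge0 ?(ltW e0)//; exact: gexp_lstein_var.
Qed.

End finite_sample.

(** * Convergence of the coefficients *)

Section nested_sums.
Context (R : realType).

(** What is needed of a multiple sum over [{0, ..., p - 1}^r], uniformly in the number [r] of
    indices. The summands of the kappas do not depend on [p]; only the cube grows. *)
Record sum_op (I : Type) (L : nat -> (I -> R) -> R) : Prop := SumOp {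
  sum_opD : forall p f g, L p (fun i => f i + g i) = L p f + L p g;
  ler_sum_op : forall p f g, (forall i, f i <= g i) -> L p f <= L p g;
  sum_op_mono : forall p q f, (p <= q)%N -> (forall i, 0 <= f i) -> L p f <= L q f }.

Lemma sum_op_unit : sum_op (fun _ (f : unit -> R) => f tt).
Proof. by split => // p f g; apply. Qed.

Lemma sum_op_nest (I : Type) (L : nat -> (I -> R) -> R) : sum_op L ->
  sum_op (fun p (f : nat * I -> R) => \sum_(k < p) L p (fun i => f (k : nat, i))).
Proof.
move=> [LD Lle Lm]; split.
- by move=> p f g; rewrite -big_split; apply: eq_bigr => k _ /=; rewrite LD.
- by move=> p f g fg; apply: ler_sum => k _; apply: Lle => i; exact: fg.
- move=> p q f pq f0; apply: (@le_trans _ _ (\sum_(k < p) L q (fun i => f (k : nat, i)))).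
    by apply: ler_sum => k _; apply: Lm.
  rewrite -!(big_mkord xpredT (fun k => L q (fun i => f (k, i)))).
  rewrite (big_cat_nat _ pq)//= lerDl sumr_ge0// => k _.
  have L0 : L q (fun=> 0) = 0.
    by have := LD q (fun=> 0) (fun=> 0); under eq_fun do rewrite addr0; move=> /eqP;
      rewrite -subr_eq0 opprD addrA subrr sub0r oppr_eq0 => /eqP.
  by rewrite -L0; apply: Lle.
Qed.

(** Absolute convergence: the sums of [|t|] and of [t + |t|] are nondecreasing and bounded, and the
    sum of [t] is their difference. *)
Lemma cvg_sum_op (I : Type) (L : nat -> (I -> R) -> R) (t : I -> R) (C : R) :
  sum_op L -> (forall p, L p (fun i => `|t i|) <= C) -> cvgn (fun p => L p t).
Proof.
move=> [LD Lle Lm] LC.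
have c1 : cvgn (fun p => L p (fun i => `|t i|)).
  apply: nondecreasing_is_cvgn; first by move=> p q pq; apply: Lm.
  by exists C => _ [p _ <-].
have tt i : t i + `|t i| <= `|t i| + `|t i| by rewrite lerD2r ler_norm.
have c2 : cvgn (fun p => L p (fun i => t i + `|t i|)).
  apply: nondecreasing_is_cvgn.
    move=> p q pq; apply: Lm => // i; have := ler_norm (- t i); rewrite normrN; lra.
  exists (C + C) => _ [p _ <-]; apply: le_trans (Lle p _ _ tt) _.
  by rewrite LD lerD.
rewrite (_ : (fun p => L p t) = fun p => L p (fun i => t i + `|t i|) - L p (fun i => `|t i|)).
  exact: is_cvgB.
by apply/funext => p; rewrite LD addrK.
Qed.

End nested_sums.

(** * Schur's test *)

Section schur.
Context (R : realType) (p : nat).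
Variables (M : 'I_p -> 'I_p -> R) (K : R).
Hypotheses (Msym : forall k l, M k l = M l k) (MK : forall k, \sum_l `|M k l| <= K).

Lemma schur_bilin (x y : 'I_p -> R) :
  \sum_k \sum_l `|M k l| * (`|x k| * `|y l|) <= K * ((\sum_k x k ^+ 2) + \sum_k y k ^+ 2) / 2.
Proof.
have E (z : 'I_p -> R) : \sum_k \sum_l `|M k l| * z k ^+ 2 <= K * \sum_k z k ^+ 2.
  rewrite mulr_sumr; apply: ler_sum => k _; rewrite -mulr_suml ler_wpM2r ?sqr_ge0//.
have E' (z : 'I_p -> R) : \sum_k \sum_l `|M k l| * z l ^+ 2 <= K * \sum_k z k ^+ 2.
  rewrite exchange_big /=; under eq_bigr do under eq_bigr do rewrite Msym; exact: E.
rewrite ler_pdivlMr// [leRHS]mulrDr; apply: (le_trans _ (lerD (E x) (E' y))).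
rewrite mulr_suml -big_split.
apply: ler_sum => k _; rewrite /= mulr_suml -big_split; apply: ler_sum => l _ /=.
rewrite -mulrDr -mulrA ler_wpM2l// -[x k ^+ 2](real_normK (num_real _)) -[y l ^+ 2](real_normK (num_real _)).
by have := sqr_ge0 (`|x k| - `|y l|); nra.
Qed.

(** Cauchy-Schwarz with the weights [|M k l|] bounds each squared row by [K] times a weighted sum of
    squares; by symmetry the column sums give the second factor [K]. *)
Lemma schur_op (v : 'I_p -> R) :
  \sum_k (\sum_l M k l * v l) ^+ 2 <= K ^+ 2 * \sum_k v k ^+ 2.
Proof.
have [p0|p0] := posnP p.
  by case: p M K v p0 Msym MK => // M' K' v *; rewrite !big_ord0 mulr0.
have K0 : 0 <= K.
  by apply: le_trans (MK (Ordinal p0)); apply: sumr_ge0.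
have E k : (\sum_l M k l * v l) ^+ 2 <= K * \sum_l `|M k l| * v l ^+ 2.
  have H : (\sum_l M k l * v l) ^+ 2 <=
     \sum_l \sum_m `|M k l| * `|M k m| * (v l ^+ 2 + v m ^+ 2) / 2.
    rewrite expr2 mulr_suml; apply: ler_sum => l _; rewrite mulr_sumr; apply: ler_sum => m _.
    apply: (@le_trans _ _ (`|M k l| * `|M k m| * (`|v l| * `|v m|))).
      by rewrite mulrACA -!normrM ler_norm.
    rewrite -[leRHS]mulrA ler_wpM2l ?mulr_ge0// -[v l ^+ 2](real_normK (num_real _)) -[v m ^+ 2](real_normK (num_real _)).
    by have := sqr_ge0 (`|v l| - `|v m|); nra.
  apply: (le_trans H).
  have -> : \sum_l \sum_m `|M k l| * `|M k m| * (v l ^+ 2 + v m ^+ 2) / 2 =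
     (\sum_m `|M k m|) * \sum_l `|M k l| * v l ^+ 2.
    transitivity (((\sum_l \sum_m `|M k l| * `|M k m| * v l ^+ 2) +
       \sum_l \sum_m `|M k l| * `|M k m| * v m ^+ 2) / 2).
      rewrite -big_split mulr_suml; apply: eq_bigr => l _ /=; rewrite -big_split mulr_suml.
      by apply: eq_bigr => m _ /=; ring.
    have F : \sum_l \sum_m `|M k l| * `|M k m| * v l ^+ 2 = (\sum_m `|M k m|) * \sum_l `|M k l| * v l ^+ 2.
      rewrite mulr_sumr; apply: eq_bigr => l _; rewrite mulr_suml; apply: eq_bigr => m _; ring.
    rewrite [X in _ + X]exchange_big /= F.
    under [X in _ + X]eq_bigr do under eq_bigr do rewrite [`|M k _| * _]mulrC.
    by rewrite F; field.
  by rewrite ler_wpM2r// sumr_ge0// => l _; rewrite mulr_ge0// sqr_ge0.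
apply: (le_trans (ler_sum _ (fun k _ => E k))).
rewrite -mulr_sumr expr2 -mulrA ler_wpM2l// exchange_big /= mulr_sumr.
apply: ler_sum => l _; rewrite -mulr_suml ler_wpM2r ?sqr_ge0//.
by under eq_bigr do rewrite Msym.
Qed.

End schur.

Section toeplitz.
Context (R : realType).
Variable (r : R).
Hypothesis r01 : 0 <= r < 1.

Lemma sig_entryC (x : R) k l : sig_entry x k l = sig_entry x l k.
Proof. by rewrite /sig_entry addnC. Qed.

Lemma geo_le p : \sum_(l < p) r ^+ l <= (1 - r)^-1.
Proof.
have /andP[r0 r1] := r01; have r1' : 0 < 1 - r by rewrite subr_gt0.
have -> : \sum_(l < p) r ^+ l = (1 - r ^+ p) / (1 - r).
  elim: p => [|p IH]; first by rewrite big_ord0 expr0 subrr mul0r.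
  by rewrite big_ord_recr /= IH exprS; field; rewrite gt_eqF.
by rewrite ler_piMl ?invr_ge0 ?(ltW r1')// gerBl exprn_ge0.
Qed.

(** A row consists of two geometric progressions issuing from the diagonal. The induction on [k]
    shifts row and columns together, each shift costing one new entry in column 0. *)
Lemma sig_row_le k p : \sum_(l < p) sig_entry r k l <= 2 / (1 - r).
Proof.
have /andP[r0 r1] := r01.
suff H : \sum_(l < p) sig_entry r k l <= \sum_(i < k.+1) r ^+ i + (1 - r)^-1.
  by rewrite (le_trans H)// mulr_natl mulr2n lerD2r geo_le.
elim: k p => [|k IH] p.
  rewrite (eq_bigr (fun l : 'I_p => r ^+ l)); last by move=> l _; rewrite /sig_entry sub0n subn0.
  by rewrite (le_trans (geo_le p))// lerDr sumr_ge0// => i _; rewrite exprn_ge0.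
case: p => [|p].
  by rewrite big_ord0 addr_ge0 ?invr_ge0 ?subr_ge0 ?(ltW r1)// sumr_ge0// => i _; rewrite exprn_ge0.
have -> : \sum_(l < p.+1) sig_entry r k.+1 l = r ^+ k.+1 + \sum_(l < p) sig_entry r k l.
  rewrite big_ord_recl; congr (_ + _); first by rewrite /sig_entry sub0n addn0 subn0.
by rewrite [\sum_(i < k.+2) _]big_ord_recr /= [leLHS]addrC [leRHS]addrAC lerD2r IH.
Qed.

(** An exact value, since its leading coefficient enters the limit variance: at [r = rho^2] it is tr
    Sigma^2, of growth rate [(1 + rho^2) / (1 - rho^2)] per coordinate. *)
Lemma sig_total p : \sum_(k < p) \sum_(l < p) sig_entry r k l =
  p%:R * ((1 + r) / (1 - r)) - 2 * r * (1 - r ^+ p) / (1 - r) ^+ 2.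
Proof.
have /andP[r0 r1] := r01; have r1' : 1 - r != 0 by rewrite gt_eqF// subr_gt0.
elim: p => [|p IH]; first by rewrite big_ord0 expr0 subrr mulr0 mul0r mul0r subrr.
have col : \sum_(i < p) sig_entry r i p = r * (1 - r ^+ p) / (1 - r).
  elim: {IH} p => [|p IH]; first by rewrite big_ord0 expr0 subrr mulr0 mul0r.
  rewrite big_ord_recl /= (eq_bigr (fun i : 'I_p => sig_entry r i p)); last first.
    by move=> i _; rewrite /sig_entry /= /bump /= add1n !subSS.
  by rewrite IH /sig_entry sub0n add0n subn0 exprS; field.
rewrite big_ord_recr /=; under eq_bigr do rewrite big_ord_recr /=.
rewrite big_split /= IH big_ord_recr /= col.
under eq_bigr do rewrite sig_entryC.
by rewrite col /sig_entry subnn expr0 [r ^+ p.+1]exprS -[p.+1%:R]natr1; field.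
Qed.

End toeplitz.

(** * Existence of the limits of the kappas *)

Section kappa_limits.
Context (R : realType).
Variables (rho : R) (beta : nat -> R) (B : R).
Hypotheses (rho1 : `|rho| < 1) (betaB : forall p, \sum_(l < p) beta l ^+ 2 <= B).

Definition row_bound : R := 2 / (1 - `|rho|).
Local Notation K := row_bound.

Lemma row_bound_ge0 : 0 <= K.
Proof. by rewrite divr_ge0// subr_ge0 ltW. Qed.

Lemma norm_sig k l : `|sig_entry rho k l| = sig_entry `|rho| k l.
Proof. by rewrite /sig_entry normrX. Qed.

Lemma sig_row p (k : 'I_p) : \sum_(l < p) `|sig_entry rho k l| <= K.
Proof. by under eq_bigr do rewrite norm_sig; apply: sig_row_le; rewrite normr_ge0. Qed.

Let sigC p (k l : 'I_p) : sig_entry rho k l = sig_entry rho l k.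
Proof. exact: sig_entryC. Qed.

Let asigC p (k l : 'I_p) : `|sig_entry rho k l| = `|sig_entry rho l k|.
Proof. by rewrite sig_entryC. Qed.

Let asig_row p (k : 'I_p) : \sum_(l < p) `| `|sig_entry rho k l| | <= K.
Proof. by under eq_bigr do rewrite normr_id; exact: sig_row. Qed.

Let c p (k : nat) : R := \sum_(l < p) `|sig_entry rho k l| * `|beta l|.

Let cB p : \sum_(k < p) c p k ^+ 2 <= K ^+ 2 * B.
Proof.
apply: (le_trans (schur_op (@asigC p) (@asig_row p) (fun l : 'I_p => `|beta l|))).
rewrite ler_wpM2l ?sqr_ge0//.
by under eq_bigr do rewrite (real_normK (num_real _)).
Qed.

Lemma cvg_kappa1 : cvgn (kappa1 beta rho).
Proof.
have H := sum_op_nest (sum_op_nest (sum_op_unit R)).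
apply: (@cvg_sum_op _ _ _ (fun i => beta i.1 * beta i.2.1 * sig_entry rho i.1 i.2.1) (K * B) H) => p /=.
have E := schur_bilin (@sigC p) (@sig_row p) (fun l : 'I_p => beta l) (fun l : 'I_p => beta l).
apply: (@le_trans _ _ (K * ((\sum_(l < p) beta l ^+ 2) + \sum_(l < p) beta l ^+ 2) / 2)).
  apply: le_trans E; rewrite le_eqVlt; apply/orP; left; apply/eqP.
  by apply: eq_bigr => k _; apply: eq_bigr => l _; rewrite !normrM mulrC.
rewrite -mulrA ler_wpM2l ?row_bound_ge0//; have := betaB p; lra.
Qed.

Lemma cvg_kappa2 : cvgn (kappa2 beta rho).
Proof.
have H := sum_op_nest (sum_op_nest (sum_op_nest (sum_op_unit R))).
pose t (i : nat * (nat * (nat * unit))) : R :=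
  (beta i.2.1 * sig_entry rho i.1 i.2.1) * (beta i.2.2.1 * sig_entry rho i.1 i.2.2.1).
rewrite (_ : kappa2 beta rho = fun p => \sum_(k < p) \sum_(l < p) \sum_(m < p)
    t (k : nat, (l : nat, (m : nat, tt)))); last first.
  apply/funext => p; apply: eq_bigr => k _; rewrite expr2 mulr_suml.
  by apply: eq_bigr => l _; rewrite mulr_sumr.
apply: (@cvg_sum_op _ _ _ t (K ^+ 2 * B) H) => p /=.
apply: le_trans (cB p); rewrite le_eqVlt; apply/orP; left; apply/eqP.
apply: eq_bigr => k _; rewrite /c expr2 mulr_suml; apply: eq_bigr => l _.
by rewrite mulr_sumr; apply: eq_bigr => m _; rewrite /t /= !normrM; ring.
Qed.

Lemma cvg_kappa3 : cvgn (kappa3 beta rho).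
Proof.
have H := sum_op_nest (sum_op_nest (sum_op_nest (sum_op_nest (sum_op_unit R)))).
pose t (i : nat * (nat * (nat * (nat * unit)))) : R :=
  beta i.2.2.1 * beta i.2.2.2.1 * sig_entry rho i.1 i.2.2.1 * sig_entry rho i.2.1 i.2.2.2.1 *
  sig_entry rho i.1 i.2.1.
apply: (@cvg_sum_op _ _ _ t (K * (K ^+ 2 * B)) H) => p /=.
have E := schur_bilin (@sigC p) (@sig_row p) (fun l : 'I_p => c p l) (fun l : 'I_p => c p l).
have c0 k : 0 <= c p k by apply: sumr_ge0 => l _; rewrite mulr_ge0.
apply: (@le_trans _ _ (K * ((\sum_(l < p) c p l ^+ 2) + \sum_(l < p) c p l ^+ 2) / 2)).
  apply: le_trans E; rewrite le_eqVlt; apply/orP; left; apply/eqP.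
  apply: eq_bigr => k _; apply: eq_bigr => l _; rewrite (ger0_norm (c0 k)) (ger0_norm (c0 l)) {1}/c.
  rewrite mulr_suml mulr_sumr; apply: eq_bigr => j _; rewrite /c !mulr_sumr.
  by apply: eq_bigr => j' _; rewrite /t /= !normrM; ring.
rewrite -mulrA ler_wpM2l ?row_bound_ge0//; have := cB p; lra.
Qed.

(** * Traces, quadratic forms and operator norm of the residual covariance *)

Section fixed_dimension.
Variable p : nat.
Let S (k l : 'I_p) : R := sig_entry rho k l.
Let bt (l : 'I_p) : R := beta l.
Let b (k : 'I_p) : R := \sum_l S k l * bt l.
Local Notation k1 := (kappa1 beta rho p).
Local Notation k2 := (kappa2 beta rho p).
Local Notation k3 := (kappa3 beta rho p).

Let bsq : \sum_k b k ^+ 2 = k2.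
Proof.
by apply: eq_bigr => k _; congr (_ ^+ 2); apply: eq_bigr => l _; rewrite mulrC.
Qed.

Let bSb : qf S b b = k3.
Proof.
apply: eq_bigr => k _; apply: eq_bigr => l _; rewrite mulr_suml mulr_suml; apply: eq_bigr => j _.
rewrite mulr_sumr; apply: eq_bigr => j' _; rewrite /S /bt; ring.
Qed.

Let SS : mxdot S S = \sum_(k < p) \sum_(l < p) sig_entry (rho ^+ 2) k l.
Proof.
by apply: eq_bigr => k _; apply: eq_bigr => l _; rewrite /S /sig_entry -exprMn expr2.
Qed.

Lemma kappa2_ge0 : 0 <= k2.
Proof. by apply: sumr_ge0 => k _; exact: sqr_ge0. Qed.

Lemma kappa2_le : k2 <= K ^+ 2 * B.
Proof.
rewrite -bsq; apply: (le_trans (schur_op (@sigC p) (@sig_row p) bt)).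
by rewrite ler_wpM2l ?sqr_ge0.
Qed.

Variable s : R.
Let tau := k1 + s.
Hypothesis tau0 : 0 < tau.
Let G := resid_cov S bt s.
Let a (k : 'I_p) : R := b k / tau.

Let GE k l : G k l = S k l - b k * b l / tau. Proof. by []. Qed.

Let Gsym k l : G k l = G l k.
Proof. by rewrite !GE /S sig_entryC [b k * _]mulrC. Qed.

Let tn0 : tau != 0. Proof. by rewrite gt_eqF. Qed.

Lemma coef_sq : \sum_k a k ^+ 2 = k2 / tau ^+ 2.
Proof. by rewrite -bsq mulr_suml; apply: eq_bigr => k _; rewrite /a expr_div_n. Qed.

Lemma resid_tr : mxdot (@dlt R p) G = p%:R - k2 / tau.
Proof.
rewrite /mxdot; under eq_bigr do rewrite sum_dltl GE.
rewrite sumrB -mulr_suml -bsq; congr (_ - _ / _).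
rewrite (eq_bigr (fun=> 1)) ?sumr_const ?card_ord// => k _.
by rewrite /S /sig_entry subnn expr0.
Qed.

Lemma resid_tr2 : mxdot G G =
  (\sum_(k < p) \sum_(l < p) sig_entry (rho ^+ 2) k l) - 2 * k3 / tau + k2 ^+ 2 / tau ^+ 2.
Proof.
rewrite -SS -bSb -bsq expr2 [X in _ + X / _]mulr_suml.
rewrite mulr_sumr !mulr_suml -sumrB -big_split; apply: eq_bigr => k _ /=.
rewrite mulr_sumr mulr_sumr !mulr_suml -sumrB -big_split; apply: eq_bigr => l _ /=.
by rewrite !GE; field.
Qed.

Lemma resid_coef : qf G a a = (k3 - k2 ^+ 2 / tau) / tau ^+ 2.
Proof.
rewrite -bSb -bsq [X in _ - X / _]expr2 [X in _ - X / _]mulr_suml mulr_suml -sumrB mulr_suml.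
apply: eq_bigr => k _; rewrite mulr_sumr mulr_suml -sumrB mulr_suml.
by apply: eq_bigr => l _; rewrite GE /a; field.
Qed.

(** A bound on the squared operator norm of [S - b b' / tau], through [(x - y)^2 <= 2 x^2 + 2 y^2];
    the rank-one part has norm [|b|^2 / tau = k2 / tau]. *)
Definition resid_bound : R := 2 * K ^+ 2 + 2 * (k2 / tau) ^+ 2.

Lemma resid_bound_ge0 : 0 <= resid_bound.
Proof. by rewrite addr_ge0// mulr_ge0// sqr_ge0. Qed.

Lemma resid_op (v : 'I_p -> R) :
  \sum_k (\sum_l G k l * v l) ^+ 2 <= resid_bound * \sum_k v k ^+ 2.
Proof.
have cs : (\sum_l b l * v l) ^+ 2 <= k2 * \sum_k v k ^+ 2.
  rewrite -bsq -subr_ge0.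
  (* Lagrange's identity, which gives Cauchy-Schwarz. *)
  have -> : (\sum_k b k ^+ 2) * (\sum_k v k ^+ 2) - (\sum_l b l * v l) ^+ 2 =
     (\sum_k \sum_l (b k * v l - b l * v k) ^+ 2) / 2.
    pose X := \sum_k \sum_l b k ^+ 2 * v l ^+ 2.
    pose Y := \sum_k \sum_l b k * v k * (b l * v l).
    transitivity ((X + X - (Y + Y)) / 2).
      rewrite (_ : X = (\sum_k b k ^+ 2) * (\sum_k v k ^+ 2)); last first.
        by rewrite mulr_suml; apply: eq_bigr => k _; rewrite mulr_sumr.
      rewrite (_ : Y = (\sum_l b l * v l) ^+ 2); first by field.
      by rewrite expr2 mulr_suml; apply: eq_bigr => k _; rewrite mulr_sumr.
    congr (_ / _); rewrite {2}/X exchange_big /= -!big_split -sumrB; apply: eq_bigr => k _ /=.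
    rewrite -!big_split -sumrB; apply: eq_bigr => l _ /=; ring.
  by rewrite divr_ge0// !sumr_ge0// => k _; rewrite sumr_ge0// => l _; exact: sqr_ge0.
have E k : (\sum_l G k l * v l) ^+ 2 <=
    2 * (\sum_l S k l * v l) ^+ 2 + (2 * (\sum_l b l * v l) ^+ 2 / tau ^+ 2) * b k ^+ 2.
  have -> : \sum_l G k l * v l = (\sum_l S k l * v l) - b k / tau * \sum_l b l * v l.
    rewrite mulr_sumr -sumrB; apply: eq_bigr => l _; rewrite GE; ring.
  move: (\sum_l S k l * v l) (\sum_l b l * v l) => x y.
  have -> : 2 * y ^+ 2 / tau ^+ 2 * b k ^+ 2 = 2 * (b k / tau * y) ^+ 2 by field.
  by have := sqr_ge0 (x + b k / tau * y); nra.
apply: (le_trans (ler_sum _ (fun k _ => E k))).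
rewrite big_split /= -!mulr_sumr bsq /resid_bound [leRHS]mulrDl lerD//.
  by rewrite -[leRHS]mulrA ler_wpM2l//; exact: (schur_op (@sigC p) (@sig_row p) v).
rewrite (_ : 2 * (k2 / tau) ^+ 2 * _ = (2 * k2 / tau ^+ 2) * (k2 * \sum_k v k ^+ 2)); last by field.
rewrite (_ : _ * k2 = (2 * k2 / tau ^+ 2) * (\sum_l b l * v l) ^+ 2); last by field.
by rewrite ler_wpM2l// divr_ge0 ?sqr_ge0// mulr_ge0// kappa2_ge0.
Qed.

Let vimgE w k : vimg G w k = \sum_l G k l * w l.
Proof. by apply: eq_bigr => l _; rewrite mulrC. Qed.

(** The quantity is [a'G^3 a = <w, G w>] with [w = G a]. Its absolute value is at most half of
    [|w|^2 + |G w|^2], and each application of [G] costs one factor [resid_bound]. *)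
Lemma resid_coef3 : `|qf G (vimg G a) (vimg G a)| <=
  (resid_bound + resid_bound ^+ 2) * (k2 / tau ^+ 2) / 2.
Proof.
pose w := vimg G a; pose w2 := vimg G w.
have Ew : \sum_k w k ^+ 2 <= resid_bound * (k2 / tau ^+ 2).
  by rewrite -coef_sq /w; under eq_bigr do rewrite vimgE; exact: resid_op.
have Ew2 : \sum_k w2 k ^+ 2 <= resid_bound * \sum_k w k ^+ 2.
  by rewrite /w2; under eq_bigr do rewrite vimgE; exact: resid_op.
have -> : qf G w w = \sum_k w k * w2 k.
  apply: eq_bigr => k _; rewrite /w2 vimgE mulr_sumr.
  by apply: eq_bigr => l _; rewrite mulrA.
apply: (@le_trans _ _ (((\sum_k w k ^+ 2) + \sum_k w2 k ^+ 2) / 2)).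
  rewrite (le_trans (ler_norm_sum _ _ _))// -big_split mulr_suml; apply: ler_sum => k _ /=.
  rewrite normrM -[w k ^+ 2](real_normK (num_real _)) -[w2 k ^+ 2](real_normK (num_real _)).
  by have := sqr_ge0 (`|w k| - `|w2 k|); nra.
rewrite ler_pM2r ?invr_gt0// [leRHS]mulrDl lerD// (le_trans Ew2)// expr2 -mulrA.
by rewrite ler_wpM2l// resid_bound_ge0.
Qed.

(** The columns of [G^2] are the images under [G] of the columns of [G], so the operator bound
    applies column by column. Hence tr G^4 grows no faster than tr G^2, and is negligible against
    [n^2]. *)
Lemma resid_tr4_ge0 : 0 <= mxdot (mx3 G G G) G <= resid_bound * mxdot G G.
Proof.
have -> : mxdot (mx3 G G G) G = \sum_l \sum_k (\sum_m G k m * G m l) ^+ 2.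
  rewrite /mxdot; transitivity (\sum_k \sum_l \sum_a \sum_b G k a * G a b * G b l * G k l).
    apply: eq_bigr => k _; apply: eq_bigr => l _; rewrite mulr_suml.
    by apply: eq_bigr => a' _; rewrite mulr_suml.
  rewrite [RHS](eq_bigr (fun l => \sum_k \sum_a \sum_b G k a * G a l * (G k b * G b l))); last first.
    move=> l _; apply: eq_bigr => k _; rewrite expr2 mulr_suml.
    by apply: eq_bigr => a' _; rewrite mulr_sumr.
  (* tr G^4 = sum G_ka G_ab G_bl G_kl, regrouped as the sum of the squares of the entries of G^2 *)
  rewrite [LHS](eq_bigr (fun k => \sum_b \sum_l \sum_a G k a * G a b * G b l * G k l)); last first.
    move=> k _; rewrite [RHS]exchange_big; apply: eq_bigr => l _ /=.
    by rewrite exchange_big.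
  rewrite exchange_big /=; apply: eq_bigr => l _; apply: eq_bigr => k _.
  rewrite exchange_big /=; apply: eq_bigr => a' _; apply: eq_bigr => b' _.
  by rewrite (Gsym l b'); ring.
apply/andP; split; first by apply: sumr_ge0 => l _; apply: sumr_ge0 => k _; exact: sqr_ge0.
rewrite /mxdot [X in _ <= _ * X]exchange_big mulr_sumr; apply: ler_sum => l _.
apply: (le_trans (resid_op (fun m => G m l))).
by under [in leRHS]eq_bigr do rewrite -expr2.
Qed.

End fixed_dimension.

End kappa_limits.

(** * Limit of the variance bound along the sequence *)

Section stein_var_limit.
Context (R : realType).
Variables (rho s c : R) (beta : nat -> R) (B : R) (p : nat -> nat).
Hypotheses (rho1 : `|rho| < 1) (betaB : forall q, \sum_(l < q) beta l ^+ 2 <= B).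
Hypotheses (s0 : 0 < s) (py : (fun n => (p n)%:R : R) @ \oo --> +oo).
Hypothesis pc : (fun n => (p n)%:R / n%:R : R) @ \oo --> c.
Hypothesis k1_ge0 : forall n, (0 < n)%N -> 0 <= kappa1 beta rho (p n).

Let k1 := limn (fun q => kappa1 beta rho q).
Let k2 := limn (fun q => kappa2 beta rho q).
Let k3 := limn (fun q => kappa3 beta rho q).
Let K := row_bound rho.

Let S n (k l : 'I_(p n)) : R := sig_entry rho k l.
Let bt n (l : 'I_(p n)) : R := beta l.

Definition tau_seq n : R := kappa1 beta rho (p n) + s.
Definition cov_seq n : 'I_(p n) -> 'I_(p n) -> R := resid_cov (@S n) (@bt n) s.
Definition coef_seq n (k : 'I_(p n)) : R := (\sum_l S k l * bt l) / tau_seq n.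
Definition slope_seq n : R := lstat_slope n (@cov_seq n) (tau_seq n) (@coef_seq n).

Lemma tau_seq_gt0 n : (0 < n)%N -> 0 < tau_seq n.
Proof. by move=> n0; rewrite ltr_wpDl// k1_ge0. Qed.

Let cvg_p (u : nat -> R) : cvgn u -> (fun n => u (p n)) @ \oo --> limn u.
Proof. by move=> cu; apply: cvg_comp cu; apply/(@cvgrnyP R). Qed.

(** The index 0 is set aside: there [n] cannot be inverted, and positivity of [kappa1] is only
    available once there is at least one row. *)
Let near_eq (f g : nat -> R) (l : R) : (forall n, (0 < n)%N -> f n = g n) ->
  f @ \oo --> l -> g @ \oo --> l.
Proof.
by move=> fg; apply: cvg_trans; apply: near_eq_cvg; exists 1%N.
Qed.

Let cinv : (fun n => n%:R^-1 : R) @ \oo --> (0 : R).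
Proof. by apply/gtr0_cvgV0; [exists 1%N => // n /=; rewrite ltr0n|exact: cvgr_idn]. Qed.

Let bdd0 (x : nat -> R) (C : R) : (forall n, (0 < n)%N -> `|x n| <= C) ->
  (fun n => x n / n%:R) @ \oo --> (0 : R).
Proof.
move=> xC; apply/norm_cvg0P; apply: (@squeeze_cvgr _ _ _ _ (fun=> 0) (fun n => C * n%:R^-1)).
- exists 1%N => // n /= n0; rewrite normr_ge0 normrM normfV normr_nat.
  by rewrite ler_wpM2r ?invr_ge0// xC.
- exact: cvg_cst.
- rewrite -[X in _ --> X](mulr0 C); apply: cvgM; [exact: cvg_cst|exact: cinv].
Qed.

Let cvg0M (x y : nat -> R) (l : R) : x @ \oo --> (0 : R) -> y @ \oo --> l ->
  (fun n => x n * y n) @ \oo --> (0 : R).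
Proof. by move=> x0 yl; rewrite -[X in _ --> X](mul0r l); exact: cvgM. Qed.

Let c1 : (fun n => kappa1 beta rho (p n)) @ \oo --> k1.
Proof. exact: cvg_p (cvg_kappa1 rho1 betaB). Qed.
Let c2 : (fun n => kappa2 beta rho (p n)) @ \oo --> k2.
Proof. exact: cvg_p (cvg_kappa2 rho1 betaB). Qed.
Let c3 : (fun n => kappa3 beta rho (p n)) @ \oo --> k3.
Proof. exact: cvg_p (cvg_kappa3 rho1 betaB). Qed.

Lemma lim_kappa1_ge0 : 0 <= k1.
Proof.
rewrite -(cvg_lim (@Rhausdorff R) c1); apply: limr_ge; first by apply/cvg_ex; exists k1.
by exists 1%N => // n; exact: k1_ge0.
Qed.

Lemma lim_kappa2_ge0 : 0 <= k2.
Proof.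
rewrite -(cvg_lim (@Rhausdorff R) c2); apply: limr_ge; first by apply/cvg_ex; exists k2.
by apply: nearW => n; exact: kappa2_ge0.
Qed.

Let t := k1 + s.
Let t0 : 0 < t. Proof. by rewrite ltr_wpDl// lim_kappa1_ge0. Qed.
Let tn0 : t != 0. Proof. by rewrite gt_eqF. Qed.

Lemma cvg_tau_seq : tau_seq @ \oo --> t.
Proof. by apply: cvgD; [exact: c1|exact: cvg_cst]. Qed.
Local Notation ct := cvg_tau_seq.

Let ctV : (fun n => (tau_seq n)^-1) @ \oo --> t^-1.
Proof. by apply: cvgV => //; exact: ct. Qed.

Let cX (u : nat -> R) (l : R) (j : nat) : u @ \oo --> l -> (fun n => u n ^+ j) @ \oo --> l ^+ j.
Proof.
move=> ul; elim: j => [|j IH]; first exact: cvg_cst.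
by rewrite (_ : (fun n => _) = fun n => u n * u n ^+ j);
  [rewrite exprS; exact: cvgM|apply/funext => n; rewrite exprS].
Qed.

Lemma cvg_qmom j : (fun n => qmom n (tau_seq n) j) @ \oo --> t ^+ j.
Proof.
elim: j => [|j IH] /=; first by rewrite expr0; exact: cvg_cst.
rewrite [X in _ --> X](_ : _ = t * (1 + 0) * t ^+ j); last by rewrite addr0 mulr1 exprS.
apply: cvgM => //; apply: cvgM; first exact: ct.
apply: cvgD; first exact: cvg_cst.
by apply: (@bdd0 (fun=> 2 * j%:R) `|2 * j%:R|).
Qed.

Let al n : R := qf (@cov_seq n) (@coef_seq n) (@coef_seq n).
Let g2 n : R := mxdot (@cov_seq n) (@cov_seq n).

Lemma cvg_coef : al @ \oo --> (k3 - k2 ^+ 2 / t) / t ^+ 2.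
Proof.
apply: (@near_eq (fun n => (kappa3 beta rho (p n) - kappa2 beta rho (p n) ^+ 2 / tau_seq n)
   * (tau_seq n)^-1 ^+ 2)).
  by move=> n n0; rewrite /al /coef_seq (resid_coef (tau_seq_gt0 n0)) exprVn.
rewrite -exprVn; apply: cvgM; last exact: cX.
apply: cvgB; first exact: c3.
by apply: cvgM => //; exact: cX.
Qed.

Let L := (1 + rho ^+ 2) / (1 - rho ^+ 2).

Let rho2 : 0 <= rho ^+ 2 < 1.
Proof. by rewrite sqr_ge0 -[rho ^+ 2](real_normK (num_real _)) expr_lt1. Qed.

(** Only the term of tr Sigma^2 linear in [p] survives the division by [n]; its boundary correction
    and the terms due to the rank-one part of the covariance are bounded. *)
Lemma cvg_tr2 : (fun n => g2 n / n%:R) @ \oo --> c * L.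
Proof.
pose r := rho ^+ 2.
apply: (@near_eq (fun n => (p n)%:R / n%:R * L - (2 * r * (1 - r ^+ p n) / (1 - r) ^+ 2) / n%:R
   - 2 * kappa3 beta rho (p n) * (tau_seq n)^-1 * n%:R^-1
   + kappa2 beta rho (p n) ^+ 2 * (tau_seq n)^-1 ^+ 2 * n%:R^-1)).
  move=> n n0; rewrite /g2 /cov_seq (resid_tr2 (tau_seq_gt0 n0)) (sig_total rho2).
  rewrite -/r /L -/r exprVn; ring.
rewrite -[X in _ --> X]addr0; apply: cvgD; last first.
  rewrite -[X in _ --> X](mulr0 (k2 ^+ 2 * t^-1 ^+ 2)); apply: cvgM => //.
  by apply: cvgM; exact: cX.
rewrite -[X in _ --> X]subr0; apply: cvgB; last first.
  rewrite -[X in _ --> X](mulr0 (2 * k3 * t^-1)); apply: cvgM => //.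
  by apply: cvgM => //; apply: cvgM => //; exact: cvg_cst.
rewrite -[X in _ --> X]subr0; apply: cvgB; first by apply: cvgM => //; exact: cvg_cst.
apply: (@bdd0 _ (2 * r / (1 - r) ^+ 2)) => n _.
have /andP[r0 r1] := rho2; rewrite -/r in r0 r1.
have rp0 : 0 <= r ^+ p n by rewrite exprn_ge0.
have rp1 : r ^+ p n <= 1 by rewrite exprn_ile1// ltW.
have d0 : 0 <= 1 - r ^+ p n by rewrite subr_ge0.
have r2 : 0 <= 2 * r by rewrite mulr_ge0.
rewrite (ger0_norm (divr_ge0 (mulr_ge0 r2 d0) (sqr_ge0 _))).
by rewrite ler_wpM2r ?invr_ge0 ?sqr_ge0// ler_piMr// gerBl.
Qed.

Lemma cvg_slope : (fun n => slope_seq n / n%:R) @ \oo --> 2 * k2 / t + c.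
Proof.
apply: (@near_eq (fun n => 2 * kappa2 beta rho (p n) * (tau_seq n)^-1 + ((p n)%:R / n%:R
   - kappa2 beta rho (p n) * (tau_seq n)^-1 * n%:R^-1))).
  move=> n n0.
  have E1 : \sum_k coef_seq (n := n) k ^+ 2 = kappa2 beta rho (p n) / tau_seq n ^+ 2.
    exact: coef_sq.
  have E2 : mxdot (@dlt R (p n)) (@cov_seq n) = (p n)%:R - kappa2 beta rho (p n) / tau_seq n.
    exact: resid_tr.
  rewrite /slope_seq /lstat_slope E1 E2.
  have nn : n%:R != 0 :> R by rewrite pnatr_eq0 -lt0n.
  have un : tau_seq n != 0 by rewrite gt_eqF// tau_seq_gt0.
  by field; rewrite nn un.
apply: cvgD; first by apply: cvgM => //; apply: cvgM => //; exact: cvg_cst.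
rewrite -[X in _ --> X]subr0; apply: cvgB => //.
rewrite -[X in _ --> X](mulr0 (k2 * t^-1)); apply: cvgM => //; exact: cvgM.
Qed.

Lemma lim_kappa3_ge0 : (forall n, (0 < n)%N -> 0 <= kappa3 beta rho (p n)) -> 0 <= k3.
Proof.
move=> H; rewrite -(cvg_lim (@Rhausdorff R) c3); apply: limr_ge; first by apply/cvg_ex; exists k3.
by exists 1%N => // n; exact: H.
Qed.

Let kB := K ^+ 2 * B.
(** Uniform in [n] because [tau_seq n >= s]; it makes the operator bound on the residual covariance
    uniform as well. *)
Let bdk n : (0 < n)%N -> 0 <= kappa2 beta rho (p n) / tau_seq n <= kB / s.
Proof.
move=> n0; have tp := tau_seq_gt0 n0.
rewrite divr_ge0 ?kappa2_ge0 ?(ltW tp)//= ler_pM ?kappa2_ge0 ?invr_ge0 ?(ltW tp)//.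
  exact: kappa2_le.
by rewrite lef_pV2 ?posrE// lerDr k1_ge0.
Qed.

Let bdr n : (0 < n)%N -> resid_bound rho beta (p n) s <= 2 * K ^+ 2 + 2 * (kB / s) ^+ 2.
Proof.
move=> n0; rewrite /resid_bound lerD2l ler_wpM2l//.
by have /andP[h0 h1] := bdk n0; rewrite ler_sqr ?nnegrE// (le_trans h0).
Qed.

Let cvg_coef3 : (fun n => qf (@cov_seq n) (vimg (@cov_seq n) (@coef_seq n))
    (vimg (@cov_seq n) (@coef_seq n)) / n%:R) @ \oo --> (0 : R).
Proof.
pose C := 2 * K ^+ 2 + 2 * (kB / s) ^+ 2.
apply: (@bdd0 _ ((C + C ^+ 2) * (kB / s / s) / 2)) => n n0.
apply: (le_trans (resid_coef3 rho1 (tau_seq_gt0 n0))).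
have r0 := resid_bound_ge0 rho beta (p n) s; have r1 := bdr n0.
have /andP[h0 h1] := bdk n0; have tp := tau_seq_gt0 n0.
rewrite ler_pM2r ?invr_gt0//; apply: ler_pM.
- by rewrite addr_ge0// sqr_ge0.
- by rewrite divr_ge0 ?kappa2_ge0// sqr_ge0.
- by rewrite lerD// ler_sqr ?nnegrE// (le_trans r0).
- rewrite expr2 invfM mulrA ler_pM ?invr_ge0 ?(ltW tp)//.
  by rewrite lef_pV2 ?posrE// lerDr k1_ge0.
Qed.

Let cvg_tr4 : (fun n => mxdot (mx3 (@cov_seq n) (@cov_seq n) (@cov_seq n)) (@cov_seq n) / n%:R ^+ 2)
  @ \oo --> (0 : R).
Proof.
pose C := 2 * K ^+ 2 + 2 * (kB / s) ^+ 2.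
apply: (@squeeze_cvgr _ _ _ _ (fun=> 0) (fun n => C * (g2 n / n%:R) * n%:R^-1)).
- exists 1%N => // n /= n0.
  have /andP[h0 h1] := resid_tr4_ge0 rho1 (tau_seq_gt0 n0).
  rewrite divr_ge0 ?sqr_ge0//= expr2 invfM !mulrA !ler_wpM2r ?invr_ge0//.
  apply: (le_trans h1); rewrite ler_wpM2r//; last exact: bdr.
  by apply: sumr_ge0 => k _; apply: sumr_ge0 => l _; rewrite -expr2 sqr_ge0.
- exact: cvg_cst.
- rewrite -[X in _ --> X](mulr0 (C * (c * L))); apply: cvgM => //; apply: cvgM; first exact: cvg_cst.
  exact: cvg_tr2.
Qed.

(** The summands vanish for three different reasons: variances of powers of [q / n] because the
    moments tend to powers of [t]; the others by an extra [1 / n], or by the operator bound for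
    [a'G^3 a] and tr G^4; the bias by the choice of the limit variance. *)
Lemma cvg_stein_var :
  (fun n => stein_var n (@cov_seq n) (tau_seq n) (@coef_seq n) (slope_seq n)
    (4 * k2 ^+ 2 + 4 * t * (2 * k2 * c + k3) + 2 * c * t ^+ 2 * (c + L))) @ \oo --> (0 : R).
Proof.
have ccst (x : R) : (fun=> x) @ \oo --> x by exact: cvg_cst.
have cm := cvg_qmom; have cD := cvg_slope; have cg := cvg_tr2; have ca := cvg_coef.
have tX j : (fun n => tau_seq n ^+ j) @ \oo --> t ^+ j by apply: cX; exact: ct.
have DX j : (fun n => (slope_seq n / n%:R) ^+ j) @ \oo --> (2 * k2 / t + c) ^+ j by exact: cX.
rewrite /stein_var -[X in _ --> X](mulr0 8); apply: cvgM => //.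
rewrite -[X in _ --> X](_ : 0 + 0 + 0 + 0 + 0 + 0 + 0 + 0 = 0); last by rewrite !addr0.
apply: cvgD; [apply: cvgD; [apply: cvgD; [apply: cvgD; [apply: cvgD; [apply: cvgD; [apply: cvgD|]|]|]|]|]|].
- rewrite [X in _ --> X](_ : _ = 16 * ((k3 - k2 ^+ 2 / t) / t ^+ 2) ^+ 2 *
   (t ^+ 6 - 2 * t ^+ 3 * t ^+ 3 + t ^+ 6)); last by ring.
  exact: cvgM (cvgM (ccst 16) (@cX _ _ 2%N ca)) (cvgD (cvgB (cm 6%N) (cvgM (cvgM (ccst 2) (tX 3%N)) (cm 3%N))) (tX 6%N)).
- apply: (@near_eq (fun n => (qf (@cov_seq n) (vimg (@cov_seq n) (@coef_seq n))
      (vimg (@cov_seq n) (@coef_seq n)) / n%:R) * (36 * qmom n (tau_seq n) 5))).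
    by move=> n n0; ring.
  exact: cvg0M cvg_coef3 (cvgM (ccst 36) (cm 5%N)).
- apply: (@near_eq (fun n => (mxdot (mx3 (@cov_seq n) (@cov_seq n) (@cov_seq n)) (@cov_seq n)
      / n%:R ^+ 2) * (8 * qmom n (tau_seq n) 4))).
    by move=> n n0; ring.
  exact: cvg0M cvg_tr4 (cvgM (ccst 8) (cm 4%N)).
- rewrite [X in _ --> X](_ : _ = 4 * (c * L) ^+ 2 * (t ^+ 4 - 2 * t ^+ 2 * t ^+ 2 + t ^+ 4));
    last by ring.
  exact: cvgM (cvgM (ccst 4) (@cX _ _ 2%N cg)) (cvgD (cvgB (cm 4%N) (cvgM (cvgM (ccst 2) (tX 2%N)) (cm 2%N))) (tX 4%N)).
- rewrite [X in _ --> X](_ : _ = 4 * (2 * k2 / t + c) ^+ 4 * t ^+ 2 * (t ^+ 2 - 2 * t * t ^+ 1 + t ^+ 2));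
    last by ring.
  exact: cvgM (cvgM (cvgM (ccst 4) (DX 4%N)) (tX 2%N))
    (cvgD (cvgB (cm 2%N) (cvgM (cvgM (ccst 2) ct) (cm 1%N))) (tX 2%N)).
- apply: (@near_eq (fun n => n%:R^-1 * (36 * (slope_seq n / n%:R) ^+ 2 * tau_seq n ^+ 2
      * qmom n (tau_seq n) 3 * al n))).
    by move=> n n0; rewrite /al; ring.
  exact: cvg0M cinv (cvgM (cvgM (cvgM (cvgM (ccst 36) (DX 2%N)) (tX 2%N)) (cm 3%N)) ca).
- apply: (@near_eq (fun n => n%:R^-1 * (8 * (slope_seq n / n%:R) ^+ 2 * tau_seq n ^+ 2
      * qmom n (tau_seq n) 2 * (g2 n / n%:R)))).
    by move=> n n0; rewrite /g2; field; rewrite pnatr_eq0 -lt0n.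
  exact: cvg0M cinv (cvgM (cvgM (cvgM (cvgM (ccst 8) (DX 2%N)) (tX 2%N)) (cm 2%N)) cg).
(* Here the variance formula is verified: [4 t k3 - 4 k2^2 + 2 c L t^2 + 2 (2 k2 + c t)^2] expands
   to it, the [8 k2^2] of the square leaving [4 k2^2] after the rank-one loss. *)
- rewrite [X in _ --> X](_ : _ = (4 * ((k3 - k2 ^+ 2 / t) / t ^+ 2) * t ^+ 3 +
     2 * (c * L) * t ^+ 2 + 2 * (2 * k2 / t + c) ^+ 2 * t ^+ 2 -
     (4 * k2 ^+ 2 + 4 * t * (2 * k2 * c + k3) + 2 * c * t ^+ 2 * (c + L))) ^+ 2); last first.
    by apply/esym/eqP; rewrite sqrf_eq0; apply/eqP; move: L => l; field.
  exact: (@cX _ _ 2%N (cvgB (cvgD (cvgD (cvgM (cvgM (ccst 4) ca) (tX 3%N)) (cvgM (cvgM (ccst 2) cg) (tX 2%N)))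
    (cvgM (cvgM (ccst 2) (DX 2%N)) (tX 2%N))) (ccst _))).
Qed.

End stein_var_limit.

(** * The central limit theorem *)

Section step_cdf.
Context (R : realType) d (T : measurableType d) (P : probability T R) (Z : T -> R).
Hypothesis mZ : measurable_fun setT Z.

Let mle b : measurable [set w | Z w <= b].
Proof.
rewrite (_ : [set w | Z w <= b] = setT `&` Z @^-1` `]-oo, b]%classic); last first.
  by apply/seteqP; split => [w /=|w [_]] /=; rewrite in_itv.
exact: mZ.
Qed.

Let istep b m : P.-integrable setT (EFin \o (fun w => step b m (Z w))).
Proof.
apply: (@integrable_le_cst _ _ _ _ _ 1) => [|w].
  apply: measurableT_comp => //; apply: continuous_measurable_fun; exact: continuous_step.
by have /andP[? ?] := step01 b m (Z w); rewrite ger0_norm.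
Qed.

Let iind (A : set T) : measurable A -> P.-integrable setT (EFin \o (fun w => \1_A w : R)).
Proof.
move=> mA; apply: (@integrable_le_cst _ _ _ _ _ 1) => [|w]; first exact: measurable_indic.
by rewrite indicE; case: (_ \in _); rewrite ?normr1 ?normr0.
Qed.

(** The ramp ending at [b] lies below the indicator of []-oo, b]]; in the companion bound, the ramp
    ending at [b + 1/m] lies above it, as its descent only starts at [b]. *)
Lemma Rintegral_step_le b m : \int[P]_w step b m (Z w) <= fine (P [set w | Z w <= b]).
Proof.
rewrite -(Rintegral_indic P (mle b)); apply: (le_Rintegral measurableT (istep b m) (iind (mle b))).
move=> w _; rewrite indicE; have [Zb|Zb] := leP (Z w) b.
  by rewrite mem_set//=; case/andP: (step01 b m (Z w)).
rewrite memNset/=; last by apply/negP; rewrite -ltNge.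
rewrite /step /= ge_min (_ : Num.max _ _ = 0) ?lexx ?orbT//.
by apply/max_idPl; rewrite mulr_ge0_le0// subr_le0 ltW.
Qed.

Lemma le_Rintegral_step b m : (0 < m)%N ->
  fine (P [set w | Z w <= b]) <= \int[P]_w step (b + m%:R^-1) m (Z w).
Proof.
move=> m0; rewrite -(Rintegral_indic P (mle b)).
apply: (le_Rintegral measurableT (iind (mle b)) (istep _ m)) => w _.
rewrite indicE; have [Zb|Zb] := leP (Z w) b; last first.
  by rewrite memNset/=; [case/andP: (step01 (b + m%:R^-1) m (Z w))|apply/negP; rewrite -ltNge].
rewrite mem_set//= /step /= le_min lexx /= le_max; apply/orP; right.
have m1 : m%:R != 0 :> R by rewrite pnatr_eq0 -lt0n.
rewrite -[leLHS](divff m1) ler_wpM2l// addrAC lerDr subr_ge0//.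
Qed.

End step_cdf.

(** * The ramp estimate for the regression statistic *)

Section regression_step.
Context (R : realType) d (T : measurableType d) (P : probability T R).
Variables (n p : nat) (rho s : R) (beta : nat -> R).
Variables (X : 'I_n -> 'I_p -> T -> R) (eps : 'I_n -> T -> R).
Let S (k l : 'I_p) : R := sig_entry rho k l.
Let bt (l : 'I_p) : R := beta l.
Hypotheses (mX : forall i k, measurable_fun setT (X i k)) (me : forall i, measurable_fun setT (eps i)).
Hypothesis iX : mutual_indep P X.
Hypothesis gX : forall i, gauss_vec P (X i) S.
Hypothesis ge : gauss_vec P eps (fun i j => s * (i == j)%:R).
Hypothesis iXe : indep2 P (fun (ij : 'I_n * 'I_p) w => X ij.1 ij.2 w) eps.
Hypotheses (n0 : (0 < n)%N) (s0 : 0 < s).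

Local Notation kap1 := (kappa1 beta rho p).
Local Notation kap2 := (kappa2 beta rho p).
Let tau := kap1 + s.
Let b (k : 'I_p) : R := \sum_l S k l * bt l.
Let G := resid_cov S bt s.
Let a (k : 'I_p) : R := b k / tau.
Let N : R := n%:R * Num.sqrt n%:R.

(** Positivity of Sigma is read off from the existence of a Gaussian row with this covariance,
    whence the condition [0 < n]. *)
Lemma kappa1_ge0 : 0 <= kap1.
Proof.
have := gauss_vec_qf_ge0 (gX (Ordinal n0)) bt; congr (_ <= _).
by apply: eq_bigr => k _; apply: eq_bigr => l _; rewrite mulrAC.
Qed.

(** It is the quadratic form of Sigma at [b = Sigma beta]. *)
Lemma kappa3_ge0 : 0 <= kappa3 beta rho p.
Proof.
have := gauss_vec_qf_ge0 (gX (Ordinal n0)) b; congr (_ <= _).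
apply: eq_bigr => k _; apply: eq_bigr => l _; rewrite mulr_suml mulr_suml; apply: eq_bigr => j _.
by rewrite mulr_sumr; apply: eq_bigr => j' _; rewrite /S /bt; ring.
Qed.

Let t0 : 0 < tau. Proof. by rewrite ltr_wpDl// kappa1_ge0. Qed.

Let V := reg_fam X eps S bt s.

Let Gsym k l : G k l = G l k.
Proof. by rewrite /G /resid_cov /S sig_entryC; congr (_ - _ / _); rewrite mulrC. Qed.

Let mV j : measurable_fun setT (V j). Proof. exact: measurable_reg_fam. Qed.

Let VC : gfam P V (split_cov G tau).
Proof.
have := gfam_reg_fam mX me (fun k l => sig_entryC rho k l) iX gX ge iXe.
by apply; rewrite -/tau gt_eqF.
Qed.

Let nR : 0 < n%:R :> R. Proof. by rewrite ltr0n. Qed.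
Let N0 : 0 < N. Proof. by rewrite mulr_gt0// sqrtr_gt0. Qed.
Let N3 : N ^+ 2 = n%:R ^+ 3.
Proof. by rewrite exprMn sqr_sqrtr// -exprSr. Qed.

Definition response_of (i : 'I_n) (w : T) : R := \sum_(j < p) X i j w * beta j + eps i w.

Definition reg_stat (w : T) : R :=
  (\sum_(k < p) (\sum_(i < n) X i k w * response_of i w) ^+ 2 - n%:R ^+ 2 * kap2
   - p%:R * n%:R * (kap1 + s)) / (n%:R * Num.sqrt n%:R).

Let reg_statE w : reg_stat w = fstat G tau a N (V ^~ w).
Proof.
rewrite /reg_stat /fstat mulrC; congr (_ * _).
have E1 : \sum_k a k ^+ 2 = kap2 / tau ^+ 2 by exact: coef_sq.
have E2 : mxdot (@dlt R p) G = p%:R - kap2 / tau by exact: resid_tr.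
have tn : tau != 0 by rewrite gt_eqF.
rewrite E1 E2 -/tau.
have -> : \sum_(k < p) (\sum_(i < n) X i k w * response_of i w) ^+ 2 =
    \sum_k (hW k (V ^~ w) + a k * qY (V ^~ w)) ^+ 2.
  apply: eq_bigr => k _; congr (_ ^+ 2); rewrite /hW /qY mulr_sumr -big_split.
  apply: eq_bigr => i _.
  (* The decomposition [X_ik = W_ik + a_k Y_i], multiplied by [Y_i]. *)
  transitivity ((X i k w - a k * response_of i w) * response_of i w + a k * response_of i w ^+ 2);
    [ring|by []].
by move: (\sum_k _) => Q; move: tn; move: tau => t tn; field.
Qed.

Lemma regression_step (z : R) (m : nat) (v c K e : R) (f df : R -> R) : 0 < e ->
  continuous f -> continuous df -> (forall y, `|f y| <= K * (1 + `|y|) /\ `|df y| <= K) ->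
  (forall y : R, is_derive y (1 : R) f (df y)) ->
  (forall y, v * df y - y * f y = step z m y - c) ->
  `|\int[P]_w step z m (reg_stat w) - c| <=
  K * (e + stein_var n G tau a (lstat_slope n G tau a) v / e) + m%:R * (3 * kap2 / Num.sqrt n%:R).
Proof.
move=> e0 cf cdf fK Df fE.
have B1 := gexp_step_lstat mV Gsym VC a n0 N3 e0 cf cdf fK Df fE.
have B2 := gexp_step_fstat mV Gsym VC a n0 N0 z m.
under eq_Rintegral do rewrite reg_statE.
rewrite -/(gexp P V (fun x => step z m (fstat G tau a N x))).
rewrite -[X in `|X|](subrKA (gexp P V (fun x => step z m (lstat G tau a N (lstat_slope n G tau a) x)))).
rewrite (le_trans (ler_normD _ _))// addrC lerD//.
apply: (le_trans B2); rewrite le_eqVlt; apply/orP; left; apply/eqP; congr (_ * _).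
have -> : \sum_k a k ^+ 2 = kap2 / tau ^+ 2 by exact: coef_sq.
by rewrite /N; field; rewrite !gt_eqF ?sqrtr_gt0.
Qed.

Lemma measurable_reg_stat : measurable_fun setT reg_stat.
Proof.
apply: measurable_funM => //; do 2 (apply: measurable_funB => //).
apply: measurable_sum => k; apply: measurable_funX; apply: measurable_sum => i.
apply: measurable_funM => //; apply: measurable_funD => //; apply: measurable_sum => j.
exact: measurable_funM.
Qed.

End regression_step.

(** Here [q] is the distribution function of the statistic at [x], enclosed by its ramp means [l]
    and [u]; [Nl] and [Nu] are the normal means of the same ramps, and [Fm], [F], [Fp] the normal
    distribution function slightly before, at and slightly after [x]. *)
Lemma sandwich (R : realFieldType) (F Fp Fm q u l Nu Nl e : R) :
  q <= u -> l <= q -> `|Nu - u| <= e / 2 -> `|Nl - l| <= e / 2 -> Nu <= Fp -> Fm <= Nl ->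
  `|F - Fp| <= e / 2 -> `|F - Fm| <= e / 2 -> `|F - q| <= e.
Proof.
rewrite !ler_norml => ? ? /andP[? ?] /andP[? ?] ? ? /andP[? ?] /andP[? ?].
by apply/andP; split; lra.
Qed.

Unset Implicit Arguments. Set Strict Implicit. Set Printing Implicit Defensive.

Theorem theorem1 (R : realType) (rho s2eps c : R) (beta : nat -> R)
    (p : nat -> nat) (d : measure_display) (T : nat -> measurableType d)
    (P : forall n, probability (T n) R)
    (X : forall n, 'I_n -> 'I_(p n) -> {RV (P n) >-> R})
    (eps : forall n, 'I_n -> {RV (P n) >-> R}) :
  -1 < rho < 1 -> 0 < s2eps -> 0 < c ->
  (fun n => (p n)%:R : R) @ \oo --> +oo ->
  (fun n => (p n)%:R / n%:R : R) @ \oo --> c ->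
  cvg (series (fun j => beta j ^+ 2) @ \oo) ->
  (* rows X_1, ..., X_n are i.i.d. N_p(0, Sigma) *)
  (forall n, mutual_indep (P n) (fun (i : 'I_n) (j : 'I_(p n)) w => X n i j w)) ->
  (forall n (i : 'I_n), gauss_vec (P n) (fun (j : 'I_(p n)) w => X n i j w)
                          (fun k l => sig_entry rho k l)) ->
  (* eps ~ N(0, s2eps I_n), independent of X *)
  (forall n, gauss_vec (P n) (fun (i : 'I_n) w => eps n i w)
                          (fun i j => s2eps * (i == j)%:R)) ->
  (forall n, indep2 (P n) (fun (ij : 'I_n * 'I_(p n)) w => X n ij.1 ij.2 w)
                          (fun (i : 'I_n) w => eps n i w)) ->
  let k1 := limn (fun q => kappa1 beta rho q) in
  let k2 := limn (fun q => kappa2 beta rho q) in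
  let k3 := limn (fun q => kappa3 beta rho q) in
  let s2 := 4 * k2 ^+ 2 + 4 * (k1 + s2eps) * (2 * k2 * c + k3)
            + 2 * c * (k1 + s2eps) ^+ 2 * (c + (1 + rho ^+ 2) / (1 - rho ^+ 2)) in
  (* Y = X beta + eps ;  stat = ||X'Y||_2^2 *)
  let Yv := fun n (i : 'I_n) (w : T n) =>
              \sum_(j < p n) X n i j w * beta j + eps n i w in
  let stat := fun n (w : T n) =>
              \sum_(k < p n) (\sum_(i < n) X n i k w * Yv n i w) ^+ 2 in
  cvg_in_distribution P
    (fun n w => (stat n w - n%:R ^+ 2 * kappa2 beta rho (p n)
                 - (p n)%:R * n%:R * (kappa1 beta rho (p n) + s2eps))
                / (n%:R * Num.sqrt n%:R))
    (gauss_law s2).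
Proof.
move=> rho1 s0 c0 py pc cb iX gX ge iXe k1 k2 k3 s2 Yv stat.
have rhoN : `|rho| < 1 by rewrite ltr_norml.
pose B := limn (series (fun j => beta j ^+ 2)).
have betaB q : \sum_(l < q) beta l ^+ 2 <= B.
  have H := @nondecreasing_cvgn_le _ (series (fun j => beta j ^+ 2)).
  rewrite -(big_mkord xpredT (fun l => beta l ^+ 2)); apply: H => //.
  by apply/nondecreasing_seqP => n; rewrite seriesSr lerDl sqr_ge0.
have mX n i j : measurable_fun setT (X n i j) by [].
have me n i : measurable_fun setT (eps n i) by [].
have k1_ge0 n : (0 < n)%N -> 0 <= kappa1 beta rho (p n).
  by move=> n0; apply: (@kappa1_ge0 _ _ _ (P n) n (p n) rho beta (fun i j w => X n i j w)).
have k3_ge0 n : (0 < n)%N -> 0 <= kappa3 beta rho (p n).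
  by move=> n0; apply: (@kappa3_ge0 _ _ _ (P n) n (p n) rho beta (fun i j w => X n i j w)).
have K1 : 0 <= k1 by exact: (lim_kappa1_ge0 rhoN betaB py k1_ge0).
have K2 : 0 <= k2 by exact: (lim_kappa2_ge0 rhoN betaB py).
have K3 : 0 <= k3 by exact: (lim_kappa3_ge0 rhoN betaB py k3_ge0).
have t0 : 0 < k1 + s2eps by rewrite ltr_wpDl.
have rho2 : 0 < 1 - rho ^+ 2.
  by rewrite subr_gt0 -[rho ^+ 2](real_normK (num_real _)) expr_lt1.
(* The last summand is positive because [c > 0]; thus [gauss_law s2] is a genuine normal law and not
   the point mass. *)
have v0 : 0 < s2.
  rewrite /s2 ltr_wpDl//.
    rewrite addr_ge0//; first by rewrite mulr_ge0// sqr_ge0.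
    by rewrite mulr_ge0 ?(mulr_ge0, ltW t0)// addr_ge0// mulr_ge0 ?mulr_ge0// ltW.
  rewrite mulr_gt0// ?mulr_gt0// ?exprn_gt0//.
  by rewrite ltr_wpDr// divr_ge0 ?(ltW rho2)// addr_ge0// sqr_ge0.
pose sg := Num.sqrt s2.
have sg0 : 0 < sg by rewrite sqrtr_gt0.
have sg2 : sg ^+ 2 = s2 by rewrite sqr_sqrtr// ltW.
pose Z n : T n -> R := reg_stat rho s2eps beta (fun i j w => X n i j w) (fun i w => eps n i w).
have mZ n : measurable_fun setT (Z n) by exact: measurable_reg_stat.
(* The slope is fixed while [n] grows: the error carries the factor [m] from the Lipschitz bound and
   a constant [K] that depends on the ramp. *)
have main z m : (fun n => \int[P n]_w step z m (Z n w)) @ \oo -->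
    \int[normal_prob 0 sg]_y step z m y.
  have [f [df [K [cf cdf fK Df fE]]]] := stein_solution sg0 (@continuous_step R z m) (step01 z m).
  rewrite sg2 in fE.
  have K0 : 0 <= K by have [_] := fK 0; exact: le_trans.
  have sv := cvg_stein_var rhoN betaB s0 py pc k1_ge0.
  have c2 : (fun n => kappa2 beta rho (p n)) @ \oo --> k2.
    by apply: cvg_comp (cvg_kappa2 rhoN betaB); apply/(@cvgrnyP R).
  have cs : (fun n => (Num.sqrt n%:R)^-1 : R) @ \oo --> (0 : R).
    apply/gtr0_cvgV0; first by exists 1%N => // n /= n0; rewrite sqrtr_gt0 ltr0n.
    apply/cvgryPge => A; near=> n; rewrite (le_trans (ler_norm _))// -sqrtr_sqr ler_wsqrtr//.
    near: n; exact: nbhs_infty_ger.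
  apply/cvgrPdist_le => e e0.
  (* Chosen so that [K * e1 <= e / 2]; the [+ 1] avoids a division by 0. With [e1] fixed, the
     variance bound divided by it still tends to 0. *)
  pose e1 := e / (2 * (K + 1)).
  have K1' : 0 < K + 1 by rewrite ltr_wpDl.
  have e10 : 0 < e1 by rewrite divr_gt0// mulr_gt0.
  have rem : (fun n => K / e1 * stein_var n (@cov_seq R rho s2eps beta p n) (tau_seq rho s2eps beta p n)
      (@coef_seq R rho s2eps beta p n) (slope_seq rho s2eps beta p n) s2
      + m%:R * (3 * kappa2 beta rho (p n) * (Num.sqrt n%:R)^-1)) @ \oo --> (0 : R).
    rewrite -[X in _ --> X]addr0; apply: cvgD.
      rewrite -[X in _ --> X](mulr0 (K / e1)); apply: cvgM; [exact: cvg_cst|exact: sv].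
    rewrite -[X in _ --> X](mulr0 m%:R); apply: cvgM; first exact: cvg_cst.
    rewrite -[X in _ --> X](mulr0 (3 * k2)); apply: cvgM => //.
    by apply: cvgM => //; exact: cvg_cst.
  have e2 : 0 < e / 2 by rewrite divr_gt0.
  near=> n.
  have n0 : (0 < n)%N by near: n; exists 1%N.
  rewrite distrC.
  have RS := regression_step beta (mX n) (me n) (iX n) (gX n) (ge n) (iXe n) n0 s0
    e10 cf cdf fK Df fE.
  apply: (le_trans RS).
  have rn : K / e1 * stein_var n (@cov_seq R rho s2eps beta p n) (tau_seq rho s2eps beta p n)
      (@coef_seq R rho s2eps beta p n) (slope_seq rho s2eps beta p n) s2
      + m%:R * (3 * kappa2 beta rho (p n) * (Num.sqrt n%:R)^-1) <= e / 2.
    by near: n; exact: (cvgr_le 0 rem).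
  have Ke : K * e1 <= e / 2.
    rewrite /e1 mulrA ler_pdivrMr ?mulr_gt0// mulrC.
    by rewrite (_ : e / 2 * (2 * (K + 1)) = e * (K + 1)); [rewrite ler_wpM2l ?(ltW e0)// lerDl|field].
  rewrite mulrDr -addrA [leRHS]splitr lerD// (le_trans _ rn)// lerD2r.
  by rewrite mulrA mulrAC.
move=> x; rewrite /gauss_law gt_eqF//= => cx.
have cdfE b : normal_prob 0 sg `]-oo, b]%classic = normal_prob 0 sg [set y | y <= b].
  by congr (normal_prob _ _ _); apply/seteqP; split => y /=; rewrite in_itv.
have mid : measurable_fun setT (@idfun R) by exact: measurable_id.
apply/cvgrPdist_le => e e0; have e2 : 0 < e / 2 by rewrite divr_gt0.
have /cvgrPdist_le /(_ _ e2) cxe := cx.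
have cV : (fun m => m.+1%:R^-1 : R) @ \oo --> (0 : R) by exact: cvg_harmonic.
have cxp : (fun m => x + m.+1%:R^-1) @ \oo --> x.
  by rewrite -[X in _ --> X]addr0; apply: cvgD => //; exact: cvg_cst.
have cxm : (fun m => x - m.+1%:R^-1) @ \oo --> x.
  by rewrite -[X in _ --> X]subr0; apply: cvgB => //; exact: cvg_cst.
pose F b := fine (normal_prob 0 sg `]-oo, b]%classic).
(* Continuity of the limit distribution function at [x] fixes one ramp width [1 / (m + 1)] that
   serves on both sides, before [n] is taken large. *)
have n1 : \forall m \near \oo, `|F x - F (x + m.+1%:R^-1)| <= e / 2 by exact: cxp _ cxe.
have n2 : \forall m \near \oo, `|F x - F (x - m.+1%:R^-1)| <= e / 2 by exact: cxm _ cxe.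
have [m [Hp Hm]] : exists m : nat,
    `|F x - F (x + m.+1%:R^-1)| <= e / 2 /\ `|F x - F (x - m.+1%:R^-1)| <= e / 2.
  by have [M _ /(_ M (leqnn _)) [h1 h2]] := filterI n1 n2; exists M.
have /cvgrPdist_le /(_ _ e2) mp := main (x + m.+1%:R^-1) m.+1.
have /cvgrPdist_le /(_ _ e2) mm := main x m.+1.
near=> n.
have up := le_Rintegral_step (P n) (mZ n) x (ltn0Sn m).
have low := Rintegral_step_le (P n) (mZ n) x m.+1.
have upN := Rintegral_step_le (normal_prob 0 sg) mid (x + m.+1%:R^-1) m.+1.
have lowN := le_Rintegral_step (normal_prob 0 sg) mid (x - m.+1%:R^-1) (ltn0Sn m).
rewrite subrK in lowN.
have h1 : `|\int[normal_prob 0 sg]_y step (x + m.+1%:R^-1) m.+1 y -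
   \int[P n]_w step (x + m.+1%:R^-1) m.+1 (Z n w)| <= e / 2 by near: n.
have h2 : `|\int[normal_prob 0 sg]_y step x m.+1 y -
   \int[P n]_w step x m.+1 (Z n w)| <= e / 2 by near: n.
apply: sandwich up low h1 h2 _ _ Hp Hm; rewrite /F cdfE; [exact: upN|exact: lowN].
Unshelve. all: end_near. Qed.
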